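(* For every integer $m\geq 2$ and every integer $n\geq 1$ there exists a simple $m$-dimensional $n$-Venn diagram.
   Context: An $m$-space is a subset of a Euclidean space that can be transformed continuously (homeomorphically) onto an $m$-dimensional rectangle (bounded case) or onto an $m$-dimensional subspace (unbounded case). An $m$-surface is a subset of an $m$-space homeomorphic to the $(m-1)$-dimensional sphere; by convention an $m$-surface is the empty set when $m\leq 0$. For an $m$-surface $S$, $S^0$ denotes its interior and $S^1$ its exterior. Given $m$-surfaces $S_1,\ldots,S_n$ in an $m$-space $S$, the regions are the sets $S_1^{\varepsilon_1}\cap\cdots\cap S_n^{\varepsilon_n}$ with $\varepsilon_i\in\{0,1\}$. The set $\{S_1,\ldots,S_n\}$ is an $m$-dimensional Venn diagram ($n$-Venn diagram) if all $2^n$ regions are non-empty and connected and each can be transformed continuously onto the interior or exterior of an $m$-surface, and the intersection of any two of the surfaces is a union of finitely many $(m-1)$-surfaces. It is a simple Venn diagram if, for every $k$, the intersection of any $k$ of the surfaces is a union of finitely many $(m-k+1)$-surfaces. *)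

(* Defs.v *)
(* MathComp-Analysis; Euclidean d-space is 'rV[R]_d for R : realType.  Its norm
   is the sup norm, which is used only through the topology and the bounded sets
   it induces; the round sphere is defined with the sum of squares. *)
From HB Require Import structures.
From mathcomp Require Import all_boot all_order all_algebra.
From mathcomp Require Import all_classical all_reals all_analysis.

Set Implicit Arguments.
Unset Strict Implicit.
Unset Printing Implicit Defensive.

Import Order.TTheory GRing.Theory Num.Theory.
Import numFieldNormedType.Exports.

Local Open Scope classical_set_scope.
Local Open Scope ring_scope.

(* [A] and [B] carry their subspace topologies; the values of [f] outside [A]
   and of [g] outside [B] are irrelevant. *)
Definition homeomorphism_on (U V : topologicalType) (A : set U) (B : set V)
    (f : U -> V) : Prop :=
  [/\ set_bij A B f, {within A, continuous f} &
      exists g : V -> U,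
        {within B, continuous g} /\ (forall x, A x -> g (f x) = x)].

Definition homeomorphic (U V : topologicalType) (A : set U) (B : set V) : Prop :=
  exists f : U -> V, homeomorphism_on A B f.

Section Spaces.
Variable R : realType.

Definition rectangle (m : nat) (a b : 'rV[R]_m) : set 'rV[R]_m :=
  [set x | forall i, a 0 i <= x 0 i <= b 0 i].

Definition unit_sphere (m : nat) : set 'rV[R]_m :=
  [set x | \sum_(i < m) x 0 i ^+ 2 = 1].
Arguments unit_sphere m : clear implicits.

Section InEuclideanSpace.
Variable d : nat.
Implicit Types T X : set 'rV[R]_d.

(* An m-dimensional subspace is linearly homeomorphic to 'rV_m, so the
   unbounded case is expressed by a homeomorphism onto all of 'rV_m. *)
Definition chart (m : nat) T (h : 'rV[R]_d -> 'rV[R]_m) : Prop :=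
  (exists a b : 'rV[R]_m,
     (forall i, a 0 i < b 0 i) /\ homeomorphism_on T (rectangle a b) h)
  \/ homeomorphism_on T [set: 'rV[R]_m] h.

Definition mspace (m : nat) T : Prop :=
  exists h : 'rV[R]_d -> 'rV[R]_m, chart T h.

Definition surface_in (m : nat) T X : Prop :=
  if m is 0%N then X = set0
  else [/\ mspace m T, X `<=` T & homeomorphic X (unit_sphere m)].

Definition surface (m : nat) X : Prop := exists T, surface_in m T X.

(* The interior of [X] in the m-space [T]: after transporting [X] to 'rV_m by a
   chart of [T], the bounded part of the complement of the image of [X] given by
   the Jordan-Brouwer theorem.  The complement is taken in all of 'rV_m rather
   than in the image of [T], so that the definition is also correct when that
   image is a rectangle, where every component would be bounded.  The result
   does not depend on the chart. *)
Definition surface_interior (m : nat) T X : set 'rV[R]_d :=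
  [set x | [/\ T x, ~ X x &
     exists h : 'rV[R]_d -> 'rV[R]_m,
       chart T h /\ bounded_set (connected_component (~` (h @` X)) (h x))]].

Definition surface_exterior (m : nat) T X : set 'rV[R]_d :=
  T `\` (X `|` surface_interior m T X).

(* [false] selects the interior (exponent 0), [true] the exterior (exponent 1). *)
Definition side (m : nat) T X (e : bool) : set 'rV[R]_d :=
  if e then surface_exterior m T X else surface_interior m T X.

Definition region (m n : nat) T (S : 'I_n -> set 'rV[R]_d) (e : 'I_n -> bool) :
    set 'rV[R]_d :=
  \bigcap_(i in [set: 'I_n]) side m T (S i) (e i).

(* The number of surfaces in the union may be zero. *)
Definition finite_union_of_surfaces (m : nat) X : Prop :=
  exists (p : nat) (C : 'I_p -> set 'rV[R]_d),
    (forall j, surface m (C j)) /\ X = \bigcup_(j in [set: 'I_p]) C j.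

(* The set {S_1, ..., S_n} is given as a family; non-emptiness of all regions
   forces its members to be pairwise distinct. *)
Definition venn_diagram (m n : nat) T (S : 'I_n -> set 'rV[R]_d) : Prop :=
  [/\ mspace m T,
      forall i, surface_in m T (S i),
      forall e : 'I_n -> bool,
        [/\ region m T S e !=set0,
            connected (region m T S e) &
            exists X, surface_in m T X /\
              (homeomorphic (region m T S e) (surface_interior m T X) \/
               homeomorphic (region m T S e) (surface_exterior m T X))] &
      forall i j : 'I_n, i != j ->
        finite_union_of_surfaces m.-1 (S i `&` S j)].

(* [m.+1 - k] is truncated subtraction: for k > m it is 0, and 0-surfaces are
   empty, as are j-surfaces for negative j. *)
Definition simple_venn_diagram (m n : nat) T (S : 'I_n -> set 'rV[R]_d) : Prop :=
  venn_diagram m T S /\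
  forall (k : nat) (A : {set 'I_n}), (0 < k)%N -> #|A| = k ->
    finite_union_of_surfaces (m.+1 - k) (\bigcap_(i in [set` A]) S i).

End InEuclideanSpace.
End Spaces.

(* Main.v *)
Require Import Defs.
From mathcomp Require Import all_boot all_order all_algebra.
From mathcomp Require Import all_classical all_reals all_analysis.
From mathcomp Require Import ring lra zify.

Set Implicit Arguments.
Unset Strict Implicit.
Unset Printing Implicit Defensive.

Import Order.TTheory GRing.Theory Num.Theory.
Import numFieldNormedType.Exports.

Local Open Scope classical_set_scope.
Local Open Scope ring_scope.

(* Take T = R^m.  The k-th surface is [|y| = 2 + F_k q], the boundary of a domain
   star-shaped about the origin, where q in R^(m-1) is the stereographic coordinate
   of the direction of y.  Write q = (x, z) with x real and z in R^(m-2).  Then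
   F_k (x, z) = a_k max (u_k x, v_k |z|), where u_k is a wave with values +1 and -1
   outside short transition zones, the signs of u_0, ..., u_(n-1) run through a Gray
   code, the amplitudes a_k decrease rapidly, and v_k goes from -1 to 1 when |z|
   crosses n - k, which flattens the k-th wave; for m = 2 this is Edwards' Venn
   diagram.

   An open set whose slices in some of the coordinates are star-shaped about a fixed
   point is homeomorphic to the cylinder over its trace on that point, so a region is
   an open ball as soon as this applies to its coordinates successively.  In the
   coordinates (|y|, x, z) the slices in x are intervals by the Gray code property,
   then those in z are balls, and the trace is an interval of radii.  This fails only
   for the regions inside the first j surfaces and outside the others, which contain
   the pole of the projection; they are star-shaped about that pole.

   Two surfaces meet along small perturbations of boundaries of boxes in the q-space,
   three of them in finitely many spheres [x = x0, |z| = r], and four never meet. *)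

(** * Homeomorphisms, gauges and fibres *)

(** From dimension three on, a domain bounded by a topological sphere need not be a ball, so every
    region is straightened explicitly, and the surfaces are shaped for that purpose.

    Two separations do most of the work. The transitions of [wave i] sit at odd multiples of
    [width i]; for [j > i] these are even multiples of [width j], around which [wave j] is constant.
    And once [wall i] has left -1, every later wall is already at 1. So where an earlier surface
    moves, a later one moves as little as possible.

    The decreasing amplitudes serve three ends. A surface whose wave has the fully wrong value
    either settles the later inequalities or, through its wall, makes the later surfaces constant.
    Over the pole the heights are the amplitudes themselves, in decreasing order, so a point there
    inside one surface is inside all earlier ones, which leaves only initial segments. Finally, the
    ratio [2 * n.+1%:R] makes the slope of an earlier wave beat that of a later wall along rays. *)

Record homeo (U V : topologicalType) (A : set U) (B : set V)
    (f : U -> V) (g : V -> U) : Prop := Homeo {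
  homeo_fwd : forall x, A x -> B (f x);
  homeo_bwd : forall y, B y -> A (g y);
  homeo_can : forall x, A x -> g (f x) = x;
  homeo_canV : forall y, B y -> f (g y) = y;
  homeo_cont : {within A, continuous f};
  homeo_contV : {within B, continuous g} }.

Section Homeomorphisms.
Implicit Types U V W : topologicalType.

Lemma homeo_on U V (A : set U) (B : set V) f g :
  homeo A B f g -> homeomorphism_on A B f.
Proof.
move=> h; split; [split|exact: homeo_cont h|].
- by move=> x; apply: (homeo_fwd h).
- move=> x y; rewrite !inE => Ax Ay fxy.
  by rewrite -(homeo_can h Ax) -(homeo_can h Ay) fxy.
- by move=> y By; exists (g y); [exact: (homeo_bwd h)|exact: (homeo_canV h)].
- by exists g; split; [exact: homeo_contV h|exact: (homeo_can h)].
Qed.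

Lemma homeomorphism_onP U V (A : set U) (B : set V) f :
  homeomorphism_on A B f -> exists g, homeo A B f g.
Proof.
move=> [[fAB _ fsurj] cf [g [cg gf]]]; exists g; split => //.
- by move=> y /fsurj [x Ax <-]; rewrite gf.
- by move=> y /fsurj [x Ax <-]; rewrite gf.
Qed.

Lemma homeo_homeomorphic U V (A : set U) (B : set V) f g :
  homeo A B f g -> homeomorphic A B.
Proof. by move=> /homeo_on; exists f. Qed.

Lemma homeo_sym U V (A : set U) (B : set V) f g :
  homeo A B f g -> homeo B A g f.
Proof. by case. Qed.

Lemma homeo_id U (A : set U) : homeo A A id id.
Proof. by split => //; apply: continuous_subspaceT => x; exact: cvg_id. Qed.

Lemma within_comp U V W (A : set U) (B : set V) (f : U -> V) (g : V -> W) :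
  (forall x, A x -> B (f x)) -> {within A, continuous f} ->
  {within B, continuous g} -> {within A, continuous (g \o f)}.
Proof.
move=> fAB /subspace_continuousP cf /subspace_continuousP cg.
apply/subspace_continuousP => x Ax O /= /(cg _ (fAB _ Ax)) gO.
have := cf _ Ax _ gO; rewrite /nbhs /= /within /= => h.
by near=> z => Az; apply: (near h z) => //; exact: fAB.
Unshelve. all: by end_near. Qed.

Lemma homeo_comp U V W (A : set U) (B : set V) (C : set W) f g f' g' :
  homeo A B f g -> homeo B C f' g' -> homeo A C (f' \o f) (g \o g').
Proof.
move=> h h'; split => /=.
- by move=> x /(homeo_fwd h)/(homeo_fwd h').
- by move=> x /(homeo_bwd h')/(homeo_bwd h).
- move=> x Ax; rewrite (homeo_can h') ?(homeo_can h)//; exact: (homeo_fwd h).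
- move=> x Cx; rewrite (homeo_canV h) ?(homeo_canV h')//; exact: (homeo_bwd h').
- exact: (within_comp (homeo_fwd h) (homeo_cont h) (homeo_cont h')).
- exact: (within_comp (homeo_bwd h') (homeo_contV h') (homeo_contV h)).
Qed.

Lemma homeo_sub U V (A A' : set U) (B B' : set V) f g :
  homeo A B f g -> A' `<=` A -> B' `<=` B ->
  (forall x, A' x -> B' (f x)) -> (forall y, B' y -> A' (g y)) ->
  homeo A' B' f g.
Proof.
move=> h sA sB fA gB; split => //.
- by move=> x /sA; exact: homeo_can h _.
- by move=> x /sB; exact: homeo_canV h _.
- exact: (continuous_subspaceW sA (homeo_cont h)).
- exact: (continuous_subspaceW sB (homeo_contV h)).
Qed.

Lemma homeo_pointwise U V (A : set U) (B : set V) f g :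
  (forall x, A x -> B (f x)) -> (forall y, B y -> A (g y)) ->
  (forall x, A x -> g (f x) = x) -> (forall y, B y -> f (g y) = y) ->
  (forall x, A x -> {for x, continuous f}) ->
  (forall y, B y -> {for y, continuous g}) -> homeo A B f g.
Proof.
move=> fAB gBA gf fg cf cg; split => //; apply: continuous_in_subspaceT.
- by move=> x; rewrite inE; exact: cf.
- by move=> x; rewrite inE; exact: cg.
Qed.

Lemma homeomorphic_refl U (A : set U) : homeomorphic A A.
Proof. exact: (homeo_homeomorphic (homeo_id A)). Qed.

Lemma homeomorphic_sym U V (A : set U) (B : set V) :
  homeomorphic A B -> homeomorphic B A.
Proof.
by move=> [f /homeomorphism_onP[g /homeo_sym /homeo_homeomorphic]].
Qed.

Lemma homeomorphic_trans U V W (A : set U) (B : set V) (C : set W) :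
  homeomorphic A B -> homeomorphic B C -> homeomorphic A C.
Proof.
move=> [f /homeomorphism_onP[g h]] [f' /homeomorphism_onP[g' h']].
exact: (homeo_homeomorphic (homeo_comp h h')).
Qed.

Lemma homeomorphic_connected U V (A : set U) (B : set V) :
  homeomorphic A B -> connected A -> connected B.
Proof.
move=> [f /homeomorphism_onP[g h]] cA.
have -> : B = f @` A.
  apply/seteqP; split=> [y By|_ [x Ax <-]]; last exact: (homeo_fwd h).
  by exists (g y); [exact: (homeo_bwd h)|exact: (homeo_canV h)].
exact: connected_continuous_connected (homeo_cont h).
Qed.

Lemma homeomorphic_nonempty U V (A : set U) (B : set V) :
  homeomorphic A B -> A !=set0 -> B !=set0.
Proof.
by move=> [f /homeomorphism_onP[g h]] [x Ax]; exists (f x); exact: (homeo_fwd h).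
Qed.

(** The inverse pulls a closed set [C] back to the image of the compact part of [A] in [C], which is
    closed in a Hausdorff space. *)
Lemma compact_homeomorphic U V (A : set U) (f : U -> V) :
  hausdorff_space V -> A !=set0 -> compact A -> {within A, continuous f} ->
  {in A &, injective f} -> homeomorphic A (f @` A).
Proof.
move=> hV [a0 Aa0] cA cf finj.
pose g y := if pselect (exists2 x, A x & f x = y) is left e
  then s2val (cid2 e) else a0.
have gP y : (f @` A) y -> A (g y) /\ f (g y) = y.
  by rewrite /g; case: pselect => // e _; case: cid2.
apply: (@homeo_homeomorphic _ _ _ _ f g); split.
- by move=> x Ax; exists x.
- by move=> y /gP[].
- move=> x Ax; have [|Ag fg] := gP (f x); first by exists x.
  by apply: finj; rewrite ?inE.
- by move=> y /gP[].
- by [].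
- apply/continuous_closedP => C cC; apply/closed_subspaceP.
  exists (f @` (A `&` C)).
    apply: compact_closed => //; apply: continuous_compact.
      by apply: continuous_subspaceW cf => x [].
    exact: compact_closedI.
  apply/seteqP; split=> [_ [[x [Ax Cx] <-] fA]|y [Cy fAy]].
    split => //; have [Ag fg] := gP _ fA.
    by have e : g (f x) = x by [apply: finj; rewrite ?inE]; change (C (g (f x))); rewrite e.
  by split => //; have [Ag fg] := gP _ fAy; exists (g y).
Qed.

End Homeomorphisms.

(** * Continuity at a point, in applicative form *)

Section ContinuityAt.
Variables (R : realType) (T : topologicalType).
Implicit Types (V : normedModType R) (x : T).

Lemma ct_cst (U : topologicalType) (c : U) x : {for x, continuous (fun _ : T => c)}.
Proof. exact: cvg_cst. Qed.

Lemma ct_id x : {for x, continuous (fun y : T => y)}.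
Proof. exact: cvg_id. Qed.

Lemma ct_comp (U W : topologicalType) (f : T -> U) (g : U -> W) x :
  {for x, continuous f} -> {for f x, continuous g} ->
  {for x, continuous (fun y => g (f y))}.
Proof. exact: continuous_comp. Qed.

Lemma ctD V (f g : T -> V) x : {for x, continuous f} ->
  {for x, continuous g} -> {for x, continuous (fun y => f y + g y : V)}.
Proof. by move=> cf cg; exact: cvgD. Qed.

Lemma ctB V (f g : T -> V) x : {for x, continuous f} ->
  {for x, continuous g} -> {for x, continuous (fun y => f y - g y : V)}.
Proof. by move=> cf cg; exact: cvgB. Qed.

Lemma ctDr (f g : T -> R) x : {for x, continuous f} ->
  {for x, continuous g} -> {for x, continuous (fun y => f y + g y : R)}.
Proof. by move=> cf cg; exact: cvgD. Qed.

Lemma ctBr (f g : T -> R) x : {for x, continuous f} ->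
  {for x, continuous g} -> {for x, continuous (fun y => f y - g y : R)}.
Proof. by move=> cf cg; exact: cvgB. Qed.

Lemma ctZ V (f : T -> R) (g : T -> V) x : {for x, continuous f} ->
  {for x, continuous g} -> {for x, continuous (fun y => f y *: g y : V)}.
Proof. by move=> cf cg; exact: cvgZ. Qed.

Lemma ctM (f g : T -> R) x : {for x, continuous f} ->
  {for x, continuous g} -> {for x, continuous (fun y => f y * g y : R)}.
Proof. by move=> cf cg; exact: cvgM. Qed.

Lemma ctV (f : T -> R) x : f x != 0 -> {for x, continuous f} ->
  {for x, continuous (fun y => (f y)^-1 : R)}.
Proof. by move=> fx cf; exact: cvgV. Qed.

Lemma ct_norm V (f : T -> V) x : {for x, continuous f} ->
  {for x, continuous (fun y => `|f y| : R)}.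
Proof. by move=> cf; exact: cvg_norm. Qed.

Lemma ct_max (f g : T -> R) x : {for x, continuous f} ->
  {for x, continuous g} -> {for x, continuous (fun y => Num.max (f y) (g y) : R)}.
Proof. by move=> cf cg; exact: continuous_max. Qed.

Lemma ct_min (f g : T -> R) x : {for x, continuous f} ->
  {for x, continuous g} -> {for x, continuous (fun y => Num.min (f y) (g y) : R)}.
Proof. by move=> cf cg; exact: continuous_min. Qed.

Lemma ct_eq (U : topologicalType) (f g : T -> U) x : f =1 g ->
  {for x, continuous f} -> {for x, continuous g}.
Proof. by move=> /funext ->. Qed.

Lemma ct_near_eq (U : topologicalType) (f g : T -> U) (A : set T) x :
  open A -> A x -> (forall z, A z -> f z = g z) ->
  {for x, continuous f} -> {for x, continuous g}.
Proof.
move=> oA Ax fg cf; rewrite /prop_for /continuous_at -(fg _ Ax).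
apply: cvg_trans cf; apply: near_eq_cvg.
by apply: filterS (open_nbhs_nbhs (conj oA Ax)) => z /fg.
Qed.

Lemma ct_dominated (f g : T -> R) x : (forall z, `|f x - f z| <= g z) ->
  g x = 0 -> {for x, continuous g} -> {for x, continuous f}.
Proof.
move=> fg gx /cvgrPdist_lt cg; apply/cvgrPdist_lt => e /cg; apply: filterS => z.
rewrite gx sub0r normrN => /(le_lt_trans (ler_norm _)).
exact: le_lt_trans (fg z).
Qed.

Lemma ct_sum (I : Type) (s : seq I) (f : I -> T -> R) x :
  (forall i, {for x, continuous (f i)}) ->
  {for x, continuous (fun y => \sum_(i <- s) f i y : R)}.
Proof.
move=> cf; elim: s => [|i s IH].
  by refine (ct_eq _ (@ct_cst R 0 x)) => y; rewrite big_nil.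
by apply: (ct_eq _ (ctD (cf i) IH)) => y; rewrite big_cons.
Qed.

Lemma ct_bigmin (I : Type) (r : seq I) (P : pred I) (c : R) (f : I -> T -> R) x :
  (forall i, {for x, continuous (f i)}) ->
  {for x, continuous (fun y => \big[Num.min/c]_(i <- r | P i) f i y : R)}.
Proof.
move=> cf; elim: r => [|i r IH].
  by apply: (@ct_eq R (fun=> c : R)); [move=> y; rewrite big_nil|exact: (@ct_cst R c x)].
have [Pi|Pi] := boolP (P i).
  apply: (@ct_eq R (fun y => Num.min (f i y) (\big[Num.min/c]_(j <- r | P j) f j y))).
    by move=> y; rewrite big_cons Pi.
  exact: ct_min.
by apply: (ct_eq _ IH) => y; rewrite big_cons (negPf Pi).
Qed.

Lemma ct_bigmax (I : Type) (r : seq I) (P : pred I) (c : R) (f : I -> T -> R) x :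
  (forall i, {for x, continuous (f i)}) ->
  {for x, continuous (fun y => \big[Num.max/c]_(i <- r | P i) f i y : R)}.
Proof.
move=> cf; elim: r => [|i r IH].
  by apply: (@ct_eq R (fun=> c : R)); [move=> y; rewrite big_nil|exact: (@ct_cst R c x)].
have [Pi|Pi] := boolP (P i).
  apply: (@ct_eq R (fun y => Num.max (f i y) (\big[Num.max/c]_(j <- r | P j) f j y))).
    by move=> y; rewrite big_cons Pi.
  exact: ct_max.
by apply: (ct_eq _ IH) => y; rewrite big_cons (negPf Pi).
Qed.

Lemma ct_row (m : nat) (f : T -> 'rV[R]_m) x :
  (forall i, {for x, continuous (fun y => f y 0 i : R)}) -> {for x, continuous f}.
Proof.
move=> cf; apply/cvg_ballP => e e0.
have : \forall y \near x, forall i, ball (f x 0 i) e (f y 0 i).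
  by apply: filter_forall => i; move/cvg_ballP: (cf i) => /(_ _ e0).
by apply: filterS => y fy; split => // i j; rewrite ord1.
Qed.

Lemma ct_coord (m : nat) (f : T -> 'rV[R]_m) x i :
  {for x, continuous f} -> {for x, continuous (fun y => f y 0 i : R)}.
Proof.
move=> cf; apply: (@ct_comp _ _ f (fun v : 'rV[R]_m => v 0 i)) => //.
exact: coord_continuous.
Qed.

Lemma ct_lt_open (f g : T -> R) : continuous f -> continuous g ->
  open [set x | f x < g x].
Proof.
move=> cf cg; rewrite (_ : [set _ | _] = (fun x => g x - f x) @^-1` [set t | 0 < t]).
  apply: open_comp; last exact: open_gt.
  by move=> x _; apply: ctB; [exact: cg|exact: cf].
by apply/seteqP; split => x /=; rewrite subr_gt0.
Qed.

Lemma ct_eq_closed (f g : T -> R) : continuous f -> continuous g ->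
  closed [set x | f x = g x].
Proof.
move=> cf cg; rewrite (_ : [set _ | _] = (fun x => g x - f x) @^-1` [set 0]).
  apply: preimage_closed; last exact: closed_eq.
  by move=> x _; apply: ctB; [exact: cg|exact: cf].
by apply/seteqP; split => x /= => [->|/eqP]; rewrite ?subrr// subr_eq0 => /eqP.
Qed.

End ContinuityAt.

(** * Sup norm, Euclidean norm and radial projection *)

Section RowVectors.
Variable R : realType.

Lemma normr_rowP (m : nat) (y : 'rV[R]_m) (C : R) : 0 <= C ->
  `|y| <= C <-> forall i, `|y 0 i| <= C.
Proof.
move=> C0; rewrite {1}/Num.norm /= mx_normrE; split => [/bigmax_leP[_ h] i|h].
  exact: (h (0, i)).
by apply/bigmax_leP; split => // -[i j] _ /=; rewrite ord1.
Qed.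

Lemma normr_row_le (m : nat) (y : 'rV[R]_m) i : `|y 0 i| <= `|y|.
Proof. exact: (@normr_rowP m y `|y| (normr_ge0 _)).1. Qed.

Definition enorm (m : nat) (y : 'rV[R]_m) : R := Num.sqrt (\sum_i y 0 i ^+ 2).

Lemma enorm_ge0 m (y : 'rV[R]_m) : 0 <= enorm y.
Proof. exact: sqrtr_ge0. Qed.

Lemma enorm_sqr m (y : 'rV[R]_m) : enorm y ^+ 2 = \sum_i y 0 i ^+ 2.
Proof. by rewrite sqr_sqrtr// sumr_ge0// => i _; rewrite sqr_ge0. Qed.

Lemma enorm_coord m (y : 'rV[R]_m) i : `|y 0 i| <= enorm y.
Proof.
rewrite -(@ler_pXn2r _ 2)// ?nnegrE ?enorm_ge0// enorm_sqr real_normK ?num_real//.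
by rewrite (bigD1 i)//= lerDl sumr_ge0// => j _; rewrite sqr_ge0.
Qed.

Lemma norm_le_enorm m (y : 'rV[R]_m) : `|y| <= enorm y.
Proof. by apply/normr_rowP => [|i]; [exact: enorm_ge0|exact: enorm_coord]. Qed.

Lemma enorm_gt0 m (y : 'rV[R]_m) : y != 0 -> 0 < enorm y.
Proof. by rewrite -normr_gt0 => /lt_le_trans; apply; exact: norm_le_enorm. Qed.

Lemma enorm0 m : enorm (0 : 'rV[R]_m) = 0.
Proof. by rewrite /enorm big1 ?sqrtr0// => i _; rewrite mxE expr0n. Qed.

Lemma enormZ m (a : R) (y : 'rV[R]_m) : 0 <= a -> enorm (a *: y) = a * enorm y.
Proof.
move=> a0; rewrite /enorm -[X in X * _](ger0_norm a0) -sqrtr_sqr -sqrtrM ?sqr_ge0//.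
by congr Num.sqrt; rewrite mulr_sumr; apply: eq_bigr => i _; rewrite mxE exprMn.
Qed.

Lemma enorm_continuous m : continuous (@enorm m).
Proof.
move=> y.
apply: (@ct_comp _ _ _ (fun y : 'rV[R]_m => \sum_i y 0 i ^+ 2 : R) Num.sqrt).
  apply: ct_sum => i.
  apply: (@ct_comp _ _ _ (fun y : 'rV[R]_m => y 0 i : R) (fun t : R => t ^+ 2)).
    exact: coord_continuous.
  exact: exprn_continuous.
exact: sqrt_continuous.
Qed.

Lemma unit_sphereE m : @unit_sphere R m = [set y | enorm y = 1].
Proof.
apply/seteqP; rewrite /unit_sphere; split => y /=.
  by rewrite /enorm => ->; rewrite sqrtr1.
by rewrite -enorm_sqr => ->; rewrite expr1n.
Qed.

(* A compact set meeting each ray from [c] exactly once projects radially and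
   homeomorphically onto the sphere, by compactness alone. *)
Lemma radial_sphere m (E : set 'rV[R]_m.+1) (c : 'rV[R]_m.+1) :
  compact E -> ~ E c ->
  (forall v, v != 0 -> exists2 a, 0 < a & E (c + a *: v)) ->
  (forall v a b, v != 0 -> 0 < a -> a < b -> E (c + a *: v) ->
     E (c + b *: v) -> False) ->
  homeomorphic E (@unit_sphere R m.+1).
Proof.
move=> cE nEc Eex Euniq.
pose f (y : 'rV[R]_m.+1) : 'rV[R]_m.+1 := (enorm (y - c))^-1 *: (y - c).
have Ene y : E y -> y - c != 0.
  by move=> Ey; apply/eqP => /subr0_eq e; apply: nEc; rewrite -e.
have fE y : E y -> y = c + enorm (y - c) *: f y.
  move=> /Ene /enorm_gt0 h; rewrite /f scalerA divff ?lt0r_neq0// scale1r.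
  by rewrite addrC subrK.
have f1 y : E y -> enorm (f y) = 1.
  move=> /Ene /enorm_gt0 h; rewrite enormZ ?invr_ge0 ?ltW// mulVf//.
  by rewrite lt0r_neq0.
have <- : f @` E = @unit_sphere R m.+1.
  rewrite unit_sphereE; apply/seteqP; split => [_ [y /f1 ? <-]//|v /= v1].
  have v0 : v != 0.
    by apply: contra_eq_neq v1 => ->; rewrite enorm0 eq_sym oner_eq0.
  have [a a0 Ea] := Eex v v0; exists (c + a *: v) => //.
  rewrite /f (addrC c) addrK enormZ ?ltW// v1 mulr1 scalerA mulVf ?scale1r//.
  by rewrite lt0r_neq0.
apply: (@compact_homeomorphic 'rV[R]_m.+1 'rV[R]_m.+1) => //.
- have [a _ Ea] : exists2 a, 0 < a & E (c + a *: const_mx 1).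
    by apply: Eex; apply/eqP => /rowP/(_ 0)/eqP; rewrite !mxE oner_eq0.
  by exists (c + a *: const_mx 1).
- apply: continuous_in_subspaceT => y; rewrite inE => Ey.
  have cB : {for y, continuous (fun y : 'rV[R]_m.+1 => y - c)}.
    by apply: ctB; [exact: ct_id|exact: ct_cst].
  apply: (@ctZ _ _ _ (fun y : 'rV[R]_m.+1 => (enorm (y - c))^-1)
    (fun y => y - c)) => //.
  apply: ctV; first by rewrite lt0r_neq0// enorm_gt0// Ene.
  by apply: (ct_comp (g := @enorm m.+1) cB); exact: enorm_continuous.
move=> x y; rewrite !inE => Ex Ey fxy.
have xE := fE _ Ex; have yE := fE _ Ey; rewrite -fxy in yE.
have f0 : f x != 0.
  by apply: contra_eq_neq (f1 _ Ex) => ->; rewrite enorm0 eq_sym oner_eq0.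
have [h|h|h] := ltgtP (enorm (x - c)) (enorm (y - c)).
- exfalso; apply: (Euniq _ _ _ f0 (enorm_gt0 (Ene _ Ex)) h);
    by rewrite -?xE -?yE.
- exfalso; apply: (Euniq _ _ _ f0 (enorm_gt0 (Ene _ Ey)) h);
    by rewrite -?xE -?yE.
- by rewrite [LHS]xE [RHS]yE h.
Qed.

End RowVectors.

(** * Gauges: their unit spheres, interiors and exteriors *)

Section Gauges.
Variable R : realType.

(** The Minkowski functionals of bounded star-shaped domains; evenness and subadditivity are not
    part of the notion. All surfaces of the diagram are unit spheres of gauges. *)
Record gauge (m : nat) (p : 'rV[R]_m -> R) : Prop := Gauge {
  gauge_continuous : continuous p;
  gaugeZ : forall a y, 0 <= a -> p (a *: y) = a * p y;
  gauge_bound : exists2 C, 0 < C & forall y, `|y| <= C * p y }.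

Lemma enorm_gauge m : gauge (@enorm R m).
Proof.
split; [exact: enorm_continuous|exact: enormZ|].
by exists 1 => // y; rewrite mul1r norm_le_enorm.
Qed.

Variables (m : nat) (p : 'rV[R]_m.+1 -> R).
Hypothesis hp : gauge p.

Lemma gauge_gt0 y : y != 0 -> 0 < p y.
Proof.
have [C C0 hC] := gauge_bound hp.
by rewrite -normr_gt0 => /lt_le_trans/(_ (hC y)); rewrite pmulr_rgt0.
Qed.

Lemma gauge0 : p 0 = 0.
Proof. by rewrite -(scale0r (0 : 'rV[R]_m.+1)) (gaugeZ hp)// mul0r. Qed.

Lemma gauge_neq0 y : 0 < p y -> y != 0.
Proof. by apply: contra_ltN => /eqP ->; rewrite gauge0. Qed.

Lemma compact_gauge_sphere : compact [set y | p y = 1].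
Proof.
have [C C0 hC] := gauge_bound hp.
apply: bounded_closed_compact.
  exists C; split; first exact: num_real.
  by move=> x Cx y /= py; rewrite (le_trans (hC y))// py mulr1 ltW.
by apply: ct_eq_closed; [exact: gauge_continuous|move=> ?; exact: ct_cst].
Qed.

Lemma gauge_sphere : homeomorphic [set y | p y = 1] (@unit_sphere R m.+1).
Proof.
apply: (@radial_sphere _ _ _ 0).
- exact: compact_gauge_sphere.
- by rewrite /= gauge0 => /esym/eqP; rewrite oner_eq0.
- move=> v /gauge_gt0 pv; exists (p v)^-1; first by rewrite invr_gt0.
  by rewrite /= add0r (gaugeZ hp) ?invr_ge0 ?ltW// mulVf// lt0r_neq0.
- move=> v a b v0 a0 ab /=; rewrite !add0r !(gaugeZ hp) ?ltW//; last first.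
    exact: lt_trans ab.
  move=> pa pb; have := ab; rewrite -(ltr_pM2r (gauge_gt0 v0)) pa pb.
  by rewrite ltxx.
Qed.

Lemma chart_setT : chart [set: 'rV[R]_m.+1] (@id 'rV[R]_m.+1).
Proof. by right; exact: homeo_on (homeo_id _). Qed.

Lemma mspace_setT : mspace m.+1 [set: 'rV[R]_m.+1].
Proof. by exists id; exact: chart_setT. Qed.

Lemma gauge_surface : surface_in m.+1 [set: 'rV[R]_m.+1] [set y | p y = 1].
Proof. by split => //; [exact: mspace_setT|exact: gauge_sphere]. Qed.

Lemma unbounded_ray (x : 'rV[R]_m.+1) (N : R) :
  x != 0 -> (forall a, 1 <= a -> `|a *: x| <= N) -> False.
Proof.
rewrite -normr_gt0 => x0 h.
have /h : 1 <= 1 + `|N| / `|x| by rewrite lerDl divr_ge0.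
rewrite normrZ ger0_norm; last by rewrite addr_ge0// divr_ge0.
rewrite mulrDl divfK ?lt0r_neq0// mul1r; have := ler_norm N; lra.
Qed.

Lemma compact_rectangle d (a b : 'rV[R]_d) : compact (rectangle a b).
Proof.
have := @rV_compact R d (fun i => [set` `[a 0 i, b 0 i]]) (fun i => @segment_compact _ _ _).
congr compact; apply/seteqP; split => x /= h i;
  by have := h i; rewrite in_itv.
Qed.

(** A rectangle is compact, so a chart onto one would make the whole space compact. Since
    [surface_interior] accepts any chart as a witness, this leaves only self-homeomorphisms of the
    space to consider. *)
Lemma chart_setT_homeo h : chart [set: 'rV[R]_m.+1] h ->
  homeomorphism_on [set: 'rV[R]_m.+1] [set: 'rV[R]_m.+1] h.
Proof.
case=> // -[a [b [_ /homeomorphism_onP[g hg]]]]; exfalso.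
have : compact (g @` rectangle a b).
  exact: continuous_compact (homeo_contV hg) (@compact_rectangle _ a b).
move=> /compact_bounded [N [_ hN]].
apply: (@unbounded_ray (const_mx 1) (N + 1)).
  by apply/eqP => /rowP/(_ 0)/eqP; rewrite !mxE oner_eq0.
move=> a' _; apply: (hN (N + 1)); first by rewrite ltrDl.
exists (h (a' *: const_mx 1)); first exact: (homeo_fwd hg).
exact: (homeo_can hg).
Qed.

Lemma connected_ray (x : 'rV[R]_m.+1) :
  connected ((fun a : R => a *: x) @` [set a | 1 <= a]).
Proof.
apply: connected_continuous_connected.
  apply/connected_intervalP => a b /= a1 b1 c /andP[ac cb].
  exact: le_trans ac.
apply: continuous_subspaceT => a.
apply: (@ctZ _ _ _ id (fun=> x)); [exact: ct_id|exact: ct_cst].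
Qed.

(** For [p x < 1] the identity is a suitable chart: a connected set leaving the unit ball crosses
    the level 1. For [p x > 1] the outward ray from [x] avoids the surface, and its image under any
    chart is unbounded because the inverse of the chart sends closed balls, which are compact, to
    bounded sets. *)
Lemma gauge_interior :
  surface_interior m.+1 [set: 'rV[R]_m.+1] [set y | p y = 1] = [set y | p y < 1].
Proof.
have [C C0 hC] := gauge_bound hp.
apply/seteqP; split => x /=.
  move=> [_ /= px [h [/chart_setT_homeo/homeomorphism_onP[g hg] [N [_ hN]]]]].
  have [//|px1|//] := ltgtP (p x) 1; exfalso.
  pose D := [set y : 'rV[R]_m.+1 | `|y| <= N + 1].
  have cD : compact D.
    apply: bounded_closed_compact.
      exists (N + 1); split; first exact: num_real.
      by move=> M NM y /= Dy; exact: le_trans Dy (ltW NM).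
    rewrite (_ : D = Num.norm @^-1` [set t | t <= N + 1])//.
    apply: preimage_closed; last exact: closed_le.
    by move=> y _; exact: norm_continuous.
  have /compact_bounded [M [_ hM]] : compact (g @` D).
    apply: continuous_compact => //.
    exact: continuous_subspaceW (homeo_contV hg).
  apply: (@unbounded_ray x (M + 1)).
    by apply: gauge_neq0; apply: lt_trans px1.
  move=> a a1; apply: (hM (M + 1)); first by rewrite ltrDl.
  exists (h (a *: x)); last exact: (homeo_can hg).
  apply: (hN (N + 1)); first by rewrite ltrDl.
  pose ray := (fun a : R => a *: x) @` [set a | 1 <= a].
  apply: (@connected_component_max _ _ (h @` ray)).
  - by exists x => //; exists 1; rewrite /= ?scale1r.
  - move=> _ [_ [b /= b1 <-] <-] [y /= py hy].
    have yE : y = b *: x by rewrite -(homeo_can hg (x := y))// hy (homeo_can hg).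
    move: py; rewrite yE (gaugeZ hp) ?(le_trans ler01)// => bpx.
    have : 1 < b * p x by rewrite (lt_le_trans px1)// ler_peMl// ltW// (lt_trans _ px1).
    by rewrite bpx ltxx.
  - apply: connected_continuous_connected; first exact: connected_ray.
    exact: continuous_subspaceW (homeo_cont hg).
  - by exists (a *: x) => //; exists a.
move=> px; split => //=; first by move=> e; rewrite e ltxx in px.
exists id; split; first exact: chart_setT.
exists C; split; first exact: num_real.
move=> M CM y; rewrite image_id => -[B [Bx BX cB] By].
apply: (le_trans (hC y)); apply: le_trans (ltW CM); rewrite ger_pMr//.
rewrite leNgt; apply/negP => py.
have /connected_intervalP itv : connected (p @` B).
  apply: connected_continuous_connected => //; apply: continuous_subspaceT.
  exact: gauge_continuous.
have [z Bz pz] : (p @` B) 1.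
  apply: (itv (p x) (p y)); [by exists x|by exists y|].
  by rewrite (ltW px) (ltW py).
exact: BX Bz pz.
Qed.

Lemma gauge_exterior :
  surface_exterior m.+1 [set: 'rV[R]_m.+1] [set y | p y = 1] = [set y | 1 < p y].
Proof.
rewrite /surface_exterior gauge_interior; apply/seteqP; split => x /=.
  by move=> [_ h]; have [px|//|px] := ltgtP (p x) 1; case: h; [right|left].
by move=> px; split => // -[/= e|/= h]; have := px; rewrite ?e ?ltxx// ltNge ltW.
Qed.

End Gauges.
Lemma ct_lipschitz (R : realType) (V : normedModType R) (f : V -> R) (A : set V) y :
  nbhs y A -> (forall w, A w -> `|f y - f w| <= `|y - w|) -> {for y, continuous f}.
Proof.
move=> yA hf; apply/cvgrPdist_lt => e e0.
apply: filterS (filterI yA (nbhsx_ballx y e e0)) => w [Aw].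
by rewrite -ball_normE /ball_ /= => /(le_lt_trans (hf _ Aw)).
Qed.

(** * Connectedness of star-shaped sets and of exteriors *)

Section Connectedness.
Variable R : realType.

Lemma star_connected (m : nat) (A : set 'rV[R]_m) c : A c ->
  (forall y t, A y -> 0 <= t <= 1 -> A (c + t *: (y - c))) -> connected A.
Proof.
move=> Ac As.
have -> : A = \bigcup_(y in A) ((fun t => c + t *: (y - c)) @` [set` `[0 : R, 1]]).
  apply/seteqP; split => [y Ay|z [y Ay [t /= t01 <-]]].
    exists y => //; exists 1; first by rewrite /= in_itv /= ler01 lexx.
    by rewrite scale1r addrC subrK.
  by apply: As => //; rewrite in_itv in t01.
apply: bigcup_connected.
  exists c => y Ay; exists 0; first by rewrite /= in_itv /= lexx ler01.
  by rewrite scale0r addr0.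
move=> y _; apply: connected_continuous_connected; first exact: segment_connected.
apply: continuous_subspaceT => t.
apply: (@ctD _ _ _ (fun=> c) (fun t : R => t *: (y - c))); first exact: ct_cst.
by apply: (@ctZ _ _ _ id (fun=> y - c)); [exact: ct_id|exact: ct_cst].
Qed.

Lemma connected_setT (m : nat) : connected [set: 'rV[R]_m].
Proof. exact: (@star_connected _ _ 0). Qed.

(** The half-spaces beyond distance [C] along the axes lie in the exterior. Two of them meet unless
    they are opposite, and opposite ones are joined through another axis, which exists in dimension
    at least 2. The outward ray from any exterior point reaches one of them. *)
Lemma gauge_gt1_connected (m : nat) (p : 'rV[R]_m.+2 -> R) : gauge p ->
  connected [set y | 1 < p y].
Proof.
move=> hp; have [C C0 hC] := gauge_bound hp.
pose H i (s : bool) : set 'rV[R]_m.+2 := [set y | C < (-1) ^+ s * y 0 i].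
have HA i s : H i s `<=` [set y | 1 < p y].
  move=> y /= Hy; rewrite -(ltr_pM2l C0) mulr1 (lt_le_trans _ (hC y))//.
  apply: lt_le_trans Hy (le_trans (ler_norm _) _).
  by rewrite normrM normr_sign mul1r; exact: normr_row_le.
have cH i s : connected (H i s).
  apply: (@star_connected _ _ (const_mx ((-1) ^+ s * (C + 1)))).
    by rewrite /H /= !mxE mulrA -signr_addb addbb mul1r; lra.
  move=> y t /= Hy /andP[t0 t1]; rewrite /H /= !mxE mulrDr mulrA -signr_addb addbb mul1r.
  rewrite mulrCA mulrBr mulrA -signr_addb addbb mul1r.
  move: Hy; rewrite /H /=; set z := (_ * y 0 i) => Hz.
  have [->|tn1] := eqVneq t 1; first by lra.
  have : t < 1 by rewrite lt_neqAle tn1 t1.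
  by have : 0 <= t * (z - C) by [rewrite mulr_ge0// subr_ge0 ltW]; lra.
pose w i s : 'rV[R]_m.+2 := \row_j (if j == i then (-1) ^+ s * (C + 1) else C + 1).
have wi i s : H i s (w i s).
  by rewrite /H /= mxE eqxx mulrA -signr_addb addbb mul1r; lra.
have wj i s j : j != i -> H j false (w i s).
  by move=> ji; rewrite /H /= mxE (negPf ji) expr0 mul1r; lra.
pose U := H 0 false `|` H 1 false.
have cU : connected U.
  apply: connectedU => //; exists (w 0 false); split => //; exact: wj.
have cHU i s : connected (H i s `|` U).
  apply: connectedU => //; exists (w i s); split => //.
  have [->|i0] := eqVneq i 0; [right|left]; apply: wj => //.
  by rewrite eq_sym.
pose ray (y : 'rV[R]_m.+2) := (fun a : R => a *: y) @` [set a | 1 <= a].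
have ex y : 1 < p y -> exists i s, (ray y `&` (H i s `|` U)) !=set0.
  move=> py; have y0 := gauge_neq0 hp (lt_trans ltr01 py).
  have [i yi] : exists i, y 0 i != 0.
    apply: contrapT => /forallNP h; move/eqP: y0; apply; apply/rowP => i.
    by rewrite mxE; apply/eqP/negPn/negP; exact: h.
  exists i, (y 0 i < 0); exists ((1 + C / `|y 0 i|) *: y); split.
    exists (1 + C / `|y 0 i|) => //=.
    by rewrite lerDl divr_ge0// ltW.
  left; rewrite /H /= mxE mulrCA -normrEsign mulrDl mul1r divfK ?normr_eq0//.
  by rewrite ltrDr normr_gt0.
have -> : [set y | 1 < p y] =
    \bigcup_(y in [set y | 1 < p y])
       (ray y `|` (\bigcup_(i in setT) \bigcup_(s in setT) (H i s `|` U))).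
  apply/seteqP; split => [y py|z [y py]] /=.
    by exists y => //; left; exists 1; rewrite /= ?scale1r.
  case=> [[a /= a1 <-]|[i _ [s _ [|[]]]]]; try exact: HA.
  rewrite (gaugeZ hp) ?(le_trans ler01)//.
  by rewrite (lt_le_trans py)// ler_peMl// ltW// (lt_trans _ py).
apply: bigcup_connected.
  exists (w 0 false) => y _; right; exists 0 => //; exists false => //; left; exact: wi.
move=> y py; have [i [s [z [rz Hz]]]] := ex y py.
apply: connectedU.
- by exists z; split => //; exists i => //; exists s.
- exact: connected_ray.
apply: bigcup_connected.
  by exists (w 0 false) => j _; exists false => //; right; left; exact: wi.
move=> j _; apply: bigcup_connected => //.
by exists (w 0 false) => b _; right; left; exact: wi.
Qed.

End Connectedness.

(** * Straightening open sets with star-shaped fibres *)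

Section FiberScaling.
Variables (R : realType) (m : nat) (c : 'rV[R]_m).
Implicit Types (I : pred 'I_m) (y w : 'rV[R]_m) (a b t : R) (W : set 'rV[R]_m).

Definition scale_coords I t y : 'rV[R]_m :=
  \row_i (if I i then c 0 i + t * (y 0 i - c 0 i) else y 0 i).

Local Notation sc := scale_coords.

Lemma scale_coords1 I y : sc I 1 y = y.
Proof. by apply/rowP => i; rewrite mxE mul1r addrC subrK; case: ifP. Qed.

Lemma scale_coords_mul I a b y : sc I a (sc I b y) = sc I (a * b) y.
Proof.
by apply/rowP => i; rewrite !mxE; case: (I i) => //; ring.
Qed.

Lemma scale_coords_pred0 t y : sc pred0 t y = y.
Proof. by apply/rowP => i; rewrite mxE. Qed.

Lemma scale_coords_dist I t y w : 0 <= t <= 1 ->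
  `|sc I t y - sc I t w| <= `|y - w|.
Proof.
move=> /andP[t0 t1]; apply/normr_rowP => // i; rewrite !mxE.
have := normr_row_le (y - w) i; rewrite !mxE; case: ifP => // _ h.
rewrite (_ : _ - _ = t * (y 0 i - w 0 i)); last by ring.
by rewrite normrM ger0_norm// (le_trans _ h)// ler_piMl.
Qed.

Lemma ct_scale_coords (T : topologicalType) I (f : T -> R) (g : T -> 'rV[R]_m) x :
  {for x, continuous f} -> {for x, continuous g} ->
  {for x, continuous (fun z => sc I (f z) (g z))}.
Proof.
move=> cf cg; apply: ct_row => i.
apply: (@ct_eq _ _ (fun z => if I i then c 0 i + f z * (g z 0 i - c 0 i) else g z 0 i)).
  by move=> z; rewrite mxE.
case: (I i); last exact: ct_coord.
apply: ctDr; first exact: ct_cst.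
by apply: ctM => //; apply: ctBr; [exact: ct_coord|exact: ct_cst].
Qed.

(** Radii of neighbourhoods, inside [W], of the whole segment along which [y] is contracted in the
    coordinates of [I]. Measuring from the segment and not from [y] alone makes the supremum
    nonincreasing along rays; the bound 1 keeps it finite. *)
Definition clearance_set I W y : set R := [set r | 0 <= r <= 1 /\
  forall t, 0 <= t <= 1 -> forall w, `|sc I t y - w| < r -> W w].

Definition clearance I W y : R := sup (clearance_set I W y).

Local Notation cl := clearance.

Lemma clearance_set0 I W y : clearance_set I W y 0.
Proof. by split; [rewrite lexx ler01|move=> t _ w; rewrite normr_lt0]. Qed.

Lemma clearance_has_sup I W y : has_sup (clearance_set I W y).
Proof.
split; first by exists 0; exact: clearance_set0.
by exists 1 => r [/andP[]].
Qed.

Lemma clearance_ub I W y r : clearance_set I W y r -> r <= cl I W y.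
Proof. by move=> h; apply: sup_upper_bound h; exact: clearance_has_sup. Qed.

Lemma clearance_le I W y b : (forall r, clearance_set I W y r -> r <= b) ->
  cl I W y <= b.
Proof. by move=> h; apply: ge_sup => //; exists 0; exact: clearance_set0. Qed.

Lemma clearance_ge0 I W y : 0 <= cl I W y.
Proof. exact/clearance_ub/clearance_set0. Qed.

Lemma clearance_le1 I W y : cl I W y <= 1.
Proof. by apply: clearance_le => r [/andP[]]. Qed.

Lemma clearance_lip1 I W y w : cl I W y <= cl I W w + `|y - w|.
Proof.
apply: clearance_le => r [/andP[r0 r1] h]; rewrite -lerBlDr.
have [s0|s0] := leP (r - `|y - w|) 0; first exact: le_trans (clearance_ge0 _ _ _).
apply: clearance_ub; split.
  by rewrite (ltW s0)/= (le_trans _ r1)// gerBl.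
move=> t t01 z hz; apply: (h t t01).
rewrite (_ : _ - z = (sc I t y - sc I t w) + (sc I t w - z)); last first.
  by rewrite addrA subrK.
rewrite (le_lt_trans (ler_normD _ _))// -ltrBrDl.
apply: lt_le_trans hz _; rewrite lerB//.
exact: scale_coords_dist.
Qed.

Lemma clearance_continuous I W : continuous (cl I W).
Proof.
move=> y; apply: (@ct_lipschitz _ _ _ setT); first exact: filterT.
move=> w _; have := clearance_lip1 I W y w; have := clearance_lip1 I W w y.
by rewrite (distrC w y) ler_norml; lra.
Qed.

(** The contraction segment of the nearer point is contained in that of the farther one. *)
Lemma clearance_anti I W y a b : 0 <= a <= b ->
  cl I W (sc I b y) <= cl I W (sc I a y).
Proof.
move=> /andP[a0 ab]; apply: clearance_le => r [r01 h]; apply: clearance_ub.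
split=> // t /andP[t0 t1] w; rewrite scale_coords_mul.
have [b0|b0] := leP b 0.
  have -> : a = b by lra.
  by move=> hw; apply: (h t); rewrite ?t0// scale_coords_mul.
move=> hw; apply: (h (t * (a / b))).
  by rewrite mulr_ge0 ?divr_ge0 ?(ltW b0)//= mulr_ile1// ?divr_ge0 ?(ltW b0)//
    ler_pdivrMr ?mul1r.
by rewrite scale_coords_mul -mulrA divfK// lt0r_neq0.
Qed.

Lemma clearance_gt0W I W y : 0 < cl I W y -> W y.
Proof.
move=> /sup_gt[|r [r01 h] r0]; first by exists 0; exact: clearance_set0.
by apply: (h 1); rewrite ?scale_coords1 ?subrr ?normr0// ler01 lexx.
Qed.

(** With [pred0] nothing moves, so [rho] is the ordinary distance to the complement of [W], capped
    at 1. It is continuous and positive on [W], hence has a positive minimum on the compact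
    segment. *)
Lemma clearance_gt0 I W y : open W ->
  (forall t, 0 <= t <= 1 -> W (sc I t y)) -> 0 < cl I W y.
Proof.
move=> oW hW; pose rho := cl pred0 W.
have rhoW w : W w -> 0 < rho w.
  move=> Ww; have /nbhs_ballP[e /= e0 eW] := open_nbhs_nbhs (conj oW Ww).
  apply: (@lt_le_trans _ _ (Num.min e 1)); first by rewrite lt_min e0 ltr01.
  apply: clearance_ub; split; first by rewrite le_min ge_min (ltW e0) ler01 lexx orbT.
  move=> t _ z; rewrite scale_coords_pred0 => hz; apply: eW.
  by rewrite mx_norm_ball /ball_ /= (lt_le_trans hz)// ge_min lexx.
have [t0 t001 tmin] := @EVT_min R (fun t => rho (sc I t y)) 0 1 ler01
  ltac:(apply: continuous_subspaceT => t; apply: (@ct_comp _ _ _ (fun t => sc I t y) rho);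
    [apply: ct_scale_coords; [exact: ct_id|exact: ct_cst]|exact: clearance_continuous]).
rewrite in_itv /= in t001.
apply: lt_le_trans (rhoW _ (hW _ t001)) _; apply: clearance_ub; split.
  by rewrite clearance_ge0 clearance_le1.
move=> t t01 w hw.
have tI : t \in `[0, 1] by rewrite in_itv.
have := lt_le_trans hw (tmin _ tI) => /sup_gt[|r [_ h] hr].
  by exists 0; exact: clearance_set0.
apply: (h 1); first by rewrite ler01 lexx.
by rewrite scale_coords_pred0.
Qed.

(* [y |-> y / clearance] stretches each fibre of [W] onto the whole fibre; its
   inverse scales by the fixed point of the clearance along the ray, which is
   1-Lipschitz because the clearance is 1-Lipschitz and nonincreasing. *)
Lemma fiber_homeomorphic I W : open W ->
  (forall y t, W y -> 0 <= t <= 1 -> W (sc I t y)) ->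
  homeomorphic W [set y | W (sc I 0 y)].
Proof.
move=> oW sW; pose P := [set y | W (sc I 0 y)]; pose d := cl I W.
pose fixp w t := 0 <= t <= 1 /\ d (sc I t w) = t.
pose mu w := xget 0 [set t | fixp w t].
have fix_uniq w s t : fixp w s -> fixp w t -> s < t -> False.
  move=> [/andP[s0 _] hs] [_ ht] st.
  have := @clearance_anti I W w s t; rewrite s0 (ltW st) -/d hs ht => /(_ isT).
  by rewrite leNgt st.
have fix_eq w s t : fixp w s -> fixp w t -> s = t.
  move=> hs ht; have [/(fix_uniq _ _ _ hs ht)//|/(fix_uniq _ _ _ ht hs)//|//] := ltgtP s t.
have muP w : P w -> fixp w (mu w) /\ 0 < mu w.
  move=> Pw; have d0 : 0 < d (sc I 0 w).
    apply: clearance_gt0 => // t _; by rewrite scale_coords_mul mulr0.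
  (* The difference is positive at 0, where the trace lies in [W], and nonpositive at 1 because
     clearances are at most 1. *)
  have [t t01 ht] := @IVT R (fun t => d (sc I t w) - t) 0 1 0 ler01
    ltac:(apply: continuous_subspaceT => t;
    apply: (@ctBr R _ (fun t => d (sc I t w)) (fun t => t)); [
    apply: (@ct_comp _ _ _ (fun t => sc I t w) d);
    [apply: ct_scale_coords; [exact: ct_id|exact: ct_cst]|exact: clearance_continuous]
    | exact: ct_id])
    ltac:(rewrite /= subr0 ge_min le_max (ltW d0) /= subr_le0 clearance_le1 orbT //).
  rewrite in_itv /= in t01.
  have ft : fixp w t by split => //; apply/eqP; rewrite -subr_eq0 ht.
  have fm : fixp w (mu w) by apply: (xgetPex 0 (P := [set t | fixp w t])); exists t.
  split=> //; rewrite (fix_eq _ _ _ fm ft) lt_neqAle; case/andP: t01 => -> _.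
  by rewrite andbT; apply: contraTneq d0 => t0; rewrite t0 (proj2 ft) -t0 ltxx.
have muW w : P w -> W (sc I (mu w) w).
  by move=> /muP[[_ e] m0]; apply: (@clearance_gt0W I); rewrite -/d e.
have d_gt0 y : W y -> 0 < d y by move=> Wy; apply: clearance_gt0 => // t; exact: sW.
have oP : open P.
  apply: (@open_comp _ _ (sc I 0)) => // y _.
  by apply: ct_scale_coords; [exact: ct_cst|exact: ct_id].
have mu_lip w w' : P w -> P w' -> mu w' <= mu w + `|w - w'|.
  move=> /muP[[/andP[s0 s1] hs] _] /muP[[/andP[t0 t1] ht] _].
  have [st|st] := leP (mu w') (mu w).
    by rewrite (le_trans st)// lerDl.
  rewrite -{1}ht /d; apply: (@le_trans _ _ (cl I W (sc I (mu w) w'))).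
    by apply: clearance_anti; rewrite s0 ltW.
  apply: (le_trans (clearance_lip1 I W _ (sc I (mu w) w))).
  rewrite -/d hs lerD2l distrC.
  by apply: scale_coords_dist; rewrite s0.
apply: (@homeo_homeomorphic _ _ _ _ (fun y => sc I (d y)^-1 y) (fun w => sc I (mu w) w)).
have can1 y : W y -> mu (sc I (d y)^-1 y) = d y.
  move=> Wy; have dy := d_gt0 _ Wy.
  have Py : P (sc I (d y)^-1 y).
    by rewrite /P /= scale_coords_mul mul0r; apply: sW => //; rewrite lexx ler01.
  apply: (fix_eq (sc I (d y)^-1 y)); first exact: (muP _ Py).1.
  split; first by rewrite clearance_ge0 clearance_le1.
  by rewrite scale_coords_mul divff ?lt0r_neq0// scale_coords1.
apply: homeo_pointwise.
- move=> y Wy /=; rewrite scale_coords_mul mul0r; apply: sW => //.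
  by rewrite lexx ler01.
- exact: muW.
- move=> y Wy; rewrite can1// scale_coords_mul divff ?scale_coords1// lt0r_neq0//.
  exact: d_gt0.
- move=> w Pw; have [[_ hw] m0] := muP _ Pw.
  by rewrite hw scale_coords_mul mulVf ?scale_coords1// lt0r_neq0.
- move=> y Wy; apply: ct_scale_coords; last exact: ct_id.
  apply: ctV; first by rewrite lt0r_neq0// d_gt0.
  exact: clearance_continuous.
move=> w Pw; apply: ct_scale_coords; last exact: ct_id.
apply: (@ct_lipschitz _ _ _ P); first exact: open_nbhs_nbhs.
move=> z Pz; have := mu_lip _ _ Pw Pz; have := mu_lip _ _ Pz Pw.
by rewrite (distrC z w) ler_norml; lra.
Qed.

End FiberScaling.

(** * The open ball as a model of Euclidean space *)

Section BallModel.
Variable R : realType.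

Lemma open_gauge_lt1 (m : nat) (p : 'rV[R]_m.+1 -> R) : gauge p -> open [set y | p y < 1].
Proof.
by move=> hp; apply: ct_lt_open; [exact: gauge_continuous|move=> ?; exact: ct_cst].
Qed.

(** All coordinates are contracted at once: the unit ball is star-shaped about 0, and the cylinder
    over its trace is the whole space. *)
Lemma gauge_lt1_homeomorphic (m : nat) (p : 'rV[R]_m.+1 -> R) : gauge p ->
  homeomorphic [set y | p y < 1] [set: 'rV[R]_m.+1].
Proof.
move=> hp.
have sc0 t (y : 'rV[R]_m.+1) : scale_coords 0 predT t y = t *: y.
  by apply/rowP => i; rewrite !mxE /= subr0 add0r.
have := @fiber_homeomorphic R _ 0 predT _ (open_gauge_lt1 hp).
have -> : [set y | [set y | p y < 1] (scale_coords 0 predT 0 y)] = setT.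
  by apply/seteqP; split => y // _; rewrite /= sc0 scale0r (gauge0 hp) ltr01.
apply=> y t /= py /andP[t0 t1].
suff : p (scale_coords 0 predT t y) < 1 by [].
rewrite sc0 (gaugeZ hp)//.
have [->|/(gauge_gt0 hp) py0] := eqVneq y 0; first by rewrite (gauge0 hp) mulr0.
by rewrite (le_lt_trans _ py)// ger_pMl.
Qed.

Lemma homeomorphic_setT_interior (m : nat) (A : set 'rV[R]_m.+1) :
  homeomorphic A [set: 'rV[R]_m.+1] ->
  exists X, surface_in m.+1 [set: 'rV[R]_m.+1] X /\
    homeomorphic A (surface_interior m.+1 [set: 'rV[R]_m.+1] X).
Proof.
move=> hA; exists [set y | enorm y = 1]; split.
  exact: (gauge_surface (enorm_gauge R m.+1)).
rewrite (gauge_interior (enorm_gauge R m.+1)); apply: homeomorphic_trans hA _.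
exact/homeomorphic_sym/gauge_lt1_homeomorphic/enorm_gauge.
Qed.

End BallModel.

(** * Polar coordinates *)

Section Stereographic.
Variables (R : realType) (M : nat).
Implicit Types (y : 'rV[R]_M.+1) (q : 'rV[R]_M) (r t : R).

Definition row_tail y : 'rV[R]_M := \row_i y 0 (lift 0 i).
Definition row_cons t q : 'rV[R]_M.+1 :=
  \row_i (if unlift 0 i is Some j then q 0 j else t).

Lemma row_cons0 t q : row_cons t q 0 0 = t.
Proof. by rewrite mxE unlift_none. Qed.

Lemma row_cons_lift t q j : row_cons t q 0 (lift 0 j) = q 0 j.
Proof. by rewrite mxE liftK. Qed.

Lemma row_consK t q : row_tail (row_cons t q) = q.
Proof. by apply/rowP => i; rewrite !mxE liftK. Qed.

Lemma row_eta y : row_cons (y 0 0) (row_tail y) = y.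
Proof. by apply/rowP => i; rewrite !mxE; case: unliftP => [j ->|->]; rewrite ?mxE. Qed.

Lemma ct_row_cons (T : topologicalType) (f : T -> R) (g : T -> 'rV[R]_M) x :
  {for x, continuous f} -> {for x, continuous g} ->
  {for x, continuous (fun z => row_cons (f z) (g z))}.
Proof.
move=> cf cg; apply: ct_row => i.
case: (unliftP 0 i) => [j ->|->].
  apply: (@ct_eq _ _ (fun z => g z 0 j : R)); last exact: ct_coord.
  by move=> z; rewrite row_cons_lift.
by apply: (@ct_eq _ _ f) => // z; rewrite row_cons0.
Qed.

Lemma ct_row_tail (T : topologicalType) (f : T -> 'rV[R]_M.+1) x :
  {for x, continuous f} -> {for x, continuous (fun z => row_tail (f z))}.
Proof.
move=> cf; apply: ct_row => i.
apply: (@ct_eq _ _ (fun z => f z 0 (lift 0 i) : R)); last exact: ct_coord.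
by move=> z; rewrite mxE.
Qed.

Lemma enorm_tail y : enorm y ^+ 2 = y 0 0 ^+ 2 + enorm (row_tail y) ^+ 2.
Proof.
rewrite !enorm_sqr big_ord_recl; congr (_ + _).
by apply: eq_bigr => i _; rewrite mxE.
Qed.

(** Zero exactly on the negative half of the first axis, origin included: the ray of the pole from
    which [stereo] projects. *)
Definition pole_dist y := enorm y + y 0 0.

Lemma pole_dist_ge0 y : 0 <= pole_dist y.
Proof. by have := enorm_coord y 0; rewrite ler_norml /pole_dist; lra. Qed.

Lemma pole_distZ r y : 0 <= r -> pole_dist (r *: y) = r * pole_dist y.
Proof. by move=> r0; rewrite /pole_dist enormZ// mxE mulrDr. Qed.

Lemma pole_dist_continuous : continuous pole_dist.
Proof.
move=> y; apply: (@ctDr _ _ (@enorm R _) (fun y : 'rV[R]_M.+1 => y 0 0 : R)).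
  exact: enorm_continuous.
exact: coord_continuous.
Qed.

(** Stereographic projection of the direction of [y], hence a coordinate on the rays off the
    pole. *)
Definition stereo y : 'rV[R]_M := (pole_dist y)^-1 *: row_tail y.

Definition stereo_inv r q : 'rV[R]_M.+1 :=
  row_cons (r * (1 - enorm q ^+ 2) / (1 + enorm q ^+ 2))
           ((2 * r / (1 + enorm q ^+ 2)) *: q).

Lemma stereo_den q : 0 < 1 + enorm q ^+ 2.
Proof. by rewrite ltr_pwDl// sqr_ge0. Qed.

Lemma enorm_stereo_inv r q : 0 <= r -> enorm (stereo_inv r q) = r.
Proof.
move=> r0; apply/eqP; rewrite -(@eqrXn2 _ 2)// ?enorm_ge0// enorm_tail.
have := stereo_den q; rewrite row_consK row_cons0 enormZ; last first.
  by rewrite divr_ge0 ?mulr_ge0// ltW// stereo_den.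
rewrite [(_ * enorm q) ^+ 2]exprMn; set s := enorm q ^+ 2 => s0; apply/eqP.
by field; rewrite lt0r_neq0.
Qed.

Lemma pole_dist_stereo_inv r q : 0 <= r ->
  pole_dist (stereo_inv r q) = 2 * r / (1 + enorm q ^+ 2).
Proof.
move=> r0; rewrite /pole_dist enorm_stereo_inv// row_cons0.
by field; rewrite lt0r_neq0// stereo_den.
Qed.

Lemma pole_dist_stereo_inv_gt0 r q : 0 < r -> 0 < pole_dist (stereo_inv r q).
Proof.
by move=> r0; rewrite pole_dist_stereo_inv ?(ltW r0)// divr_gt0 ?mulr_gt0// stereo_den.
Qed.

Lemma stereo_invK r q : 0 < r -> stereo (stereo_inv r q) = q.
Proof.
move=> r0; rewrite /stereo pole_dist_stereo_inv ?(ltW r0)// row_consK scalerA.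
rewrite mulVf ?scale1r// lt0r_neq0// divr_gt0 ?mulr_gt0// stereo_den//.
Qed.

(** Translates a large coordinate into closeness to the pole. The reciprocal quotient belongs to the
    projection from the opposite pole. *)
Lemma enorm_stereo y : 0 < pole_dist y ->
  enorm (stereo y) ^+ 2 = (enorm y - y 0 0) / pole_dist y.
Proof.
move=> py; rewrite enormZ ?invr_ge0 ?ltW// exprMn.
have -> : enorm (row_tail y) ^+ 2 = enorm y ^+ 2 - y 0 0 ^+ 2.
  by rewrite enorm_tail; ring.
by move: py; rewrite /pole_dist => py; field; rewrite lt0r_neq0.
Qed.

Lemma stereoK y : 0 < pole_dist y -> stereo_inv (enorm y) (stereo y) = y.
Proof.
move=> py; have e0 : 0 < enorm y.
  rewrite lt_neqAle enorm_ge0 andbT; apply: contraTneq py => e0.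
  have := enorm_coord y 0; rewrite -e0 normr_le0 /pole_dist -e0 => /eqP ->.
  by rewrite addr0 ltxx.
have d : pole_dist y = enorm y + y 0 0 by [].
rewrite /stereo_inv enorm_stereo// -[RHS]row_eta; congr row_cons.
  by rewrite d in py *; field; rewrite !lt0r_neq0//; lra.
rewrite /stereo scalerA (_ : _ / _ / _ = 1) ?scale1r//.
by rewrite d in py *; field; rewrite !lt0r_neq0//; lra.
Qed.

Lemma stereoZ r y : 0 < r -> stereo (r *: y) = stereo y.
Proof.
move=> r0; rewrite /stereo pole_distZ ?ltW//; apply/rowP => i; rewrite !mxE.
by rewrite invfM mulrACA mulVf ?mul1r// lt0r_neq0.
Qed.

Lemma ct_stereo y : 0 < pole_dist y -> {for y, continuous stereo}.
Proof.
move=> py.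
apply: (@ctZ _ _ _ (fun y => (pole_dist y)^-1) row_tail).
  by apply: ctV; [rewrite lt0r_neq0|exact: pole_dist_continuous].
exact/ct_row_tail/ct_id.
Qed.

Lemma ct_stereo_inv (T : topologicalType) (f : T -> R) (g : T -> 'rV[R]_M) x :
  {for x, continuous f} -> {for x, continuous g} ->
  {for x, continuous (fun z => stereo_inv (f z) (g z))}.
Proof.
move=> cf cg.
have cs : {for x, continuous (fun z => enorm (g z) ^+ 2)}.
  apply: (@ct_comp _ _ _ (fun z => enorm (g z)) (fun t : R => t ^+ 2)).
    by apply: (@ct_comp _ _ _ g (@enorm R M)) => //; exact: enorm_continuous.
  exact: exprn_continuous.
have cd : {for x, continuous (fun z => (1 + enorm (g z) ^+ 2)^-1)}.
  apply: ctV; first by rewrite lt0r_neq0// stereo_den.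
  by apply: (@ctDr R _ (fun=> 1)) => //; exact: ct_cst.
apply: ct_row_cons; first (apply: ctM => //; apply: ctM => //).
  by apply: (@ctBr R _ (fun=> 1)) => //; exact: ct_cst.
apply: ctZ => //; apply: ctM => //; apply: ctM => //; exact: ct_cst.
Qed.

End Stereographic.

(** * Star-shaped domains given by a radius depending on the direction *)

Section ConicalGauge.
Variables (R : realType) (M : nat) (F : 'rV[R]_M -> R) (h K : R).
Hypotheses (cF : continuous F) (F1 : forall q, `|F q| <= 1) (h1 : `|h| <= 1)
  (FK : forall q, K <= enorm q ^+ 2 -> F q = h).

(** On the pole ray [h] is the constant value of [F] near infinity, which makes [radius] continuous
    off the origin. *)
Definition radius (y : 'rV[R]_M.+1) : R :=
  2 + (if 0 < pole_dist y then F (stereo y) else h).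

Definition cone_gauge (y : 'rV[R]_M.+1) : R := enorm y / radius y.

Lemma radius_ge1 y : 1 <= radius y.
Proof.
by rewrite /radius; case: ifP => _; [have := F1 (stereo y)|have := h1];
  rewrite ler_norml; lra.
Qed.

Lemma radius_le3 y : radius y <= 3.
Proof.
by rewrite /radius; case: ifP => _; [have := F1 (stereo y)|have := h1];
  rewrite ler_norml; lra.
Qed.

Lemma radius_gt0 y : 0 < radius y.
Proof. exact: lt_le_trans (radius_ge1 y). Qed.

Lemma cone_gauge_le y : cone_gauge y <= enorm y.
Proof. by rewrite ler_pdivrMr ?radius_gt0// ler_peMr ?enorm_ge0// radius_ge1. Qed.

Lemma cone_gauge_ge y : enorm y / 3 <= cone_gauge y.
Proof.
rewrite ler_wpM2l ?enorm_ge0// lef_pV2 ?posrE ?radius_gt0//.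
exact: radius_le3.
Qed.

Lemma cone_gauge_lt1 y : (cone_gauge y < 1) = (enorm y < radius y).
Proof. by rewrite ltr_pdivrMr ?radius_gt0// mul1r. Qed.

Lemma cone_gauge_gt1 y : (1 < cone_gauge y) = (radius y < enorm y).
Proof. by rewrite ltr_pdivlMr ?radius_gt0// mul1r. Qed.

Lemma cone_gauge_eq1 y : (cone_gauge y = 1) <-> (enorm y = radius y).
Proof.
rewrite /cone_gauge; have := radius_gt0 y => h0; split => [e|->];
     last by rewrite divff// lt0r_neq0.
by rewrite -[RHS]mul1r -e divfK// lt0r_neq0.
Qed.

Lemma ct_radius y : y != 0 -> {for y, continuous radius}.
Proof.
move=> y0; have [py|py] := ltP 0 (pole_dist y).
  have cG : {for y, continuous (fun z => 2 + F (stereo z))}.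
    apply: (@ctDr R _ (fun=> 2)); first exact: ct_cst.
    by apply: (@ct_comp _ _ _ (@stereo R M) F); [exact: ct_stereo|exact: cF].
  have oP : open [set z | 0 < @pole_dist R M z].
    by apply: ct_lt_open; [move=> ?; exact: ct_cst|exact: pole_dist_continuous].
  by apply: (ct_near_eq oP py _ cG) => z /= pz; rewrite /radius pz.
have {}py : pole_dist y = 0 by apply/eqP; rewrite eq_le py pole_dist_ge0.
(* Off the pole ray this inequality says that the stereographic coordinate has squared norm above
   [K], where [F] is constant. *)
have oP : open [set z | K * @pole_dist R M z < enorm z - z 0 0].
  apply: ct_lt_open => z.
    by apply: (@ctM _ _ (fun=> K)); [exact: ct_cst|exact: pole_dist_continuous].
  by apply: ctBr; [exact: enorm_continuous|exact: coord_continuous].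
have Py : K * pole_dist y < enorm y - y 0 0.
  have := enorm_gt0 y0; have := py; rewrite {1}/pole_dist py mulr0; lra.
apply: (@ct_near_eq _ _ (fun=> 2 + h) _ _ _ oP Py); last exact: ct_cst.
move=> z /= Pz; rewrite /radius; case: ifP => // pz; rewrite FK// enorm_stereo//.
by rewrite ler_pdivlMr// ltW.
Qed.

Lemma cone_gauge_gauge : gauge cone_gauge.
Proof.
split.
- move=> y; have [->|y0] := eqVneq y 0.
    (* At the origin, where the direction is lost, continuity comes from the bound of the quotient
       by [enorm]. *)
    apply: (@ct_dominated _ _ _ (@enorm R M.+1)); last exact: enorm_continuous.
      move=> z; rewrite {1}/cone_gauge enorm0 mul0r sub0r normrN ger0_norm.
        exact: cone_gauge_le.
      by rewrite divr_ge0 ?enorm_ge0// ltW// radius_gt0.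
    exact: enorm0.
  apply: (@ctM _ _ (@enorm R M.+1) (fun z => (radius z)^-1)).
    exact: enorm_continuous.
  by apply: ctV; [rewrite lt0r_neq0// radius_gt0|exact: ct_radius].
- move=> a y; rewrite le_eqVlt => /predU1P[<-|a0].
    by rewrite scale0r /cone_gauge enorm0 !mul0r.
  rewrite /cone_gauge enormZ ?ltW// -mulrA; congr (_ * (_ / _)).
  by rewrite /radius pole_distZ ?ltW// pmulr_rgt0// stereoZ.
- exists 3 => // y; apply: le_trans (norm_le_enorm y) _.
  by have := cone_gauge_ge y; lra.
Qed.

End ConicalGauge.
(** * Waves along a Gray code *)

Section Clamp.
Variable R : realType.
Implicit Types s t : R.

Definition clamp t : R := Num.max (-1) (Num.min 1 t).

Variant clamp_spec t : R -> Prop :=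
  | ClampLow of t <= -1 : clamp_spec t (-1)
  | ClampMid of -1 < t & t < 1 : clamp_spec t t
  | ClampHigh of 1 <= t : clamp_spec t 1.

Lemma clampP t : clamp_spec t (clamp t).
Proof.
rewrite /clamp minEle maxEle; case: (leP 1 t) => t1.
  by rewrite ifT; [exact: ClampHigh|lra].
case: (leP (-1) t) => t2; last by apply: ClampLow; lra.
have [e|e] := eqVneq t (-1); first by rewrite e; apply: ClampLow.
by apply: ClampMid => //; rewrite lt_neqAle eq_sym e.
Qed.

Lemma clamp_ge t : -1 <= clamp t. Proof. by case: clampP; lra. Qed.
Lemma clamp_le t : clamp t <= 1. Proof. by case: clampP; lra. Qed.
Lemma clamp1 t : 1 <= t -> clamp t = 1. Proof. by case: clampP => //; lra. Qed.
Lemma clampN1 t : t <= -1 -> clamp t = -1. Proof. by case: clampP => //; lra. Qed.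

Lemma clamp_mono s t : s <= t -> clamp s <= clamp t.
Proof. by case: (clampP s); case: (clampP t); lra. Qed.

Lemma clamp_gtN1 t : -1 < clamp t -> -1 < t.
Proof. by case: clampP; lra. Qed.

Lemma clamp_lt1 t : clamp t < 1 -> t < 1.
Proof. by case: clampP; lra. Qed.

Lemma clamp_continuous : continuous clamp.
Proof.
move=> t; apply: (@ct_max _ _ (fun=> -1)); first exact: ct_cst.
by apply: (@ct_min _ _ (fun=> 1)); [exact: ct_cst|exact: ct_id].
Qed.

End Clamp.

Section Pits.
Variables (R : realType) (n : nat).
Implicit Types (i j k q : nat) (X Y : R).

Definition width k : R := 2 ^+ (n - k.+1).

(** The pits of level [k] have period [4 * width k] and half-width [width k], so their edges are odd
    multiples of [width k]. The single pit of level 0 is centred at [2 ^+ n], and its right half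
    lies beyond the interval from 0 to [2 ^+ n]. *)
Definition pit_center k i : R := (4 * i + 2)%N%:R * width k.

(** The slope 4 confines the transitions to distance 1/4 from the edges, which are integers; the
    half-integers, where the signs are read, stay clear of them. *)
Definition pit k i X : R := clamp (4 * (`|X - pit_center k i| - width k)).

(* The profile of the [k]-th surface: -1 in the pits, +1 between them.  The signs
   of the profiles at [i + 1/2], [i < 2 ^ n], form a Gray code. *)
Definition wave k X : R := \big[Num.min/1]_(i < 2 ^ k.-1) pit k i X.

Lemma width_ge1 k : 1 <= width k.
Proof. by rewrite exprn_ege1// ler1n. Qed.

Lemma widthS k : (k.+1 < n)%N -> width k = 2 * width k.+1.
Proof. by move=> kn; rewrite /width -exprS; congr (_ ^+ _); lia. Qed.

Lemma width_lt i j : (i < j < n)%N -> width i = (2 * 2 ^ (j - i.+1))%N%:R * width j.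
Proof.
move=> /andP[ij jn]; rewrite natrM natrX /width -exprS -exprD; congr (_ ^+ _); lia.
Qed.

Lemma width_total k : (k < n)%N -> 2 ^+ n = (2 ^ k.+1)%N%:R * width k :> R.
Proof. by move=> kn; rewrite natrX /width -exprD; congr (_ ^+ _); lia. Qed.

Lemma wave_le k i X : (i < 2 ^ k.-1)%N -> wave k X <= pit k i X.
Proof. by move=> ik; apply: (@bigmin_le _ _ _ _ (Ordinal ik)). Qed.

Lemma wave_le1 k X : wave k X <= 1.
Proof. exact: bigmin_le_id. Qed.

Lemma wave_geN1 k X : -1 <= wave k X.
Proof. by apply/bigmin_geP; split; [lra|move=> i _; exact: clamp_ge]. Qed.

Lemma wave_pit k X : wave k X < 1 ->
  exists2 i, (i < 2 ^ k.-1)%N & wave k X = pit k i X.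
Proof.
pose P t := t < 1 -> exists2 i, (i < 2 ^ k.-1)%N & t = pit k i X.
rewrite -/(P _) /wave; apply: (big_ind P); rewrite /P; first by rewrite ltxx.
  by move=> x y hx hy; case: (leP x y).
by move=> i _ _; exists i.
Qed.

Lemma wave_eq_pit k i X : (i < 2 ^ k.-1)%N ->
  (forall j, (j < 2 ^ k.-1)%N -> j != i -> pit k j X = 1) -> wave k X = pit k i X.
Proof.
move=> ik h; apply/eqP; rewrite eq_le wave_le//=.
apply/bigmin_geP; split=> [|[j jk] _ /=]; first exact: clamp_le.
by have [->//|ji] := eqVneq j i; rewrite (h j)// clamp_le.
Qed.

Lemma pit_continuous k i : continuous (pit k i).
Proof.
move=> X.
apply: (@ct_comp _ _ _ (fun X => 4 * (`|X - pit_center k i| - width k))); last first.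
  exact: clamp_continuous.
apply: (@ctM _ _ (fun=> 4)); first exact: ct_cst.
apply: ctBr; last exact: ct_cst.
by apply: (@ct_norm R _ R^o); apply: ctBr; [exact: ct_id|exact: ct_cst].
Qed.

Lemma wave_continuous k : continuous (wave k).
Proof. by move=> X; apply: ct_bigmin => i; exact: pit_continuous. Qed.

(** The dyadic interval number [alpha] of level [q], widened by the reach 1/4 of a transition. The
    first and the last interval extend to infinity. *)
Definition in_cell q alpha X :=
  (alpha = 0%N \/ alpha%:R * (2 ^+ (n - q)) - 4^-1 <= X) /\
  (alpha = (2 ^ q).-1%N \/ X <= (alpha.+1)%:R * 2 ^+ (n - q) + 4^-1).

Lemma far_pit k i X : 2 * width k - 4^-1 <= `|X - pit_center k i| -> pit k i X = 1.
Proof. by move=> h; apply: clamp1; have := width_ge1 k; lra. Qed.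

Lemma pow2_half k : (0 < k)%N -> (2 ^ k = 2 * 2 ^ k.-1)%N.
Proof. by case: k => // k _; rewrite expnS. Qed.

Lemma half_alpha k alpha : (alpha < 2 ^ k)%N -> (alpha./2 < 2 ^ k.-1)%N.
Proof. by case: k => [|k] /=; rewrite ?expnS; lia. Qed.

(** Only the pit numbered by half of [alpha] comes near the cell, and only one of its edges, at the
    midpoint of the cell. The parity of [alpha] tells which edge: this is the reflection in the Gray
    code. At level 0 the cell is the whole line, and the bound on [X] cuts off the second edge. *)
Lemma wave_cell k alpha X : (k < n)%N -> (alpha < 2 ^ k)%N -> in_cell k alpha X ->
  (k = 0%N -> X <= 2 ^+ n + 4^-1) ->
  wave k X = clamp ((if odd alpha then 4 else -4) * (X - (2 * alpha + 1)%N%:R * width k)).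
Proof.
move=> kn ak [hl hr] h0; have w1 := width_ge1 k.
have W : 2 ^+ (n - k) = 2 * width k :> R by rewrite /width -exprS; congr (_ ^+ _); lia.
rewrite W in hl hr.
have hr' : alpha = (2 ^ k).-1 /\ (0 < k)%N \/ X <= (alpha.+1)%:R * (2 * width k) + 4^-1.
  case: hr => hr; last by right.
  case: (posnP k) => [k0|k0]; last by left.
  right; have {hr} a0 : alpha = 0%N by rewrite hr k0.
  by rewrite a0 mul1r -W (le_trans (h0 k0))// lerD2r k0 subn0.
have aE : alpha = (odd alpha + 2 * alpha./2)%N by rewrite mul2n odd_double_half.
set i0 := alpha./2 in aE *.
rewrite (@wave_eq_pit _ i0 _ (half_alpha ak)); last first.
  move=> j jk; rewrite neq_ltn => /orP[ji|ij]; apply: far_pit.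
    case: hl => [a0|hl]; first by move: ji; rewrite /i0 a0.
    rewrite (le_trans _ (ler_norm _))// /pit_center.
    have {ji} : 0 <= (i0%:R - j%:R - 1) * width k.
      apply: mulr_ge0; last by lra.
      by move: ji; rewrite -(ler_nat R) -addn1 natrD; lra.
    have : 0 <= (odd alpha)%:R * width k by rewrite mulr_ge0 ?(le_trans _ w1).
    by move: hl; rewrite {1}aE !natrD; lra.
  case: hr' => [[a1 k0]|hr'].
    have e2 := pow2_half k0; by move: ij jk; rewrite /i0 a1 e2; lia.
  rewrite -normrN (le_trans _ (ler_norm _))// /pit_center.
  have {ij} : 0 <= (j%:R - i0%:R - 1) * width k.
    apply: mulr_ge0; last by lra.
    by move: ij; rewrite -(ler_nat R) -addn1 natrD; lra.
  have : 0 <= (1 - (odd alpha)%:R) * width k.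
    by rewrite mulr_ge0 ?(le_trans _ w1)// subr_ge0; case: (odd alpha).
  by move: hr'; rewrite {1}aE -[(_ + _).+1]addn1 !natrD; lra.
rewrite /pit /pit_center (_ : (2 * alpha + 1)%N = (odd alpha + odd alpha + 4 * i0 + 1)%N);
  last by rewrite {1}aE; lia.
have [oa|ea] := boolP (odd alpha).
  have hX : pit_center k i0 - 4^-1 <= X.
    case: hl => [a0|]; first by rewrite a0 in oa.
    by rewrite /pit_center {1}aE oa !natrD /=; lra.
  move: hX; rewrite /pit_center !natrD /=.
  move=> hX; case: (ler0P (X - _)) => hs; last by congr clamp; lra.
  by rewrite !clampN1//; lra.
have hX : X <= pit_center k i0 + 4^-1.
  case: hr' => [[a1 k0]|].
    have e2 := pow2_half k0; have := expn_gt0 2 k.-1; move: ea; rewrite a1 e2 /=; lia.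
  by rewrite {1}aE (negPf ea) -[(_ + _).+1]addn1 /pit_center !natrD /=; lra.
move: hX; rewrite /pit_center !natrD /=.
move=> hX; case: (ler0P (X - _)) => hs; first by congr clamp; lra.
by rewrite !clampN1//; lra.
Qed.

End Pits.

(** * Addresses in the Gray code and the interval property *)

Section GrayCode.
Variables (R : realType) (n : nat).
Implicit Types (i j k q s : nat) (X Y : R).
Local Notation width := (width R n).
Local Notation pit := (@pit R n).
Local Notation pit_center := (pit_center R n).
Local Notation wave := (@wave R n).
Local Notation in_cell := (@in_cell R n).

(* The transition zones of [wave i], [i < k], are around multiples of
   [2 * width k]. *)
Lemma wave_window k s X : `|X - (2 * s)%N%:R * width k| <= 4^-1 ->
  wave k X = wave k ((2 * s)%N%:R * width k) /\ (wave k X = 1 \/ wave k X = -1).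
Proof.
move=> hX; have w1 := width_ge1 R n k.
have h i : pit k i X = (if (s == 2 * i + 1)%N then -1 else 1) /\
    pit k i ((2 * s)%N%:R * width k) = (if (s == 2 * i + 1)%N then -1 else 1).
  have [e|si] := eqVneq s (2 * i + 1)%N.
    rewrite e (_ : 2 * (2 * i + 1) = 4 * i + 2)%N in hX *; last by lia.
    by rewrite /pit /pit_center subrr normr0 !clampN1//; lra.
  have far : 2 * width k <= `|(2 * s)%N%:R * width k - pit_center k i|.
    rewrite /pit_center -mulrBl normrM (ger0_norm (le_trans ler01 w1)).
    rewrite ler_wpM2r ?(le_trans ler01)//.
    have [h|h] : (2 * s + 2 <= 4 * i + 2)%N \/ (4 * i + 2 + 2 <= 2 * s)%N.
    - by move/eqP: si; lia.
    - rewrite distrC; apply: le_trans (ler_norm _); move: h.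
      by rewrite -(ler_nat R) (natrD _ (2 * s)); lra.
    - by apply: le_trans (ler_norm _); move: h; rewrite -(ler_nat R)
        (natrD _ (4 * i + 2)); lra.
  split; apply: far_pit; last by apply: le_trans far; lra.
  have := ler_distD X ((2 * s)%N%:R * width k) (pit_center k i).
  rewrite (distrC _ X); lra.
split; first by apply: eq_bigr => i _; rewrite (h i).1 (h i).2.
pose P t := t = 1 :> R \/ t = -1.
rewrite -/(P _) /wave; apply: (big_ind P); rewrite /P; first by left.
  by move=> x y hx hy; case: (leP x y).
by move=> i _; rewrite (h i).1; case: ifP; [right|left].
Qed.

Lemma wave_left k X : (k < n)%N -> X <= 2 * width k + 4^-1 ->
  wave k X = clamp (-4 * (X - width k)).
Proof.
move=> kn hX; have W : 2 ^+ (n - k) = 2 * width k.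
  by rewrite /width -exprS; congr (_ ^+ _); lia.
rewrite (@wave_cell _ _ k 0) ?expn_gt0// ?mul1r//.
  by split; [left|right; rewrite W mul1r].
by move=> k0; rewrite (le_trans hX)// lerD2r -W k0 subn0.
Qed.

(** The left half of the first pit of level [j] runs from [width j] to [2 * width j], which is the
    width of the previous level; these halves chain up to [2 ^+ n]. *)
Lemma wave_covered k X : (k < n)%N -> width k + 4^-1 <= X -> X <= 2 ^+ n ->
  exists2 j, (j <= k)%N & wave j X = -1.
Proof.
have low j : (j < n)%N -> width j + 4^-1 <= X -> X <= 2 * width j + 4^-1 ->
    wave j X = -1.
  by move=> jn h1 h2; rewrite wave_left// clampN1//; lra.
elim: k => [|k IH] kn h1 h2.
  by exists 0%N => //; apply: low => //; move: h2; rewrite (width_total R kn) /=; lra.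
have [h|h] := leP X (2 * width k.+1 + 4^-1); first by exists k.+1 => //; exact: low.
have [||//|j jk jX] := IH; first exact: ltnW.
  by rewrite widthS// ltW.
by exists j => //; exact: leqW.
Qed.

Lemma wave_right k X : (0 < k < n)%N -> 2 ^+ n <= X -> wave k X = 1.
Proof.
move=> /andP[k0 kn] hX; have w1 := width_ge1 R n k.
have [/wave_pit[i ik ->]|h|//] := ltgtP (wave k X) 1; last first.
  by have := @wave_le1 R n k X; lra.
apply: far_pit; rewrite (le_trans _ (ler_norm _))//.
rewrite (width_total R kn) in hX.
have h : (4 * i + 2 + 2 <= 2 ^ k.+1)%N.
  by rewrite expnS (pow2_half k0); lia.
have {h} : 0 <= ((2 ^ k.+1)%N%:R - (4 * i + 2)%N%:R - 2) * width k.
  apply: mulr_ge0; last by lra.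
  by move: h; rewrite -(ler_nat R) (natrD _ (4 * i + 2)); lra.
by rewrite /pit_center; lra.
Qed.

Lemma wave0 X : wave 0 X = clamp (4 * (`|X - 2 * width 0| - width 0)).
Proof. by rewrite (@wave_eq_pit _ _ 0 0)// => -[]. Qed.

Variable b : nat -> bool.

(* [code_cell q] is the index of the dyadic cell of level [q] on which the first
   [q] waves have the signs prescribed by [b]. *)
Fixpoint code_cell q : nat :=
  if q is q'.+1 then (2 * code_cell q' + (odd (code_cell q') (+) ~~ b q'))%N else 0%N.

(** The midpoint of a unit interval, at distance at least 1/2 from all edges of pits. *)
Definition code_point : R := (code_cell n)%:R + 2^-1.

Lemma code_cell_lt q : (code_cell q < 2 ^ q)%N.
Proof. by elim: q => // q IH; rewrite expnS /=; case: addb; lia. Qed.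

Lemma code_cell_nested q d :
  (code_cell q * 2 ^ d <= code_cell (q + d) < (code_cell q).+1 * 2 ^ d)%N.
Proof.
elim: d => [|d IH]; first by rewrite addn0 expn0 !muln1 leqnn ltnSn.
by rewrite addnS expnS /=; case: addb; lia.
Qed.

Lemma code_pointP q : (q <= n)%N ->
  (code_cell q)%:R * 2 ^+ (n - q) + 2^-1 <= code_point <=
  (code_cell q).+1%:R * 2 ^+ (n - q) - 2^-1.
Proof.
move=> qn; have := code_cell_nested q (n - q); rewrite subnKC// /code_point.
rewrite -(ler_nat R) -(ler_nat R (code_cell n).+1) !natrM natrX -[(code_cell n).+1]addn1.
by rewrite (natrD _ (code_cell n)) => /andP[]; lra.
Qed.

Lemma code_point_cell q : (q <= n)%N -> in_cell q (code_cell q) code_point.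
Proof. by move=> /code_pointP; split; right; lra. Qed.

Lemma code_point_side k : (k < n)%N ->
  if odd (code_cell k) (+) ~~ b k
  then (2 * code_cell k + 1)%N%:R * width k + 2^-1 <= code_point
  else code_point <= (2 * code_cell k + 1)%N%:R * width k - 2^-1.
Proof.
move=> kn; have /= := code_pointP kn; rewrite -/(width k).
case: addb => /=; first by case/andP.
by rewrite addn0 addn1; case/andP.
Qed.

Lemma code_point_total : code_point <= 2 ^+ n.
Proof. by have := code_pointP (leq0n n); rewrite subn0 mul1r; lra. Qed.

Lemma wave_code_point k : (k < n)%N -> wave k code_point = if b k then 1 else -1.
Proof.
move=> kn; have := code_point_side kn.
rewrite (wave_cell kn (code_cell_lt k) (code_point_cell (ltnW kn))); last first.
  by move=> _; have := code_point_total; lra.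
by case: (odd _); case: (b k) => /= h; case: clampP; lra.
Qed.

Definition between (x y z : R) := x <= y <= z \/ z <= y <= x.

(** Moving from [X] towards the code point never spoils the [k]-th condition: the wave can change
    only towards the value prescribed by [b]. *)
Definition wave_between k X := forall Y, between code_point Y X ->
  if b k then wave k X <= wave k Y else wave k Y <= wave k X.

Lemma in_cell_between q alpha X Y Z : in_cell q alpha X -> in_cell q alpha Z ->
  between X Y Z -> in_cell q alpha Y.
Proof.
move=> [hX1 hX2] [hZ1 hZ2] hY; split.
  case: hX1 hZ1 => [?|h1] [?|h2]; first [by left|by right; case: hY; lra].
case: hX2 hZ2 => [?|h1] [?|h2]; first [by left|by right; case: hY; lra].
Qed.

(** [wave k] is a single ramp on the cell, hence monotone there. A point on the wrong half is either
    within 1/4 of the midpoint, so still in the widened next cell, or past the ramp, where the wave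
    has exactly the opposite value. *)
Lemma wave_cell_between k X : (k < n)%N -> in_cell k (code_cell k) X ->
  (k = 0%N -> X <= 2 ^+ n + 4^-1) ->
  wave_between k X /\
  (in_cell k.+1 (code_cell k.+1) X \/ wave k X = if b k then -1 else 1).
Proof.
move=> kn hX h0; have side := code_point_side kn; have w1 := width_ge1 R n k.
have cX := wave_cell kn (code_cell_lt k) hX h0.
split.
  move=> Y hY; have hYc := in_cell_between (code_point_cell (ltnW kn)) hX hY.
  rewrite cX (wave_cell kn (code_cell_lt k) hYc); last first.
    move=> k0; have := code_point_total; have := h0 k0; case: hY; lra.
  move: side hY; set z := _ * width k => side hY.
  case: (odd _) side; case: (b k) => /= side; case: clampP => ?; case: clampP => ?;
     case: hY; lra.
have E : 2 ^+ (n - k.+1) = width k by [].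
rewrite /in_cell E cX; move: hX => [hl hr].
have W : 2 ^+ (n - k) = 2 * width k by rewrite /width -exprS; congr (_ ^+ _); lia.
rewrite W in hl hr.
rewrite /=; case: (boolP (odd _ (+) _)) => oe.
  have [hX|hX] := leP ((2 * code_cell k + 1)%N%:R * width k - 4^-1) X; last first.
    right; move: oe; case: (odd _); case: (b k) => //= _; case: clampP; lra.
  left; split; first by right.
  case: hr => [e|hr]; [left|right].
    have := expn_gt0 2 k; rewrite expnS e; lia.
  rewrite (_ : (2 * code_cell k + 1).+1 = (2 * (code_cell k).+1)%N); last by lia.
  by rewrite natrM; lra.
rewrite addn0.
have [hX|hX] := leP X ((2 * code_cell k + 1)%N%:R * width k + 4^-1); last first.
  right; move: oe; case: (odd _); case: (b k) => //= _; case: clampP; lra.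
left; split; last by right; rewrite -addn1.
case: hl => [e|hl]; [by left; rewrite e|right].
by rewrite natrM; lra.
Qed.

(** Beyond [2 ^+ n] lies the second edge of the pit of level 0; seen from a code point inside that
    pit, the wave only rises. *)
Lemma wave0_between X : ~~ b 0 -> (0 < n)%N -> 2 ^+ n < X -> wave_between 0 X.
Proof.
move=> b0 n0 hX Y; rewrite (negPf b0) !wave0.
have := code_point_side n0; rewrite /= b0 mul1r => side.
have W : 2 ^+ n = 2 * width 0 by rewrite (width_total R n0).
have w1 := width_ge1 R n 0.
have xn := code_point_total; rewrite W in hX xn.
case; last by lra.
move=> /andP[xY YX]; rewrite (ger0_norm (_ : 0 <= X - _)); last by lra.
have [hY|hY] := leP Y (2 * width 0).
  rewrite clampN1; first exact: clamp_ge.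
  by rewrite ler0_norm; lra.
by apply: clamp_mono; rewrite ger0_norm; lra.
Qed.

(** [X] is followed down the nested cells of the code. If it leaves them at level [q], then [wave q]
    has the fully wrong value, and the levels after [q] are left to the amplitudes. *)
Lemma code_dichotomy X : (0 < n)%N -> (b 0 -> X <= 2 ^+ n + 4^-1) ->
  (forall k, (k < n)%N -> wave_between k X) \/
  exists q, [/\ (q < n)%N, wave q X = (if b q then -1 else 1) &
                forall k, (k <= q)%N -> wave_between k X].
Proof.
move=> n0 hX.
suff H q : (q <= n)%N -> (in_cell q (code_cell q) X /\
     forall k, (k < q)%N -> wave_between k X) \/
  exists q, [/\ (q < n)%N, wave q X = (if b q then -1 else 1) &
                forall k, (k <= q)%N -> wave_between k X].
  by case: (H n (leqnn n)) => [[_ h]|h]; [left|right].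
elim: q => [|q IH] qn; first by left; split => //; split; left.
case: (IH (ltnW qn)) => [[hc hb]|]; last by right.
have [[q0 [b0 hX2]]|hq] : (q = 0%N /\ ~~ b 0 /\ 2 ^+ n + 4^-1 < X) \/
    (q = 0%N -> X <= 2 ^+ n + 4^-1).
  case: (posnP q) => [->|q0]; last by right => e; rewrite e in q0.
  case: (leP X (2 ^+ n + 4^-1)) => h; first by right.
  left; split => //; split => //; apply/negP => /hX; lra.
- left; rewrite q0; split; last first.
    by move=> [|//] _; apply: wave0_between => //; lra.
  rewrite /= b0; split; last by left.
  right; have := width_ge1 R n 0; have := width_total R n0 (k := 0).
  by rewrite /width !mul1r /=; lra.
have [bq [hc'|hop]] := wave_cell_between qn hc hq.
  left; split => // k; rewrite ltnS leq_eqVlt => /predU1P[->//|]; exact: hb.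
right; exists q; split => // k; rewrite leq_eqVlt => /predU1P[->//|]; exact: hb.
Qed.

End GrayCode.

(** * Heights: waves raised by walls *)

Section Heights.
Variables (R : realType) (n : nat).
Implicit Types (i j k : nat) (X Y r s : R).
Local Notation width := (width R n).
Local Notation wave := (@wave R n).

Definition depth k : R := (n - k)%N%:R.

Definition wall k s : R := clamp (4 * (s - depth k)).

(* The factor beats the slopes of [wall] and the size of the walls, so that [wave i]
   dominates [wall j] for [i < j]. *)
Definition amp k : R := (2 * n.+1%:R)^-1 ^+ k.

Definition height k X s : R := amp k * Num.max (wave k X) (wall k s).

Lemma amp_gt0 k : 0 < amp k.
Proof. by rewrite exprn_gt0// invr_gt0 mulr_gt0// ltr0n. Qed.

Lemma amp_le1 k : amp k <= 1.
Proof.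
rewrite exprn_ile1// ?invr_ge0 ?mulr_ge0// invf_le1 ?mulr_gt0 ?ltr0n//.
by have : 1 <= n.+1%:R :> R by [rewrite ler1n]; lra.
Qed.

Lemma amp_decay i j : (i < j)%N -> 2 * n.+1%:R * amp j <= amp i.
Proof.
move=> ij; have c0 : 0 < 2 * n.+1%:R :> R by rewrite mulr_gt0 ?ltr0n.
rewrite /amp -(subnKC ij) addSn exprS mulrA divff ?lt0r_neq0// mul1r exprD.
by rewrite ler_piMr ?exprn_ge0 ?invr_ge0 ?(ltW c0)//; exact: amp_le1.
Qed.

Lemma amp_lt i j : (i < j)%N -> amp j < amp i.
Proof.
move=> /amp_decay; have c1 : 1 <= n.+1%:R :> R by rewrite ler1n.
have a0 := amp_gt0 j; have : 0 <= (n.+1%:R - 1) * amp j by rewrite mulr_ge0// ?ltW//; lra.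
lra.
Qed.

Lemma wall_mono k r s : r <= s -> wall k r <= wall k s.
Proof. by move=> rs; apply: clamp_mono; lra. Qed.

Lemma wall_continuous k : continuous (wall k).
Proof.
move=> s; apply: (@ct_comp _ _ _ (fun s => 4 * (s - depth k))); last first.
  exact: clamp_continuous.
apply: (@ctM _ _ (fun=> 4)); first exact: ct_cst.
by apply: ctBr; [exact: ct_id|exact: ct_cst].
Qed.

Lemma depth_lt i j : (i < j < n)%N -> depth j + 1 <= depth i.
Proof. by move=> ij; rewrite /depth -(natrD _ _ 1) ler_nat; lia. Qed.

(** Earlier walls stand farther out, by at least 1, which exceeds the length 1/2 of a transition. So
    where [wall i] has started to rise, the later surfaces are at full height. *)
Lemma wall_next i j s : (i < j < n)%N -> -1 < wall i s -> wall j s = 1.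
Proof.
by move=> /depth_lt ij /clamp_gtN1 h; apply: clamp1; lra.
Qed.

Lemma wall0 k : (k < n)%N -> wall k 0 = -1.
Proof.
move=> kn; apply: clampN1; have : 1 <= depth k by rewrite ler1n subn_gt0.
by lra.
Qed.

Lemma wall_far k s : n.+1%:R <= s -> wall k s = 1.
Proof.
move=> h; apply: clamp1; have : depth k <= n%:R by rewrite ler_nat leq_subr.
by move: h; rewrite -addn1 natrD; lra.
Qed.

Lemma wall_lt1 k s : wall k s < 1 -> s < n.+1%:R.
Proof. by apply: contraLR; rewrite -!leNgt => /(wall_far k) ->. Qed.

Lemma height_le k X s : height k X s <= amp k.
Proof. by rewrite ger_pMr ?amp_gt0// ge_max wave_le1 clamp_le. Qed.

Lemma height_ge k X s : - amp k <= height k X s.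
Proof. by rewrite -mulN1r mulrC ler_pM2l ?amp_gt0// le_max wave_geN1. Qed.

Lemma height_wave1 k X s : wave k X = 1 -> height k X s = amp k.
Proof. by rewrite /height => ->; rewrite max_l ?mulr1// clamp_le. Qed.

Lemma height_waveN1 k X s : wave k X = -1 -> height k X s = amp k * wall k s.
Proof. by rewrite /height => ->; rewrite max_r// clamp_ge. Qed.

Lemma height_wall1 k X s : wall k s = 1 -> height k X s = amp k.
Proof. by rewrite /height => ->; rewrite max_r ?mulr1// wave_le1. Qed.

Lemma height_mono k X Y r s : wave k X <= wave k Y -> r <= s ->
  height k X r <= height k Y s.
Proof.
move=> h1 h2; rewrite ler_pM2l ?amp_gt0// ge_max; apply/andP; split.
  by apply: (le_trans h1); rewrite le_max lexx.
by apply: (le_trans (wall_mono k h2)); rewrite le_max lexx orbT.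
Qed.

(** In a pit whose wall is still down the height is [- amp i], which is below [- amp j]. *)
Lemma wall_of_height i j X s : (i < j)%N -> - amp j <= height i X s ->
  wave i X = -1 -> -1 < wall i s.
Proof.
move=> ij h hw; move: h; rewrite height_waveN1// => h.
rewrite ltNge; apply/negP => /(ler_wpM2l (ltW (amp_gt0 i))).
by have := amp_lt ij; lra.
Qed.

Lemma height_transition k X s : wall k s < wave k X -> height k X s = amp k * wave k X.
Proof. by move=> h; rewrite /height max_l// ltW. Qed.

(** The first edge of level [k] is an even multiple of [width j], around which [wave j] is constant;
    only [wave k] moves there, with slope -4. *)
Lemma wave_slope k j X Y : (k < j < n)%N -> X <= 2 * width k + 4^-1 -> Y <= X ->
  -1 < wave k X < 1 -> wave k Y < 1 ->
  [/\ wave k Y = wave k X + 4 * (X - Y), wave j Y = wave j X &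
      wave j X = 1 \/ wave j X = -1].
Proof.
move=> kjn hX YX hw hY; have kn : (k < n)%N by lia.
have w1 := width_ge1 R n k; have := width_lt R kjn.
move: hw hY; rewrite !(wave_left kn)//; last by lra.
set N := (_ * _)%N => + + NE.
have win Z : `|Z - width k| <= 4^-1 -> wave j Z = wave j (width k) /\
    (wave j Z = 1 \/ wave j Z = -1).
  by rewrite NE; exact: wave_window.
case: clampP => [h1|h1 h1'|h1] /andP[h2 h3]; [lra| |lra].
case: clampP => [h4|h4 h4'|h4] h5; [lra| |lra].
have [|eX oX] := win X; first by rewrite ler_norml; lra.
have [|eY _] := win Y; first by rewrite ler_norml; lra.
by split=> //; [lra|rewrite eX eY].
Qed.

(* This makes the cell of an initial segment star-shaped about the pole of the
   projection. *)
Lemma prefix_outward j X s t : (0 < j)%N -> (j <= n)%N -> 0 <= s -> 1 <= t ->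
  (forall k i, (k < j)%N -> (j <= i < n)%N -> height i X s < height k X s) ->
  forall k i, (k < j)%N -> (j <= i < n)%N ->
  height i (2 ^+ n + t * (X - 2 ^+ n)) (t * s) <
  height k (2 ^+ n + t * (X - 2 ^+ n)) (t * s).
Proof.
move=> j0 jn s0 t1 H k i kj /andP[ji ni]; set Y := _ + _.
have n0 : (0 < n)%N by exact: leq_trans j0 jn.
have W := @width_total R n 0 n0.
have k_i : (k < i)%N by exact: leq_trans kj ji.
have ki : (k < i < n)%N by rewrite k_i.
have kn : (k < n)%N by exact: ltn_trans ni.
have st : s <= t * s by rewrite ler_peMl.
have ai := amp_lt (proj1 (andP ki)).
have above u v : height k u v = amp k -> height i u v < height k u v.
  by move=> ->; exact: le_lt_trans (height_le _ _ _) ai.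
have Hki := H k i kj; rewrite ji ni in Hki; have {Hki} Hki := Hki isT.
have keep : height k X s <= height k Y (t * s) -> height i X s = amp i ->
    height i Y (t * s) < height k Y (t * s).
  move=> h1 h2; apply: le_lt_trans (height_le _ _ _) _; rewrite -h2.
  exact: lt_le_trans h1.
(* The dilation fixes [2 ^+ n]. To its right all waves but the one of level 0 equal 1, and that one
   only rises. *)
have [hX|hX] := leP (2 ^+ n) X.
  have hY : 2 ^+ n <= Y by rewrite lerDl mulr_ge0//; lra.
  have i0 : (0 < i < n)%N by rewrite ni (leq_ltn_trans (leq0n k) k_i).
  have iX u : height i X u = amp i by rewrite height_wave1// wave_right.
  case: (posnP k) => [k0|k0]; last by apply: above; rewrite height_wave1// wave_right ?k0.
  apply: keep => //; apply: height_mono => //; rewrite k0 !wave0; apply: clamp_mono.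
  have w1 := width_ge1 R n 0.
  have XY : X <= Y.
    by have : 0 <= (t - 1) * (X - 2 ^+ n) by [apply: mulr_ge0; lra]; rewrite /Y; lra.
  by rewrite !ger0_norm; lra.
have YX : Y <= X.
  by have : 0 <= (t - 1) * (2 ^+ n - X) by [apply: mulr_ge0; lra]; rewrite /Y; lra.
(* Past the left half of its first pit [wave k] is no longer a single ramp, but then [X] lies in a
   pit of an earlier level [k']. Surface [k'] can exceed surface [i] there only by its wall, which
   puts [wall k] at 1. *)
have [hX'|hX'] := leP X (2 * width k + 4^-1); last first.
  have [k0|k0] := posnP k.
    by move: hX' hX; rewrite k0 W; lra.
  have kn' : (k.-1 < n)%N by exact: leq_ltn_trans (leq_pred k) kn.
  have [||k' k'k hk'] := wave_covered kn' (X := X).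
  - by rewrite widthS ?prednK// ltW.
  - exact: ltW.
  apply: above; apply: height_wall1; apply/eqP; rewrite eq_le clamp_le /=.
  have k'_k : (k' < k)%N by rewrite -(prednK k0).
  have k'i : (k' < i)%N by exact: ltn_trans k_i.
  have k'j : (k' < j)%N by exact: ltn_trans kj.
  have h' := H k' i k'j; rewrite ji ni in h'.
  have h'' : - amp i <= height k' X s by apply: le_trans (ltW (h' isT)); exact: height_ge.
  have e : wall k s = 1.
    by apply: (@wall_next k'); [rewrite k'_k|exact: wall_of_height h'' hk'].
  by apply: le_trans (wall_mono k st); rewrite e.
have wYX : wave k X <= wave k Y.
  by rewrite !(wave_left kn)//; [apply: clamp_mono|]; lra.
have hkeep : height k X s <= height k Y (t * s) by exact: height_mono.
(* If the wall gives the height of surface [k], it has left -1, so surface [i] is already at its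
   maximum. *)
have [wk|wk] := leP (wave k X) (wall k s).
  apply: keep => //; apply: height_wall1; apply: (wall_next ki).
  have := le_lt_trans (height_ge i X s) Hki; rewrite /height max_r// => h.
  rewrite ltNge; apply/negP => /(ler_wpM2l (ltW (amp_gt0 k))); lra.
have wX1 : -1 < wave k X by apply: le_lt_trans wk; exact: clamp_ge.
have [wY1|wY1] := ltP (wave k Y) 1; last first.
  by apply: above; apply: height_wave1; apply/eqP; rewrite eq_le wY1 wave_le1.
have wX2 : -1 < wave k X < 1 by rewrite wX1 (le_lt_trans wYX).
have [eY ei [ei'|ei']] := wave_slope ki hX' YX wX2 wY1.
  by apply: keep => //; exact: height_wave1.
have [wi|wi] := ltP (wall i s) 1; last first.
  by apply: keep => //; apply: height_wall1; apply/eqP; rewrite eq_le wi clamp_le.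
rewrite (height_waveN1 _ (etrans ei ei')).
have hk : height k X s = amp k * wave k X by rewrite height_transition.
have hk' : amp k * wave k Y <= height k Y (t * s).
  by rewrite ler_pM2l ?amp_gt0// le_max lexx.
rewrite hk (height_waveN1 _ ei') in Hki.
have lip : wall i (t * s) <= wall i s + 4 * ((t - 1) * s).
  have h0 : 0 <= (t - 1) * s by rewrite mulr_ge0//; lra.
  rewrite /wall; set u := (t - 1) * s in h0 *.
  rewrite (_ : t * s = s + u); last by rewrite /u; ring.
  by clear -h0; case: clampP => ?; case: clampP => ?; lra.
apply: lt_le_trans hk'; rewrite eY.
have dXY : X - Y = (t - 1) * (2 ^+ n - X) by rewrite /Y; ring.
have ai0 := amp_gt0 i.
have lip' := ler_wpM2l (ltW ai0) lip.
apply: le_lt_trans lip' _; rewrite mulrDr mulrDr.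
apply: ltr_leD => //; rewrite dXY.
have w01 := width_ge1 R n 0.
have wk0 : width k <= width 0 by rewrite ler_weXn2l ?ler1n// leq_sub2l.
have gap : 1 / 2 <= 2 ^+ n - X.
  by move: wX1; rewrite (wave_left kn)// => /clamp_gtN1; lra.
have sn := wall_lt1 wi.
(* The amplitude ratio is made for this: [wall i] gains at most [4 * ((t - 1) * s)] with [s] below
   [n.+1%:R], while [wave k] gains at least half of [4 * (t - 1)]. *)
have di := amp_decay (proj1 (andP ki)).
have ak0 := amp_gt0 k.
have h1 : amp i * s <= amp i * n.+1%:R by rewrite ler_pM2l// ltW.
have h2 : amp k * (1 / 2) <= amp k * (2 ^+ n - X) by rewrite ler_pM2l.
have : 0 <= (t - 1) * (amp k * (2 ^+ n - X) - amp i * s) by apply: mulr_ge0; lra.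
lra.
Qed.

End Heights.
(** * Regions *)

Section Field.
Variables (R : realType) (n d : nat).
Implicit Types (i j k : nat) (q : 'rV[R]_d.+1).
Local Notation width := (width R n).
Local Notation wave := (@wave R n).

(** The shift puts the abscissa [2 ^+ n] at the origin, so that dilations of [q] are those of
    [prefix_outward]; there [wave 0] is at the centre of its pit. *)
Definition field k q : R := height n k (q 0 0 + 2 ^+ n) `|row_tail q|.

Lemma field_continuous k : continuous (field k).
Proof.
move=> q; apply: (@ctM _ _ (fun=> amp R n k) (fun q : 'rV[R]_d.+1 =>
  Num.max (wave k (q 0 0 + 2 ^+ n)) (wall n k `|row_tail q|))); first exact: ct_cst.
apply: ct_max.
  apply: (@ct_comp _ _ _ (fun q : 'rV[R]_d.+1 => q 0 0 + 2 ^+ n : R)).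
    by apply: ctDr; [exact: coord_continuous|exact: ct_cst].
  exact: wave_continuous.
apply: (@ct_comp _ _ _ (fun q : 'rV[R]_d.+1 => `|row_tail q| : R)).
  apply: (@ct_norm R _ 'rV[R]_d); apply: ct_row_tail; exact: ct_id.
exact: wall_continuous.
Qed.

Lemma field_le k q : field k q <= amp R n k.
Proof. exact: height_le. Qed.

Lemma field_norm k q : `|field k q| <= 1.
Proof.
rewrite ler_norml (le_trans _ (height_ge n k _ _)) ?lerN2 ?amp_le1//.
exact: le_trans (field_le k q) (amp_le1 R n k).
Qed.

(** Either the walls are passed, or the tail contributes at most the second summand to the squared
    Euclidean norm; then the first coordinate is at least [3 * 2 ^+ n] in absolute value, which
    leaves all pits behind. *)
Definition far_bound : R := (3 * 2 ^+ n) ^+ 2 + d%:R * n.+1%:R ^+ 2.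

Lemma field_far k q : (k < n)%N -> far_bound <= enorm q ^+ 2 -> field k q = amp R n k.
Proof.
move=> kn hq; have [hz|hz] := leP n.+1%:R `|row_tail q|.
  by rewrite /field height_wall1// wall_far.
rewrite /field height_wave1//; have w1 := width_ge1 R n k.
have tail_le : enorm (row_tail q) ^+ 2 <= d%:R * n.+1%:R ^+ 2.
  rewrite enorm_sqr (_ : d%:R * _ = \sum_(i < d) n.+1%:R ^+ 2 :> R); last first.
    by rewrite sumr_const card_ord mulr_natl.
  apply: ler_sum => i _; rewrite -[_ ^+ 2]ger0_norm ?sqr_ge0// normrX.
  rewrite ler_pXn2r ?nnegrE//.
  exact: le_trans (normr_row_le _ i) (ltW hz).
have hq0 : (3 * 2 ^+ n) ^+ 2 <= q 0 0 ^+ 2.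
  by move: hq tail_le; rewrite /far_bound enorm_tail; lra.
have p0 : 0 < 2 ^+ n :> R by rewrite exprn_gt0.
have t0 : 0 < 3 * 2 ^+ n :> R by lra.
have : 3 * 2 ^+ n <= `|q 0 0|.
  rewrite -(@ler_pXn2r _ 2)// ?nnegrE ?(ltW t0)// -[leRHS]normrX.
  by rewrite [leRHS]ger0_norm// sqr_ge0.
rewrite ler_normr => /orP h.
have [/wave_pit[i ik ->]|h1] := ltP (wave k (q 0 0 + 2 ^+ n)) 1; last first.
  by apply/eqP; rewrite eq_le wave_le1.
apply: far_pit.
have : (4 * i + 2 + 2 <= 2 * 2 ^ k.+1)%N.
  by case: k ik {kn w1} => [|k] /=; rewrite ?expnS; lia.
rewrite -(ler_nat R) (natrD _ (4 * i + 2)) natrM => hi.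
have hw : 0 <= (2 * (2 ^ k.+1)%N%:R - (4 * i + 2)%N%:R - 2) * width k.
  by apply: mulr_ge0; lra.
have hw' : 0 <= (4 * i)%N%:R * width k by apply: mulr_ge0; [exact: ler0n|lra].
have W := @width_total R n k kn.
case: h => h.
  rewrite (le_trans _ (ler_norm _))// /pit_center; lra.
rewrite -normrN (le_trans _ (ler_norm _))// /pit_center natrD; lra.
Qed.

Definition vgauge k : 'rV[R]_d.+2 -> R := cone_gauge (field k) (amp R n k).

Lemma amp_norm k : `|amp R n k| <= 1.
Proof. by rewrite ger0_norm ?amp_le1// ltW// amp_gt0. Qed.

Lemma vgauge_gauge k : (k < n)%N -> gauge (vgauge k).
Proof.
move=> kn; apply: (@cone_gauge_gauge _ _ _ _ far_bound).
- exact: field_continuous.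
- exact: field_norm.
- exact: amp_norm.
- by move=> q; exact: field_far.
Qed.

Definition vradius k : 'rV[R]_d.+2 -> R := radius (field k) (amp R n k).

Lemma vgauge_lt1 k y : (vgauge k y < 1) = (enorm y < vradius k y).
Proof. exact: cone_gauge_lt1 (field_norm k) (amp_norm k) y. Qed.

Lemma vgauge_gt1 k y : (1 < vgauge k y) = (vradius k y < enorm y).
Proof. exact: cone_gauge_gt1 (field_norm k) (amp_norm k) y. Qed.

Lemma vgauge_eq1 k y : (vgauge k y = 1) <-> (enorm y = vradius k y).
Proof. exact: cone_gauge_eq1 (field_norm k) (amp_norm k) y. Qed.

Lemma vradius_ge1 k y : 1 <= vradius k y.
Proof. exact: radius_ge1 (field_norm k) (amp_norm k) y. Qed.

Lemma vradius_stereo k y : 0 < pole_dist y -> vradius k y = 2 + field k (stereo y).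
Proof. by move=> py; rewrite /vradius /radius py. Qed.

Lemma vradius_pole k y : pole_dist y <= 0 -> vradius k y = 2 + amp R n k.
Proof. by move=> py; rewrite /vradius /radius ltNge py. Qed.

Implicit Types b : nat -> bool.

(** Here [true] means inside, opposite to the convention of [side]; [regionE] translates. *)
Definition cell b : set 'rV[R]_d.+2 := [set y | forall k, (k < n)%N ->
  if b k then enorm y < vradius k y else vradius k y < enorm y].

Definition window_cell b : set 'rV[R]_d.+2 := [set w : 'rV[R]_d.+2 | forall k, (k < n)%N ->
  if b k then w 0 0 < 2 + field k (row_tail w) else 2 + field k (row_tail w) < w 0 0].

Lemma open_forall_lt (T : topologicalType) (P : nat -> T -> Prop) N :
  (forall k, (k < N)%N -> open [set x | P k x]) ->
  open [set x | forall k, (k < N)%N -> P k x].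
Proof.
elim: N => [|N IH] hP.
  by rewrite (_ : mkset _ = setT); [exact: openT|apply/seteqP; split].
rewrite (_ : mkset _ = [set x | forall k, (k < N)%N -> P k x] `&` [set x | P N x]).
  by apply: openI; [apply: IH => k kN; apply: hP; exact: ltnW|exact: hP].
apply/seteqP; split => x /=.
  by move=> h; split; [move=> k kN; apply: h; exact: ltnW|exact: h].
by move=> [h1 h2] k; rewrite ltnS leq_eqVlt => /predU1P[->//|]; exact: h1.
Qed.

Lemma open_window_cell b : open (window_cell b).
Proof.
apply: open_forall_lt => k kn.
have c0 : continuous (fun w : 'rV[R]_d.+2 => w 0 0 : R) by exact: coord_continuous.
have cF : continuous (fun w : 'rV[R]_d.+2 => 2 + field k (row_tail w) : R).
  move=> w; apply: (@ctDr R _ (fun=> 2) (fun w : 'rV[R]_d.+2 => field k (row_tail w)));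
    first exact: ct_cst.
  apply: (@ct_comp _ _ _ (@row_tail R d.+1) (field k)).
    exact/ct_row_tail/ct_id.
  exact: field_continuous.
by case: (b k); exact: ct_lt_open.
Qed.

(** On the pole ray the radii of the surfaces decrease with the index, so a point there inside
    surface [k] is inside every earlier one. A cell with a gap therefore avoids that ray. *)
Definition has_gap b := exists i k, [/\ (i < k < n)%N, ~~ b i & b k].

Lemma no_gap b : ~ has_gap b ->
  exists2 j, (j <= n)%N & forall k, (k < n)%N -> b k = (k < j)%N.
Proof.
move=> h; suff H N : (N <= n)%N ->
    exists2 j, (j <= N)%N & forall k, (k < N)%N -> b k = (k < j)%N by exact: H.
elim: N => [_|N IH Nn]; first by exists 0%N.
have [j jN hj] := IH (ltnW Nn).
have [bN|bN] := boolP (b N).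
  exists N.+1 => // k kN; rewrite kN; move: kN; rewrite ltnS leq_eqVlt.
  case/predU1P => [->//|kN]; apply/negPn/negP => bk; apply: h; exists k, N.
  by rewrite kN Nn.
exists j; first exact: leqW.
move=> k; rewrite ltnS leq_eqVlt => /predU1P[->|/hj//].
by rewrite (negPf bN) ltnNge jN.
Qed.

Lemma cell_pole_dist b y : has_gap b -> cell b y -> 0 < pole_dist y.
Proof.
move=> [i [k [/andP[ik kn] bi bk]]] hy; rewrite ltNge; apply/negP => py.
have := hy _ kn; have := hy _ (ltn_trans ik kn); rewrite (negPf bi) bk !vradius_pole//.
by have := amp_lt R n ik; lra.
Qed.

Lemma cell_window b : has_gap b -> homeomorphic (cell b) (window_cell b).
Proof.
move=> gb; have [i [k [/andP[ik kn] bi bk]]] := gb.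
have w0 w : window_cell b w -> 0 < w 0 0.
  move=> /(_ _ (ltn_trans ik kn)); rewrite (negPf bi).
  by have := field_norm i (row_tail w); rewrite ler_norml; lra.
apply: (@homeo_homeomorphic _ _ _ _ (fun y => row_cons (enorm y) (stereo y))
  (fun w : 'rV[R]_d.+2 => stereo_inv (w 0 0) (row_tail w))).
apply: homeo_pointwise.
- move=> y hy l ln; have := hy _ ln.
  by rewrite vradius_stereo ?(cell_pole_dist gb hy)// row_cons0 row_consK.
- move=> w hw l ln; have := hw _ ln; have w0' := w0 _ hw.
  by rewrite vradius_stereo ?pole_dist_stereo_inv_gt0// stereo_invK// enorm_stereo_inv// ltW.
- by move=> y /(cell_pole_dist gb) py; rewrite row_cons0 row_consK stereoK.
- move=> w /w0 w0'; rewrite enorm_stereo_inv ?ltW// stereo_invK//.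
  exact: row_eta.
- move=> y /(cell_pole_dist gb) py; apply: ct_row_cons; last exact: ct_stereo.
  exact: enorm_continuous.
- move=> w _; apply: ct_stereo_inv; first exact: coord_continuous.
  exact/ct_row_tail/ct_id.
Qed.

End Field.

(** * Cells away from the pole *)

Section GapCells.
Variables (R : realType) (n d : nat) (b : nat -> bool).
Hypotheses (n0 : (0 < n)%N) (gb : has_gap n b).
Implicit Types (k : nat) (X r s t : R) (w : 'rV[R]_d.+2).
Local Notation xi := (code_point R n b).
Local Notation height := (@height R n).

Definition admissible X r s := forall k, (k < n)%N ->
  if b k then r < 2 + height k X s else 2 + height k X s < r.

Lemma window_cellE w : window_cell n b w <->
  admissible (row_tail w 0 0 + 2 ^+ n) (w 0 0) `|row_tail (row_tail w)|.
Proof. by []. Qed.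

(** Conditions whose wave satisfies [wave_between] persist. After a fully wrong level [q] there are
    two cases. If [wave q] is 1, or is -1 with its wall down, the condition on surface [q] puts [r]
    beyond the range of all later surfaces; otherwise the later surfaces are constant. Either way
    the later conditions do not depend on the abscissa. *)
Lemma admissible_wave X r s t : 0 <= t <= 1 -> admissible X r s ->
  admissible (xi + t * (X - xi)) r s.
Proof.
move=> /andP[t0 t1] H; set Y := _ + _.
have bY : between xi Y X.
  have [h|h] := leP xi X; [left|right].
    have u0 : 0 <= t * (X - xi) by apply: mulr_ge0; lra.
    have : t * (X - xi) <= 1 * (X - xi) by apply: ler_wpM2r; lra.
    by rewrite /Y; lra.
  have u0 : 0 <= t * (xi - X) by apply: mulr_ge0; lra.
  have : t * (xi - X) <= 1 * (xi - X) by apply: ler_wpM2r; lra.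
  by rewrite /Y; lra.
have keep k : (k < n)%N -> wave_between n b k X ->
    if b k then r < 2 + height k Y s else 2 + height k Y s < r.
  move=> kn /(_ Y bY); have := H k kn; case: (b k) => h hw.
    by apply: lt_le_trans h _; rewrite lerD2l; exact: height_mono.
  by apply: le_lt_trans h; rewrite lerD2l; exact: height_mono.
(* Beyond [2 ^+ n] all waves but the one of level 0 equal 1. When [b 0] holds, neither surface of
   the gap is the first, so their conditions contradict the order of the amplitudes. *)
have hX : b 0 -> X <= 2 ^+ n + 4^-1.
  move=> b0; rewrite leNgt; apply/negP => hX.
  have [i [k [/andP[ik kn] bi bk]]] := gb.
  have i0 : (0 < i)%N by rewrite lt0n; apply: contraNneq bi => ->.
  have hX' : 2 ^+ n <= X by lra.
  have h j : (0 < j < n)%N -> height j X s = amp R n j.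
    by move=> jn; apply: height_wave1; exact: wave_right.
  have := H k kn; have := H i (ltn_trans ik kn); rewrite (negPf bi) bk !h.
  - by have := amp_lt R n ik; lra.
  - by rewrite (ltn_trans i0 ik) kn.
  - by rewrite i0 (ltn_trans ik kn).
have [h|[q [qn wq h]]] := @code_dichotomy R n b X n0 hX.
  by move=> k kn; exact: keep (h k kn).
move=> k kn; have [kq|qk] := leqP k q; first exact: keep (h k kq).
have qk' : (q < k < n)%N by rewrite qk.
have al := amp_lt R n qk; have := H k kn; have := H q qn.
case: (boolP (b q)) wq => bq wq hq.
  have [wl|wl] := leP (wall n q s) (-1).
    have ge := height_ge n k Y s; have ge' := height_ge n k X s.
    have : r < 2 - amp R n k.
      apply: lt_le_trans hq _; rewrite (height_waveN1 _ wq) lerD2l.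
      by have := ler_wpM2l (ltW (amp_gt0 R n q)) wl; lra.
    by case: (b k); lra.
  have e Z : height k Z s = amp R n k by apply: height_wall1; exact: wall_next qk' wl.
  by rewrite !e.
have le := height_le n k Y s; have le' := height_le n k X s.
by move: hq; rewrite (height_wave1 _ wq); case: (b k); lra.
Qed.

(** Over the code point the waves are exactly 1 or -1: surfaces prescribed to enclose the point are
    at full height whatever the walls, and lowering the walls lowers the others. *)
Lemma admissible_wall r s s' : s <= s' -> admissible xi r s' -> admissible xi r s.
Proof.
move=> ss H k kn; have := H k kn; have := wave_code_point R b kn.
case: (b k) => wk; first by rewrite !height_wave1.
by apply: le_lt_trans; rewrite lerD2l; exact: height_mono.
Qed.

(** On the axis all walls are down, and the conditions cut out an interval of radii around 2. *)
Lemma admissible0E r :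
  admissible xi r 0 <-> forall k, (k < n)%N ->
    if b k then r < 2 + amp R n k else 2 - amp R n k < r.
Proof.
split=> H k kn; have := H k kn; have := wave_code_point R b kn; case: (b k) => wk.
- by rewrite height_wave1.
- by rewrite (height_waveN1 _ wk) wall0// mulrN1.
- by rewrite height_wave1.
- by rewrite (height_waveN1 _ wk) wall0// mulrN1.
Qed.

Lemma admissible_radius r t : 0 <= t <= 1 -> admissible xi r 0 ->
  admissible xi (2 + t * (r - 2)) 0.
Proof.
move=> /andP[t0 t1] /admissible0E H; apply/admissible0E => k kn.
have := H k kn; have a0 := amp_gt0 R n k; case: (b k) => h.
  have [h2|h2] := leP r 2.
    by have : 0 <= t * (2 - r) by [apply: mulr_ge0; lra]; lra.
  have : t * (r - 2) <= 1 * (r - 2) by apply: ler_wpM2r; lra.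
  by lra.
have [h2|h2] := leP 2 r.
  by have : 0 <= t * (r - 2) by [apply: mulr_ge0; lra]; lra.
have : t * (2 - r) <= 1 * (2 - r) by apply: ler_wpM2r; lra.
by lra.
Qed.

Lemma admissible_center : admissible xi 2 0.
Proof. by apply/admissible0E => k _; have := amp_gt0 R n k; case: (b k); lra. Qed.

(** Common centre of the three contractions. Coordinate 0 is the radius, coordinate 1 the abscissa
    shifted by [2 ^+ n], and the others are transverse; [Ir], [Ix] and [Iz] select them. *)
Let c0 : 'rV[R]_d.+2 := row_cons 2 (row_cons (xi - 2 ^+ n) 0).
Let Ix : pred 'I_d.+2 := fun i => (i : nat) == 1%N.
Let Iz : pred 'I_d.+2 := fun i => (1 < (i : nat))%N.
Let Ir : pred 'I_d.+2 := fun i => (i : nat) == 0%N.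

Let scx t w : [/\ scale_coords c0 Ix t w 0 0 = w 0 0,
  row_tail (scale_coords c0 Ix t w) 0 0 + 2 ^+ n =
    xi + t * (row_tail w 0 0 + 2 ^+ n - xi) &
  row_tail (row_tail (scale_coords c0 Ix t w)) = row_tail (row_tail w)].
Proof.
split; first by rewrite mxE.
  by rewrite !mxE /= liftK mxE unlift_none; ring.
by apply/rowP => i; rewrite !mxE.
Qed.

Let scz t w : [/\ scale_coords c0 Iz t w 0 0 = w 0 0,
  row_tail (scale_coords c0 Iz t w) 0 0 = row_tail w 0 0 &
  row_tail (row_tail (scale_coords c0 Iz t w)) = t *: row_tail (row_tail w)].
Proof.
split; first by rewrite mxE.
  by rewrite !mxE.
apply/rowP => i; rewrite !mxE /= liftK mxE liftK mxE; ring.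
Qed.

Let scr t w : scale_coords c0 Ir t w 0 0 = 2 + t * (w 0 0 - 2) /\
  row_tail (scale_coords c0 Ir t w) = row_tail w.
Proof.
split; first by rewrite !mxE /= unlift_none.
by apply/rowP => i; rewrite !mxE.
Qed.

Lemma window_cell_homeomorphic : homeomorphic (@window_cell R n d b) [set: 'rV[R]_d.+2].
Proof.
have oW := @open_window_cell R n d b.
pose W1 : set 'rV[R]_d.+2 := [set w | @window_cell R n d b (scale_coords c0 Ix 0 w)].
pose W2 : set 'rV[R]_d.+2 := [set w | W1 (scale_coords c0 Iz 0 w)].
pose W3 : set 'rV[R]_d.+2 := [set w | W2 (scale_coords c0 Ir 0 w)].
have W1E w : W1 w <-> admissible xi (w 0 0) `|row_tail (row_tail w)|.
  rewrite /W1 /= window_cellE; have [-> -> ->] := scx 0 w.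
  by rewrite mul0r addr0.
have W2E w : W2 w <-> admissible xi (w 0 0) 0.
  rewrite /W2 /= W1E; have [-> _ ->] := scz 0 w.
  by rewrite scale0r normr0.
have osc I (W : set 'rV[R]_d.+2) : open W -> open [set w | W (scale_coords c0 I 0 w)].
  move=> oW'; apply: (@open_comp _ _ (scale_coords c0 I 0)) => // y _.
  by apply: ct_scale_coords; [exact: ct_cst|exact: ct_id].
have oW1 := osc Ix _ oW; have oW2 := osc Iz _ oW1.
have h1 : homeomorphic (@window_cell R n d b) W1.
  apply: fiber_homeomorphic => // w t; rewrite !window_cellE => hw t01.
  by have [-> -> ->] := scx t w; exact: admissible_wave.
have h2 : homeomorphic W1 W2.
  apply: fiber_homeomorphic => // w t /W1E hw t01; apply/W1E.
  have [-> _ ->] := scz t w; apply: admissible_wall hw.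
  by case/andP: t01 => t0 t1; rewrite normrZ ger0_norm// ler_piMl.
have h3 : homeomorphic W2 W3.
  apply: fiber_homeomorphic => // w t /W2E hw t01; apply/W2E.
  by have [-> _] := scr t w; exact: admissible_radius.
have <- : W3 = setT.
  apply/seteqP; split => w // _; apply/W2E; have [-> _] := scr 0 w.
  by rewrite mul0r addr0; exact: admissible_center.
exact: homeomorphic_trans h1 (homeomorphic_trans h2 h3).
Qed.

Lemma gap_cell_homeomorphic : homeomorphic (@cell R n d b) [set: 'rV[R]_d.+2].
Proof.
exact: homeomorphic_trans (@cell_window R n d b gb) window_cell_homeomorphic.
Qed.

End GapCells.

(** * Cells of initial segments, seen from the pole *)

Section PrefixCells.
Variables (R : realType) (n d j : nat).
Hypotheses (j0 : (0 < j)%N) (jn : (j < n)%N).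
Implicit Types (i k : nat) (s : 'rV[R]_d.+1) (t : R) (w y : 'rV[R]_d.+2).

(** Applying [stereo] after this reflection projects from the opposite pole and makes the original
    pole the origin. *)
Definition flip y : 'rV[R]_d.+2 := row_cons (- y 0 0) (row_tail y).

Lemma enorm_flip y : enorm (flip y) = enorm y.
Proof.
apply/eqP; rewrite -(@eqrXn2 _ 2)// ?enorm_ge0// !enorm_tail row_cons0 row_consK.
by rewrite sqrrN.
Qed.

Lemma flipK y : flip (flip y) = y.
Proof. by rewrite /flip row_cons0 row_consK opprK row_eta. Qed.

Lemma pole_dist_flip y : pole_dist (flip y) = enorm y - y 0 0.
Proof. by rewrite /pole_dist enorm_flip row_cons0. Qed.

Lemma ct_flip (T : topologicalType) (f : T -> 'rV[R]_d.+2) x :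
  {for x, continuous f} -> {for x, continuous (fun z => flip (f z))}.
Proof.
move=> cf; apply: ct_row_cons; last exact: ct_row_tail.
apply: (@ct_eq _ _ (fun z => 0 - f z 0 0 : R)); first by move=> z; rewrite sub0r.
by apply: ctBr; [exact: ct_cst|exact: ct_coord].
Qed.

Definition inversion s : 'rV[R]_d.+1 := (enorm s ^+ 2)^-1 *: s.

(** [inversion] is the change of coordinates between the two projections; the value at 0 is the
    constant value of [field] near infinity. *)
Definition polar_field k s : R := if s == 0 then amp R n k else field n k (inversion s).

Lemma enorm_inversion s : s != 0 -> enorm (inversion s) ^+ 2 = (enorm s ^+ 2)^-1.
Proof.
move=> /enorm_gt0 s0; rewrite /inversion enormZ ?invr_ge0 ?sqr_ge0//.
by field; rewrite lt0r_neq0.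
Qed.

Lemma polar_field_norm k s : `|polar_field k s| <= 1.
Proof. by rewrite /polar_field; case: ifP => _; [exact: amp_norm|exact: field_norm]. Qed.

Lemma polar_field_continuous k : (k < n)%N -> continuous (polar_field k).
Proof.
move=> kn s; have cn : continuous (fun s : 'rV[R]_d.+1 => enorm s ^+ 2 : R).
  move=> z; apply: (@ct_comp _ _ _ (@enorm R d.+1) (fun t : R => t ^+ 2)).
    exact: enorm_continuous.
  exact: exprn_continuous.
have [s0|s0] := eqVneq s 0.
  have oA : open [set z : 'rV[R]_d.+1 | far_bound R n d * enorm z ^+ 2 < 1].
    apply: ct_lt_open => z; last exact: ct_cst.
    apply: (@ctM _ _ (fun=> far_bound R n d) (fun z : 'rV[R]_d.+1 => enorm z ^+ 2)).
      exact: ct_cst.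
    exact: cn.
  have As : [set z : 'rV[R]_d.+1 | far_bound R n d * enorm z ^+ 2 < 1] s.
    by rewrite /= s0 enorm0 expr0n mulr0 ltr01.
  apply: (@ct_near_eq _ _ (fun=> amp R n k) _ _ _ oA As); last exact: ct_cst.
  move=> z /= Az; rewrite /polar_field; case: eqVneq => // z0.
  have z1 : 0 < enorm z ^+ 2 by rewrite exprn_gt0// enorm_gt0.
  by rewrite field_far// enorm_inversion// -[leRHS]mul1r ler_pdivlMr// ltW.
have oA : open [set z : 'rV[R]_d.+1 | 0 < enorm z].
  by apply: ct_lt_open; [move=> ?; exact: ct_cst|exact: enorm_continuous].
apply: (@ct_near_eq _ _ (fun z => field n k (inversion z)) _ _ _ oA); first exact: enorm_gt0.
  move=> z /= z0; rewrite /polar_field ifF//; apply/eqP => e.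
  by rewrite e enorm0 ltxx in z0.
apply: (@ct_comp _ _ _ inversion (field n k)); last exact: field_continuous.
apply: (@ctZ _ _ _ (fun s => (enorm s ^+ 2)^-1) id); last exact: ct_id.
by apply: ctV; [rewrite lt0r_neq0// exprn_gt0// enorm_gt0|exact: cn].
Qed.

Lemma vradius_flip k y : 0 < pole_dist (flip y) ->
  vradius n k y = 2 + polar_field k (stereo (flip y)).
Proof.
move=> py; rewrite /polar_field; have es := enorm_stereo py.
have [p0|p0] := ltP 0 (pole_dist y); last first.
  rewrite ifT ?vradius_pole//; apply: contraT => /enorm_gt0 s0.
  have := exprn_gt0 2 s0; rewrite es enorm_flip row_cons0 opprK ltNge.
  by rewrite ler_pdivrMr// mul0r p0.
have s0 : stereo (flip y) != 0.
  apply: contraTneq p0 => s0; move: es; rewrite s0 enorm0 expr0n /= => /esym/eqP.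
  rewrite mulf_eq0 invr_eq0 (negPf (lt0r_neq0 py)) orbF enorm_flip row_cons0 opprK.
  by rewrite -leNgt /pole_dist => /eqP ->.
rewrite (negPf s0) vradius_stereo//; congr (_ + field n k _).
rewrite /inversion es /stereo row_consK scalerA enorm_flip row_cons0 opprK.
congr (_ *: _); rewrite pole_dist_flip in py *.
by move: p0; rewrite /pole_dist => p0; field; rewrite !lt0r_neq0.
Qed.

Let b k := (k < j)%N.

(** On the ray opposite to the pole surface 0 is at the centre of its pit with its wall down, at
    height [- amp 0], below the range of surface [j]. No point there is inside the former and
    outside the latter. *)
Lemma prefix_cell_pole_dist y : cell n b y -> 0 < pole_dist (flip y).
Proof.
move=> hy; rewrite ltNge; apply/negP => py.
have n0 : (0 < n)%N by exact: leq_ltn_trans jn.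
have := hy 0%N n0; have := hy j jn; rewrite /b ltnn j0 => h1 h2.
have y0 : 0 < enorm y by have := vradius_ge1 n j y; lra.
have eh : enorm y = y 0 0.
  by move: py (enorm_coord y 0); rewrite pole_dist_flip ler_norml; lra.
have tl : row_tail y = 0.
  apply: contraTeq isT => /enorm_gt0/(exprn_gt0 2).
  by have := enorm_tail y; rewrite eh; lra.
have py' : 0 < pole_dist y by rewrite /pole_dist -eh addr_gt0.
have s0 : stereo y = 0 by rewrite /stereo tl scaler0.
have w0 : wave n 0 (2 ^+ n) = -1 :> R.
  rewrite wave0 (@width_total R n 0 n0) subrr normr0.
  by apply: clampN1; have := width_ge1 R n 0; lra.
have f0 : field n 0 (0 : 'rV[R]_d.+1) = - amp R n 0.
  rewrite /field (_ : row_tail 0 = 0); last by apply/rowP => i; rewrite !mxE.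
  by rewrite normr0 mxE add0r height_waveN1// wall0// mulrN1.
move: h1 h2; rewrite !vradius_stereo// s0 f0.
have := height_ge n j (0 + 2 ^+ n) `|row_tail (0 : 'rV[R]_d.+1)|.
have := amp_lt R n j0; rewrite /field mxE; lra.
Qed.

Definition polar_cell : set 'rV[R]_d.+2 := [set w : 'rV[R]_d.+2 | forall k, (k < n)%N ->
  if b k then w 0 0 < 2 + polar_field k (row_tail w)
  else 2 + polar_field k (row_tail w) < w 0 0].

Lemma cell_polar : homeomorphic (@cell R n d b) polar_cell.
Proof.
have w0 w : polar_cell w -> 0 < w 0 0.
  move=> /(_ j jn); rewrite /b ltnn.
  by have := polar_field_norm j (row_tail w); rewrite ler_norml; lra.
apply: (@homeo_homeomorphic _ _ _ _
  (fun y => row_cons (enorm y) (stereo (flip y)))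
  (fun w : 'rV[R]_d.+2 => flip (stereo_inv (w 0 0) (row_tail w)))).
apply: homeo_pointwise.
- move=> y hy l ln; have := hy _ ln.
  by rewrite vradius_flip ?(prefix_cell_pole_dist hy)// row_cons0 row_consK.
- move=> w hw l ln; have := hw _ ln; have w0' := w0 _ hw.
  rewrite vradius_flip flipK ?pole_dist_stereo_inv_gt0//.
  by rewrite stereo_invK// enorm_flip enorm_stereo_inv// ltW.
- move=> y /prefix_cell_pole_dist py; rewrite row_cons0 row_consK.
  by rewrite -{1}(enorm_flip y) stereoK// flipK.
- move=> w /w0 w0'; rewrite flipK enorm_flip enorm_stereo_inv ?ltW// stereo_invK//.
  exact: row_eta.
- move=> y /prefix_cell_pole_dist py; apply: ct_row_cons.
    exact: enorm_continuous.
  apply: (@ct_comp _ _ _ flip (@stereo R d.+1)); last exact: ct_stereo.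
  exact/ct_flip/ct_id.
- move=> w _; apply: ct_flip; apply: ct_stereo_inv; first exact: coord_continuous.
  exact/ct_row_tail/ct_id.
Qed.

(** The defaults here and in [floor] bound all fields; surface 0 is always an inner one and surface
    [j] an outer one, so both extrema are attained by surfaces. *)
Definition ceiling s : R := \big[Num.min/1]_(k < n | b k) polar_field k s.
Definition floor s : R := \big[Num.max/-1]_(k < n | ~~ b k) polar_field k s.

Lemma ceiling_continuous : continuous ceiling.
Proof. by move=> s; apply: ct_bigmin => k; exact: polar_field_continuous. Qed.

Lemma floor_continuous : continuous floor.
Proof. by move=> s; apply: ct_bigmax => k; exact: polar_field_continuous. Qed.

Let n0 : (0 < n)%N. Proof. exact: leq_ltn_trans jn. Qed.

Lemma ceilingP t s : t < ceiling s <-> forall k, (k < n)%N -> b k -> t < polar_field k s.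
Proof.
split=> [/bigmin_gtP[_ h] k kn bk|h]; first exact: (h (Ordinal kn)).
apply/bigmin_gtP; split; last by move=> k; exact: h.
apply: lt_le_trans (h 0%N n0 j0) _.
exact: le_trans (ler_norm _) (polar_field_norm _ _).
Qed.

Lemma floorP t s : floor s < t <-> forall k, (k < n)%N -> ~~ b k -> polar_field k s < t.
Proof.
split=> [/bigmax_ltP[_ h] k kn bk|h]; first exact: (h (Ordinal kn)).
apply/bigmax_ltP; split; last by move=> k; exact: h.
apply: le_lt_trans (h j jn _); last by rewrite /b ltnn.
by have := polar_field_norm j s; rewrite ler_norml => /andP[].
Qed.

Lemma polar_cellE w : polar_cell w <->
  floor (row_tail w) < w 0 0 - 2 /\ w 0 0 - 2 < ceiling (row_tail w).
Proof.
rewrite ceilingP floorP; split=> [h|[h1 h2] k kn].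
  by split=> k kn bk; have := h k kn; rewrite ?bk ?(negPf bk); lra.
by have := h1 k kn; have := h2 k kn; case: (b k) => [/(_ isT) + _|_ /(_ isT)]; lra.
Qed.

Definition gap_width s : R := (ceiling s - floor s) / 2.
Definition middle s : R := (ceiling s + floor s) / 2.

Lemma gap_widthP s : 0 < gap_width s <->
  forall k i, (k < j)%N -> (j <= i < n)%N -> polar_field i s < polar_field k s.
Proof.
rewrite /gap_width (_ : (0 < _ / 2) = (floor s < ceiling s)); last first.
  by rewrite pmulr_lgt0// subr_gt0.
rewrite ceilingP; split=> [h k i kj /andP[ji ni]|h k kn kj].
  have := h k (ltn_trans kj jn) kj; move/floorP; apply => //.
  by rewrite /b -leqNgt.
apply/floorP => i ni; rewrite /b -leqNgt => ji; apply: h => //.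
by rewrite ji.
Qed.

(** Shrinking the coordinate of the opposite projection by [t] dilates the original one by the
    inverse of [t], so this is [prefix_outward]; at 0 the order of the amplitudes decides. *)
Lemma gap_width_star t s : 0 <= t <= 1 -> 0 < gap_width s -> 0 < gap_width (t *: s).
Proof.
move=> /andP[t0 t1] /gap_widthP h; apply/gap_widthP => k i kj ji.
have [e|ts0] := eqVneq (t *: s) 0.
  rewrite /polar_field e eqxx; apply: amp_lt.
  by case/andP: ji => ji _; exact: leq_trans kj ji.
have s0 : s != 0 by apply: contraNneq ts0 => ->; rewrite scaler0.
have tn0 : t != 0 by apply: contraNneq ts0 => ->; rewrite scale0r.
have tp : 0 < t by rewrite lt_neqAle eq_sym tn0.
have e : inversion (t *: s) = t^-1 *: inversion s.
  rewrite /inversion enormZ// !scalerA; congr (_ *: _).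
  by have := enorm_gt0 s0 => es; field; rewrite !lt0r_neq0.
rewrite /polar_field (negPf ts0) e.
set q := inversion s in e *.
have hq k' i' : (k' < j)%N -> (j <= i' < n)%N -> field n i' q < field n k' q.
  by move=> kj' ji'; have := h k' i' kj' ji'; rewrite /polar_field (negPf s0).
have t1' : 1 <= t^-1 by rewrite invf_ge1.
have := prefix_outward j0 (ltnW jn) (normr_ge0 (row_tail q)) t1' hq kj ji.
rewrite /field (_ : row_tail (t^-1 *: q) = t^-1 *: row_tail q); last first.
  by apply/rowP => l; rewrite !mxE.
rewrite normrZ ger0_norm ?invr_ge0//.
by rewrite (_ : 2 ^+ n + t^-1 * _ = (t^-1 *: q) 0 0 + 2 ^+ n); [|rewrite [in RHS]mxE; ring].
Qed.

Lemma gap_width0 : 0 < gap_width 0.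
Proof.
apply/gap_widthP => k i kj /andP[ji _]; rewrite /polar_field eqxx.
exact: amp_lt (leq_trans kj ji).
Qed.

(** A shear along the radius centres every fibre at 0. The resulting set is straightened in the
    radius, then in the direction, where it is star-shaped about the pole. *)
Lemma prefix_cell_homeomorphic : homeomorphic (@cell R n d b) [set: 'rV[R]_d.+2].
Proof.
apply: homeomorphic_trans cell_polar _.
pose D : set 'rV[R]_d.+2 := [set w : 'rV[R]_d.+2 | `|w 0 0| < gap_width (row_tail w)].
pose D1 : set 'rV[R]_d.+2 := [set w : 'rV[R]_d.+2 | 0 < gap_width (row_tail w)].
have ctail (f : 'rV[R]_d.+1 -> R) (w : 'rV[R]_d.+2) : continuous f ->
    {for w, continuous (fun w : 'rV[R]_d.+2 => f (row_tail w))}.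
  move=> cf; apply: (@ct_comp _ _ _ (@row_tail R d.+1) f); last exact: cf.
  exact/ct_row_tail/ct_id.
have cmid : continuous middle.
  move=> s; apply: (@ctM _ _ (fun s => ceiling s + floor s)); last exact: ct_cst.
  by apply: ctDr; [exact: ceiling_continuous|exact: floor_continuous].
have cgap : continuous gap_width.
  move=> s; apply: (@ctM _ _ (fun s => ceiling s - floor s)); last exact: ct_cst.
  by apply: ctBr; [exact: ceiling_continuous|exact: floor_continuous].
have shear : homeomorphic polar_cell D.
  apply: (@homeo_homeomorphic _ _ _ _
    (fun w : 'rV[R]_d.+2 => row_cons (w 0 0 - (2 + middle (row_tail w))) (row_tail w))
    (fun w : 'rV[R]_d.+2 => row_cons (w 0 0 + (2 + middle (row_tail w))) (row_tail w))).
  apply: homeo_pointwise.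
  - move=> w /polar_cellE; rewrite /D /= row_cons0 row_consK /middle /gap_width.
    by rewrite ltr_norml; lra.
  - move=> w; rewrite /D /= ltr_norml => h; apply/polar_cellE.
    by rewrite row_cons0 row_consK; move: h; rewrite /middle /gap_width; lra.
  - by move=> w _; rewrite row_cons0 row_consK subrK row_eta.
  - by move=> w _; rewrite row_cons0 row_consK addrK row_eta.
  - move=> w _; apply: ct_row_cons; last exact/ct_row_tail/ct_id.
    apply: (@ctBr _ _ (fun w : 'rV[R]_d.+2 => w 0 0)); first exact: coord_continuous.
    by apply: (@ctDr _ _ (fun=> 2)); [exact: ct_cst|exact: ctail].
  - move=> w _; apply: ct_row_cons; last exact/ct_row_tail/ct_id.
    apply: (@ctDr _ _ (fun w : 'rV[R]_d.+2 => w 0 0)); first exact: coord_continuous.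
    by apply: (@ctDr _ _ (fun=> 2)); [exact: ct_cst|exact: ctail].
have oD : open D.
  apply: ct_lt_open => w; last exact: ctail.
  by apply: (@ct_norm R _ R^o); exact: coord_continuous.
have oD1 : open D1.
  by apply: ct_lt_open => w; [exact: ct_cst|exact: ctail].
pose Ir : pred 'I_d.+2 := fun l : 'I_d.+2 => (l : nat) == 0%N.
pose Is : pred 'I_d.+2 := fun l : 'I_d.+2 => (0 < (l : nat))%N.
have sr t w : scale_coords 0 Ir t w 0 0 = t * w 0 0 /\
    row_tail (scale_coords 0 Ir t w) = row_tail w.
  split; first by rewrite !mxE /=; ring.
  by apply/rowP => i; rewrite !mxE.
have ss t w : row_tail (scale_coords 0 Is t w) = t *: row_tail w.
  by apply/rowP => i; rewrite !mxE /=; ring.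
have h1 : homeomorphic D D1.
  rewrite (_ : D1 = [set w | D (scale_coords 0 Ir 0 w)]); last first.
    apply/seteqP; split => w; rewrite /D /D1 /=; have [-> ->] := sr 0 w;
      by rewrite mul0r normr0.
  apply: fiber_homeomorphic => // w t; rewrite /D /=; have [-> ->] := sr t w.
  move=> hw /andP[t0 t1]; apply: le_lt_trans hw.
  by rewrite normrM ger0_norm// ler_piMl.
have h2 : homeomorphic D1 [set: 'rV[R]_d.+2].
  rewrite (_ : setT = [set w | D1 (scale_coords 0 Is 0 w)]); last first.
    by apply/seteqP; split => w // _; rewrite /D1 /= ss scale0r; exact: gap_width0.
  apply: fiber_homeomorphic => // w t; rewrite /D1 /= ss => hw t01.
  exact: gap_width_star.
exact: homeomorphic_trans shear (homeomorphic_trans h1 h2).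
Qed.

End PrefixCells.
(** * Intersections *)

Section FiniteUnions.
Variables (R : realType) (d : nat).

Lemma finite_union_set0 m : finite_union_of_surfaces m (set0 : set 'rV[R]_d).
Proof.
exists 0%N, (fun=> set0); split; first by case.
by apply/seteqP; split => // x [[]].
Qed.

Lemma finite_union_seq (I : eqType) (s : seq I) (C : I -> set 'rV[R]_d) m :
  (forall i, i \in s -> surface m (C i)) ->
  finite_union_of_surfaces m (\bigcup_(i in [set` s]) C i).
Proof.
move=> h; exists (size s), (fun j => C (tnth (in_tuple s) j)); split.
  by move=> j; apply: h; rewrite (tnth_nth (tnth (in_tuple s) j)) mem_nth.
apply/seteqP; split => [x [i /= is_ Cx]|x [j _ Cx]].
  have ii : (index i s < size s)%N by rewrite index_mem.
  by exists (Ordinal ii) => //; rewrite (tnth_nth i) /= nth_index.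
by exists (tnth (in_tuple s) j) => //=; exact: mem_tnth.
Qed.

(** The range of [f] serves as the ambient space of the surface, with [g] as its chart. *)
Lemma surface_embedding m (f : 'rV[R]_m.+1 -> 'rV[R]_d) g (E : set 'rV[R]_m.+1) :
  continuous f -> (forall x, g (f x) = x) -> {within range f, continuous g} ->
  homeomorphic E (@unit_sphere R m.+1) -> surface m.+1 (f @` E).
Proof.
move=> cf gf cg hE.
have h : homeo [set: 'rV[R]_m.+1] (range f) f g.
  split => //.
  - by move=> _ [x _ <-]; rewrite gf.
  - exact: continuous_subspaceT.
exists (range f); split.
- by exists g; right; exact: homeo_on (homeo_sym h).
- by move=> _ [x _ <-]; exists x.
apply: homeomorphic_trans hE; apply: homeomorphic_sym.
apply: (homeo_homeomorphic (f := f) (g := g)); apply: homeo_sub h _ _ _ _ => //.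
- by move=> _ [x _ <-]; exists x.
- by move=> _ [x Ex <-]; rewrite gf.
Qed.

End FiniteUnions.

(** * Common points of two, three and four surfaces *)

Section Intersections.
Variables (R : realType) (n d : nat).
Implicit Types (i j k P : nat) (q v : 'rV[R]_d.+1) (y : 'rV[R]_d.+2) (X s t : R).
Local Notation width := (width R n).
Local Notation wave := (@wave R n).
Local Notation pit := (@pit R n).
Local Notation pit_center := (pit_center R n).
Local Notation wall := (@wall R n).
Local Notation amp := (amp R n).
Local Notation field := (@field R n d).

Definition sphere k : set 'rV[R]_d.+2 := [set y | vgauge n k y = 1].

Definition lift_graph k q : 'rV[R]_d.+2 := stereo_inv (2 + field k q) q.

Lemma field_gt2 k q : 0 < 2 + field k q.
Proof. by have := field_norm n k q; rewrite ler_norml; lra. Qed.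

Lemma lift_graph_continuous k : continuous (lift_graph k).
Proof.
move=> q; apply: (@ct_stereo_inv R d.+1 _ (fun q => 2 + field k q) (fun q => q));
  last exact: ct_id.
by apply: (@ctDr R _ (fun=> 2)); [exact: ct_cst|exact: field_continuous].
Qed.

Lemma stereo_lift_graph k q : stereo (lift_graph k q) = q.
Proof. by rewrite stereo_invK// field_gt2. Qed.

Lemma stereo_graph_continuous (A : set 'rV[R]_d.+2) k :
  A `<=` range (lift_graph k) -> {within A, continuous (@stereo R d.+1)}.
Proof.
move=> hA; apply: continuous_in_subspaceT => y; rewrite inE => /hA[q _ <-].
by apply: ct_stereo; apply: pole_dist_stereo_inv_gt0; exact: field_gt2.
Qed.

Lemma sphere_lift_graph i k q : sphere i (lift_graph k q) <-> field i q = field k q.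
Proof.
rewrite /sphere /= vgauge_eq1 enorm_stereo_inv; last exact/ltW/field_gt2.
rewrite vradius_stereo ?pole_dist_stereo_inv_gt0 ?field_gt2// stereo_invK ?field_gt2//.
by split=> [/addrI/esym|->].
Qed.

Lemma sphere_pair i j y : (i < j)%N -> sphere i y -> sphere j y ->
  exists2 q, field i q = field j q & y = lift_graph i q.
Proof.
move=> ij /vgauge_eq1 hi /vgauge_eq1 hj.
have py : 0 < pole_dist y.
  rewrite ltNge; apply/negP => py; move: hj; rewrite hi !vradius_pole//.
  by have := amp_lt R n ij; lra.
exists (stereo y); last by rewrite /lift_graph -vradius_stereo// -hi stereoK.
by move: hj; rewrite hi !vradius_stereo// => /addrI.
Qed.

(** The [i]-th field with all pits but [P] filled in. It agrees with a later field along a single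
    closed surface, whereas [field i] yields one for each pit. *)
Definition pit_field i P q : R :=
  amp i * Num.max (pit i P (q 0 0 + 2 ^+ n)) (wall i `|row_tail q|).

Lemma pit_field_continuous i P : continuous (pit_field i P).
Proof.
move=> q; apply: (@ctM _ _ (fun=> amp i) (fun q : 'rV[R]_d.+1 =>
  Num.max (pit i P (q 0 0 + 2 ^+ n)) (wall i `|row_tail q|))); first exact: ct_cst.
apply: ct_max.
  apply: (@ct_comp _ _ _ (fun q : 'rV[R]_d.+1 => q 0 0 + 2 ^+ n : R)).
    by apply: ctDr; [exact: coord_continuous|exact: ct_cst].
  exact: pit_continuous.
apply: (@ct_comp _ _ _ (fun q : 'rV[R]_d.+1 => `|row_tail q| : R)).
  apply: (@ct_norm R _ 'rV[R]_d); apply: ct_row_tail; exact: ct_id.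
exact: wall_continuous.
Qed.

Lemma wave_in_pit i P X : (P < 2 ^ i.-1)%N -> pit i P X < 1 -> wave i X = pit i P X.
Proof.
move=> Pi /clamp_lt1 hX; apply: wave_eq_pit => // Q Qi QP; apply: far_pit.
have w1 := width_ge1 R n i.
have far : 4 * width i <= `|pit_center i P - pit_center i Q|.
  rewrite /pit_center -mulrBl normrM (ger0_norm (le_trans ler01 w1)).
  rewrite ler_wpM2r ?(le_trans ler01)//.
  have [h|h] : (4 * Q + 2 + 4 <= 4 * P + 2)%N \/ (4 * P + 2 + 4 <= 4 * Q + 2)%N.
  - by move/eqP: QP; clear; lia.
  - by apply: le_trans (ler_norm _); move: h; rewrite -(ler_nat R) (natrD _ (4 * Q + 2)); lra.
  - rewrite distrC; apply: le_trans (ler_norm _); move: h.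
    by rewrite -(ler_nat R) (natrD _ (4 * P + 2)); lra.
have := ler_distD X (pit_center i P) (pit_center i Q).
rewrite (distrC (pit_center i P) X); lra.
Qed.

(** At a point of agreement surface [i] is below its maximum, hence in a pit, and distinct pits are
    too far apart to interfere. *)
Lemma field_eq_pit i j q : (i < j)%N -> field i q = field j q <->
  exists2 P, (P < 2 ^ i.-1)%N & pit_field i P q = field j q.
Proof.
move=> ij; have ai := amp_gt0 R n i; have aj := amp_lt R n ij.
have le := field_le n j q.
split=> [e|[P Pi e]].
  have [|P Pi eP] := @wave_pit R n i (q 0 0 + 2 ^+ n).
    rewrite ltNge; apply/negP => h.
    move: e; rewrite {1}/field height_wave1; last by apply/eqP; rewrite eq_le h wave_le1.
    by lra.
  by exists P => //; rewrite -e /field /height eP.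
rewrite -e /field /height (wave_in_pit Pi)// ltNge; apply/negP => h.
move: e le; rewrite /pit_field; set mx := Num.max _ _ => e le.
have : amp i * 1 <= amp i * mx by rewrite ler_pM2l// le_max h.
by lra.
Qed.

Definition pit_middle i P : 'rV[R]_d.+1 := row_cons (pit_center i P - 2 ^+ n) 0.

Lemma pit_middleE i P t v :
  (pit_middle i P + t *: v) 0 0 + 2 ^+ n - pit_center i P = t * v 0 0 /\
  row_tail (pit_middle i P + t *: v) = t *: row_tail v.
Proof.
split; first by rewrite !mxE unlift_none; ring.
by apply/rowP => l; rewrite !mxE liftK mxE add0r.
Qed.

Lemma pit_field_ray i P t v : 0 <= t -> pit_field i P (pit_middle i P + t *: v) =
  amp i * Num.max (clamp (4 * (t * `|v 0 0| - width i))) (wall i (t * `|row_tail v|)).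
Proof.
move=> t0; have [e1 e2] := pit_middleE i P t v.
by rewrite /pit_field /pit e1 e2 normrM normrZ (ger0_norm t0).
Qed.

Lemma pit_field_bounded i P j q : (i < j)%N -> pit_field i P q = field j q ->
  `|q 0 0 + 2 ^+ n - pit_center i P| < width i + 4^-1 /\ `|row_tail q| < n.+1%:R.
Proof.
move=> ij e; have ai := amp_gt0 R n i; have aj := amp_lt R n ij.
have le := field_le n j q.
have mx1 : Num.max (pit i P (q 0 0 + 2 ^+ n)) (wall i `|row_tail q|) < 1.
  rewrite ltNge; apply/negP => h; move: e le; rewrite /pit_field.
  set mx := Num.max _ _ in h * => e le.
  have : amp i * 1 <= amp i * mx by rewrite ler_pM2l.
  by lra.
move: mx1; rewrite gt_max => /andP[/clamp_lt1 h1 /wall_lt1 h2]; split => //.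
by lra.
Qed.

(** The edges of a pit of level [i] are even multiples of [width j], around which [wave j] is
    constant; the sign of the product keeps [Y] at the same edge as [X]. *)
Lemma pit_window i P j X : (i < j < n)%N -> `| `|X - pit_center i P| - width i| <= 4^-1 ->
  (forall Y, 0 <= (Y - pit_center i P) * (X - pit_center i P) ->
     `| `|Y - pit_center i P| - width i| <= 4^-1 -> wave j Y = wave j X) /\
  (wave j X = 1 \/ wave j X = -1).
Proof.
move=> ijn; have wE := width_lt R ijn; have w1 := width_ge1 R n i.
have win (e : nat) (Z : R) : (e = 1 \/ e = 3)%N ->
    `|Z - (4 * P + e)%N%:R * width i| <= 4^-1 ->
    wave j Z = wave j ((4 * P + e)%N%:R * width i) /\ (wave j Z = 1 \/ wave j Z = -1).
  move=> _; rewrite wE mulrA -natrM mulnCA; exact: wave_window.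
have c3 : (4 * P + 3)%N%:R * width i = pit_center i P + width i.
  by rewrite /pit_center !natrD; ring.
have c1 : (4 * P + 1)%N%:R * width i = pit_center i P - width i.
  by rewrite /pit_center !natrD; ring.
have w3 Z := win 3 Z (or_intror erefl); have w1' Z := win 1 Z (or_introl erefl).
rewrite c3 in w3; rewrite c1 in w1'.
set C := pit_center i P in w3 w1' *; move=> hX.
have [X0|X0] := leP 0 (X - C).
  rewrite (ger0_norm X0) in hX.
  have [|eX oX] := w3 X; first by rewrite opprD addrA.
  split=> // Y YX; have [Y0|Y0] := leP 0 (Y - C).
    by rewrite (ger0_norm Y0) => hY; rewrite eX; apply: (w3 Y _).1; rewrite opprD addrA.
  have Xp : 0 < X - C by move: hX; rewrite ler_norml; lra.
  by have := nmulr_rlt0 (X - C) Y0; rewrite Xp ltNge YX.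
have hX' := hX; rewrite (ltr0_norm X0) in hX.
have [|eX oX] := w1' X.
  by move: hX; rewrite !ler_norml; lra.
split=> // Y YX; have [Y0|Y0] := leP (Y - C) 0.
  rewrite (ler0_norm Y0) => hY; rewrite eX; apply: (w1' Y _).1.
  by move: hY; rewrite !ler_norml; lra.
by have := pmulr_rlt0 (X - C) Y0; rewrite X0 ltNge YX.
Qed.

(** From the first meeting on, [pit_field] gains on [field j]. If its wall gives its value there,
    [field j] is already at its maximum and stays so. If the edge of the pit does, [wave j] is
    constant along that edge, and [field j] can grow only through [wall j], which is slower. *)
Lemma pit_ray_uniq i j P v s t : (i < j < n)%N -> v != 0 -> 0 < s -> s < t ->
  pit_field i P (pit_middle i P + s *: v) = field j (pit_middle i P + s *: v) ->
  pit_field i P (pit_middle i P + t *: v) = field j (pit_middle i P + t *: v) -> False.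
Proof.
move=> ijn v0 s0 st; set qs := _ + s *: v; set qt := _ + t *: v => es et.
have [ij jn] := andP ijn.
have ai := amp_gt0 R n i; have aj := amp_lt R n ij; have aj0 := amp_gt0 R n j.
have t0 : 0 < t by exact: lt_trans st.
have [bt _] := pit_field_bounded ij et.
have [es1 es2] := pit_middleE i P s v; have [et1 et2] := pit_middleE i P t v.
rewrite -/qs in es1 es2; rewrite -/qt in et1 et2.
have leT := field_le n j qt.
have rE : `|row_tail qs| = s * `|row_tail v| by rewrite es2 normrZ ger0_norm// ltW.
have rE' : `|row_tail qt| = t * `|row_tail v| by rewrite et2 normrZ ger0_norm// ltW.
set X := qs 0 0 + 2 ^+ n in es1; set Y := qt 0 0 + 2 ^+ n in et1.
set z := `|row_tail v| in rE rE'; have z0 : 0 <= z by exact: normr_ge0.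
have w1 := width_ge1 R n i.
have pX : pit i P X = clamp (4 * (s * `|v 0 0| - width i)).
  by rewrite /pit es1 normrM gtr0_norm.
have pY : pit i P Y = clamp (4 * (t * `|v 0 0| - width i)).
  by rewrite /pit et1 normrM gtr0_norm.
have geS : - amp j <= field j qs by exact: height_ge.
have leS := field_le n j qs.
have sz : s * z <= t * z by rewrite ler_wpM2r// ltW.
have [hw|hw] := leP (pit i P X) (wall i (s * z)).
  have FE : pit_field i P qs = amp i * wall i (s * z).
    by rewrite /pit_field -/X rE max_r.
  have wl : -1 < wall i (s * z).
    rewrite ltNge; apply/negP => /(ler_wpM2l (ltW ai)); rewrite -FE es; lra.
  have fs : field j qs = amp j.
    by rewrite /field height_wall1// rE; exact: wall_next wl.
  have ft : field j qt = amp j.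
    rewrite /field height_wall1// rE'; apply: (wall_next ijn).
    exact: lt_le_trans wl (wall_mono n i sz).
  have h1 : amp i * wall i (s * z) = amp j by rewrite -FE es.
  have h2 : amp i * wall i (t * z) <= amp j.
    by rewrite -ft -et /pit_field rE' ler_pM2l// le_max lexx orbT.
  have h3 : wall i (t * z) <= wall i (s * z) by rewrite -(ler_pM2l ai) h1.
  have h4 : wall i (s * z) < 1 by rewrite -(ltr_pM2l ai) h1 mulr1.
  have zp : 0 < z.
    rewrite lt_neqAle z0 andbT; apply/eqP => z00.
    have := wl; rewrite -z00 mulr0 wall0 ?ltxx//; exact: ltn_trans jn.
  have : s * z < t * z by rewrite ltr_pM2r.
  move: wl h3 h4; rewrite /wall; clear.
  by case: clampP => ?; case: clampP => ?; lra.
have FE : pit_field i P qs = amp i * pit i P X.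
  by rewrite /pit_field -/X rE max_l// ltW.
have p1 : -1 < pit i P X by apply: le_lt_trans hw; exact: clamp_ge.
have p2 : pit i P X < 1 by rewrite -(ltr_pM2l ai) -FE es mulr1; lra.
have p3 : amp i * pit i P Y <= field j qt.
  by rewrite -et /pit_field ler_pM2l// le_max lexx.
have p4 : pit i P Y < 1 by rewrite -(ltr_pM2l ai) mulr1; lra.
have sv : 4 * (s * `|v 0 0| - width i) = pit i P X /\
    -1 < 4 * (s * `|v 0 0| - width i) < 1.
  by move: p1 p2; rewrite pX; clear; case: clampP => ?; lra.
have stv : s * `|v 0 0| < t * `|v 0 0|.
  rewrite ltr_pM2r//; rewrite -(pmulr_rgt0 _ s0); lra.
have tv : pit i P Y = 4 * (t * `|v 0 0| - width i) /\ 4 * (t * `|v 0 0| - width i) < 1.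
  by move: p4 sv.2 stv; rewrite pY; clear; case: clampP => ?; lra.
have aX : `|X - pit_center i P| = s * `|v 0 0| by rewrite es1 normrM gtr0_norm.
have aY : `|Y - pit_center i P| = t * `|v 0 0| by rewrite et1 normrM gtr0_norm.
have wX : `| `|X - pit_center i P| - width i| <= 4^-1.
  by rewrite aX ler_norml; have := sv.2; lra.
have wY : `| `|Y - pit_center i P| - width i| <= 4^-1.
  by rewrite aY ler_norml; have := sv.2; have := tv.2; lra.
have [same cases] := pit_window ijn wX.
have YX : 0 <= (Y - pit_center i P) * (X - pit_center i P).
  rewrite es1 et1 mulrACA -expr2; apply: mulr_ge0; last exact: sqr_ge0.
  by apply: mulr_ge0; exact: ltW.
have {YX}same := same Y YX wY.
have step : amp i * pit i P X < amp i * pit i P Y.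
  by rewrite ltr_pM2l// -sv.1 tv.1; lra.
case: cases => cases.
  have fs : field j qs = amp j by rewrite /field height_wave1.
  by move: step; rewrite -FE es fs; lra.
have fs : field j qs = amp j * wall j (s * z).
  by rewrite /field height_waveN1// rE.
have ft : field j qt = amp j * wall j (t * z).
  by rewrite /field height_waveN1 ?rE'// -cases.
have [wl|wl] := ltP (wall j (s * z)) 1; last first.
  have := ler_wpM2l (ltW aj0) wl; rewrite mulr1 -fs -es FE; lra.
have sn := wall_lt1 wl.
have lip : wall j (t * z) <= wall j (s * z) + 4 * (t * z - s * z).
  by rewrite /wall; move: sz; clear; case: clampP => ?; case: clampP => ?; lra.
have lip' := ler_wpM2l (ltW aj0) lip.
(* The amplitude ratio again: at this edge [s] times the first coordinate of [v] exceeds 1/2 in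
   absolute value, while [s * z] is below [n.+1%:R] because [wall j] is below 1. *)
have di := amp_decay R n ij.
have h1 : amp j * (s * z) <= amp j * n.+1%:R by rewrite ler_pM2l// ltW.
have h2 : amp i * (1 / 2) < amp i * (s * `|v 0 0|).
  by rewrite ltr_pM2l//; have := sv.2; lra.
have h3 : amp j * z < amp i * `|v 0 0|.
  by rewrite -(ltr_pM2l s0) mulrCA [ltRHS]mulrCA; lra.
have h4 : (t - s) * (amp j * z) < (t - s) * (amp i * `|v 0 0|).
  by rewrite ltr_pM2l// subr_gt0.
have := p3; rewrite ft tv.1; have := FE; rewrite es fs -sv.1; lra.
Qed.

(** At the middle of the pit [pit_field] is [- amp i], below the range of [field j]; far out on the
    ray it is [amp i], above that range. *)
Lemma pit_ray_exists i j P v : (i < j < n)%N -> v != 0 ->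
  exists2 t, 0 < t &
    pit_field i P (pit_middle i P + t *: v) = field j (pit_middle i P + t *: v).
Proof.
move=> /andP[ij jn] v0; have n_i : (i < n)%N by exact: ltn_trans jn.
have ai := amp_gt0 R n i; have aj := amp_lt R n ij.
pose h t := pit_field i P (pit_middle i P + t *: v) - field j (pit_middle i P + t *: v).
have ch : continuous h.
  move=> t; have cl : {for t, continuous (fun t : R => pit_middle i P + t *: v)}.
    apply: (@ctD R _ 'rV[R]_d.+1 (fun=> pit_middle i P)); first exact: ct_cst.
    by apply: (@ctZ R _ 'rV[R]_d.+1 id (fun=> v)); [exact: ct_id|exact: ct_cst].
  apply: (@ctBr _ _ (fun t => pit_field i P (pit_middle i P + t *: v))).
    by apply: (ct_comp (g := pit_field i P) cl); exact: pit_field_continuous.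
  by apply: (ct_comp (g := field j) cl); exact: field_continuous.
have h0 : h 0 < 0.
  rewrite /h pit_field_ray// !mul0r wall0// clampN1; last first.
    by have := width_ge1 R n i; lra.
  rewrite maxxx mulrN1.
  have := height_ge n j ((pit_middle i P + 0 *: v) 0 0 + 2 ^+ n)
    `|row_tail (pit_middle i P + 0 *: v)|.
  by rewrite -/(field j _); lra.
have top t : 0 <= t ->
    Num.max (clamp (4 * (t * `|v 0 0| - width i))) (wall i (t * `|row_tail v|)) = 1 ->
    0 < h t.
  by move=> t0 e; rewrite /h pit_field_ray// e mulr1;
     have := field_le n j (pit_middle i P + t *: v); lra.
have [t t0 ht] : exists2 t, 0 <= t & 0 < h t.
  have w1 := width_ge1 R n i.
  have [x0|x0] := eqVneq (v 0 0) 0; last first.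
    have nx : 0 < `|v 0 0| by rewrite normr_gt0.
    exists ((width i + 1) / `|v 0 0|); first by rewrite divr_ge0//; lra.
    apply: top; first by rewrite divr_ge0//; lra.
    rewrite divfK ?lt0r_neq0// clamp1; last by lra.
    by rewrite max_l// clamp_le.
  have nz : 0 < `|row_tail v|.
    rewrite normr_gt0; apply: contra_neq v0 => z0; rewrite -(row_eta v) x0 z0.
    by apply/rowP => l; rewrite !mxE; case: unlift => // a; rewrite mxE.
  exists (n.+1%:R / `|row_tail v|); first by rewrite divr_ge0.
  apply: top; first by rewrite divr_ge0.
  by rewrite divfK ?lt0r_neq0// wall_far// max_r// clamp_le.
have [c] := @IVT R h 0 t 0 t0 (continuous_subspaceT ch)
  ltac:(rewrite ge_min le_max (ltW h0) (ltW ht) orbT //).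
rewrite in_itv /= => /andP[c0 _] hc; exists c.
  rewrite lt_neqAle c0 andbT; apply/eqP => e.
  by rewrite -e in hc; rewrite hc ltxx in h0.
by apply/eqP; rewrite -subr_eq0 -/(h c) hc.
Qed.

Lemma compact_pit i j P : (i < j)%N -> compact [set q | pit_field i P q = field j q].
Proof.
move=> ij; apply: bounded_closed_compact; last first.
  by apply: ct_eq_closed; [exact: pit_field_continuous|exact: field_continuous].
set B := (width i + 4^-1 + `|pit_center i P - 2 ^+ n|) + n.+1%:R.
have w1 := width_ge1 R n i.
have B0 : 0 <= B by rewrite /B !addr_ge0//; lra.
exists B; split; first exact: num_real.
move=> M BM q /= /(pit_field_bounded ij) [h1 h2].
apply: le_trans (ltW BM); apply/normr_rowP => // l.
case: (unliftP 0 l) => [l' ->|->].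
  have := normr_row_le (row_tail q) l'; rewrite mxE /B => h3.
  by have := normr_ge0 (pit_center i P - 2 ^+ n); lra.
have := ler_normD (q 0 0 + 2 ^+ n - pit_center i P) (pit_center i P - 2 ^+ n).
rewrite addrA subrK addrK /B.
have : 0 <= n.+1%:R :> R by exact: ler0n.
lra.
Qed.

Lemma pit_sphere i j P : (i < j < n)%N ->
  homeomorphic [set q | pit_field i P q = field j q] (@unit_sphere R d.+1).
Proof.
move=> ijn; have [ij jn] := andP ijn; have n_i : (i < n)%N by exact: ltn_trans jn.
apply: (@radial_sphere _ _ _ (pit_middle i P)).
- exact: compact_pit.
- move=> /= e; have := pit_field_ray i P (0 : 'rV[R]_d.+1) (lexx (0 : R)).
  rewrite scaler0 addr0 e !mul0r wall0// clampN1; last first.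
    by have := width_ge1 R n i; lra.
  rewrite maxxx mulrN1 => e'.
  have := height_ge n j (pit_middle i P 0 0 + 2 ^+ n) `|row_tail (pit_middle i P)|.
  by rewrite -/(field j _) e'; have := amp_lt R n ij; lra.
- move=> v v0; exact: pit_ray_exists.
- by move=> v s t v0 s0 st /= es et; exact: (pit_ray_uniq ijn v0 s0 st es et).
Qed.

Lemma sphere_pair_surfaces i j : (i < j < n)%N ->
  finite_union_of_surfaces d.+1 (sphere i `&` sphere j).
Proof.
move=> ijn; have [ij jn] := andP ijn.
pose C P := lift_graph i @` [set q | pit_field i P q = field j q].
rewrite (_ : _ `&` _ = \bigcup_(P in [set` iota 0 (2 ^ i.-1)]) C P).
  apply: finite_union_seq => P _.
  apply: (@surface_embedding _ _ _ _ (@stereo R d.+1)).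
  - exact: lift_graph_continuous.
  - exact: stereo_lift_graph.
  - apply: stereo_graph_continuous; exact: subset_refl.
  - exact: pit_sphere.
apply/seteqP; split => [y [hi hj]|y [P /= hP [q /= e <-]]].
  have [q /(field_eq_pit q ij)[P Pi e] ->] := sphere_pair ij hi hj.
  by exists P; [rewrite /= mem_iota|exists q].
split; apply/sphere_lift_graph => //; apply/esym/(field_eq_pit q ij).
by exists P => //; move: hP; rewrite mem_iota.
Qed.

(* At a common point of three surfaces each of the first two is crossed at the
   level of the third one, which is flat there; this pins down the abscissa and
   the distance to the axis. *)
Lemma field_triple i j k q : (i < j)%N -> (j < k < n)%N ->
  field i q = field j q /\ field j q = field k q <->
  [/\ wave i (q 0 0 + 2 ^+ n) = amp k / amp i,
      wave j (q 0 0 + 2 ^+ n) = -1 &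
      `|row_tail q| = depth R n j + (amp k / amp j) / 4].
Proof.
move=> ij jkn; have [jk kn] := andP jkn.
have ijn : (i < j < n)%N by rewrite ij (ltn_trans jk kn).
have ikn : (i < k < n)%N by rewrite (ltn_trans ij jk).
have ai := amp_gt0 R n i; have aj := amp_gt0 R n j; have ak := amp_gt0 R n k.
have aij := amp_lt R n ij; have ajk := amp_lt R n jk.
have fk := field_le n k q.
have fk' : - amp k <= field k q by exact: height_ge.
set X := q 0 0 + 2 ^+ n; set r := `|row_tail q|.
have wallE : wall j r = amp k / amp j <-> r = depth R n j + (amp k / amp j) / 4.
  have k0 : 0 < amp k / amp j by rewrite divr_gt0.
  have k1 : amp k / amp j < 1 by rewrite ltr_pdivrMr// mul1r.
  by rewrite /wall; case: clampP => ?; split => ?; lra.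
split=> [[e1 e2]|[h1 h2 /wallE h3]].
  have wj : wave j X < 1.
    rewrite ltNge; apply/negP => h; move: e2; rewrite {1}/field height_wave1; first lra.
    by apply/eqP; rewrite eq_le h wave_le1.
  have wlj : wall j r < 1.
    rewrite ltNge; apply/negP => h; move: e2; rewrite {1}/field height_wall1; first lra.
    by apply/eqP; rewrite eq_le h clamp_le.
  have wli : wall i r <= -1.
    by rewrite leNgt; apply/negP => /(wall_next ijn) e; rewrite e ltxx in wlj.
  have wlX : wall i r <= wave i X by apply: le_trans wli _; exact: wave_geN1.
  have fi : field i q = amp i * wave i X by rewrite /field /height max_l.
  have wX : -1 < wave i X < 1.
    rewrite -(ltr_pM2l ai) -[X in _ && X](ltr_pM2l ai) -fi e1 e2; lra.
  have wjX : wave j X = -1.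
    have [P Pi eP] : exists2 P, (P < 2 ^ i.-1)%N & wave i X = pit i P X.
      by apply: wave_pit; case/andP: wX.
    have pw : `| `|X - pit_center i P| - width i| <= 4^-1.
      move: wX; rewrite eP /pit; case: clampP => [h|h h'|h]; rewrite ?ltxx ?andbF//.
      by move=> _; rewrite ler_norml; lra.
    by have [_ [e|//]] := pit_window ijn pw; rewrite e ltxx in wj.
  have fj : field j q = amp j * wall j r by rewrite /field height_waveN1.
  have wlj' : -1 < wall j r.
    by rewrite -(ltr_pM2l aj) -fj e2; lra.
  have fkE : field k q = amp k by rewrite /field height_wall1//; exact: wall_next jkn wlj'.
  split => //.
    by rewrite -fkE -e2 -e1 fi mulrC mulKf// lt0r_neq0.
  by apply/wallE; rewrite -fkE -e2 fj mulrC mulKf// lt0r_neq0.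
have wlj' : -1 < wall j r by rewrite h3; have := divr_gt0 ak aj; lra.
have wlj : wall j r < 1 by rewrite h3 ltr_pdivrMr// mul1r.
have fkE : field k q = amp k by rewrite /field height_wall1//; exact: wall_next jkn wlj'.
have fj : field j q = amp k.
  by rewrite /field height_waveN1// h3 mulrC divfK// lt0r_neq0.
rewrite fkE fj; split => //.
have wli : wall i r <= -1.
  by rewrite leNgt; apply/negP => /(wall_next ijn) e; rewrite e ltxx in wlj.
rewrite /field /height max_l.
  by rewrite h1 mulrC divfK// lt0r_neq0.
by apply: le_trans wli _; exact: wave_geN1.
Qed.

(** At a triple point the third surface is at full height, so the level determines its index; this
    rules out a fourth surface. *)
Lemma sphere_triple_level i j k y : (i < j)%N -> (j < k < n)%N ->
  sphere i y -> sphere j y -> sphere k y -> enorm y = 2 + amp k.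
Proof.
move=> ij jkn hi hj hk; have [jk kn] := andP jkn.
have [q e1 ey] := sphere_pair ij hi hj.
move: hk hi; rewrite ey => /sphere_lift_graph hk _.
have e2 : field j q = field k q by rewrite -e1.
have [_ _ er] := (field_triple q ij jkn).1 (conj e1 e2).
rewrite /lift_graph enorm_stereo_inv; last exact/ltW/field_gt2.
congr (_ + _); rewrite e1 e2 /field height_wall1//; apply: (wall_next jkn).
rewrite er /wall; have := divr_gt0 (amp_gt0 R n k) (amp_gt0 R n j).
by case: clampP => ?; lra.
Qed.

Lemma sphere_quadruple i j k l y : (i < j)%N -> (j < k)%N -> (k < l < n)%N ->
  sphere i y -> sphere j y -> sphere k y -> sphere l y -> False.
Proof.
move=> ij jk /andP[kl ln] hi hj hk hl.
have jkn : (j < k < n)%N by rewrite jk (ltn_trans kl ln).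
have jln : (j < l < n)%N by rewrite (ltn_trans jk kl).
have := sphere_triple_level ij jkn hi hj hk.
rewrite (sphere_triple_level ij jln hi hj hl).
by have := amp_lt R n kl; lra.
Qed.

End Intersections.

(** * Maxima and minima of gauges *)

Section GaugeLattice.
Variables (R : realType) (m : nat).
Implicit Types p q : 'rV[R]_m.+1 -> R.

Lemma gaugeM c p : 0 < c -> gauge p -> gauge (fun y => c * p y).
Proof.
move=> c0 [cp Zp [C C0 hC]]; split.
- by move=> y; apply: (@ctM _ _ (fun=> c)); [exact: ct_cst|exact: cp].
- by move=> a y a0; rewrite Zp// mulrCA.
- exists (C / c) => [|y]; first exact: divr_gt0.
  by rewrite mulrA divfK ?lt0r_neq0.
Qed.

Lemma gauge_max p q : gauge p -> gauge q -> gauge (fun y => Num.max (p y) (q y)).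
Proof.
move=> [cp Zp [C C0 hC]] [cq Zq _]; split.
- by move=> y; apply: ct_max; [exact: cp|exact: cq].
- by move=> a y a0; rewrite Zp// Zq// maxr_pMr.
- exists C => // y; apply: le_trans (hC y) _.
  by rewrite ler_pM2l// le_max lexx.
Qed.

Lemma gauge_min p q : gauge p -> gauge q -> gauge (fun y => Num.min (p y) (q y)).
Proof.
move=> [cp Zp [C C0 hC]] [cq Zq [D D0 hD]]; split.
- by move=> y; apply: ct_min; [exact: cp|exact: cq].
- by move=> a y a0; rewrite Zp// Zq// minr_pMr.
- exists (Num.max C D) => [|y]; first by rewrite lt_max C0.
  have py : 0 <= p y by rewrite -(pmulr_rge0 _ C0) (le_trans _ (hC y)).
  have qy : 0 <= q y by rewrite -(pmulr_rge0 _ D0) (le_trans _ (hD y)).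
  case: (leP (p y) (q y)) => _; [apply: le_trans (hC y) _|apply: le_trans (hD y) _];
    by rewrite ler_wpM2r// le_max lexx ?orbT.
Qed.

Lemma gauge_bigmax (I : Type) (r : seq I) p0 (p : I -> 'rV[R]_m.+1 -> R) : gauge p0 ->
  (forall i, gauge (p i)) -> gauge (fun y => \big[Num.max/p0 y]_(i <- r) p i y).
Proof.
move=> h0 h; elim: r => [|i r IH].
  by rewrite (_ : (fun y => _) = p0)//; apply/funext => y; rewrite big_nil.
rewrite (_ : (fun y => _) =
    fun y => Num.max (p i y) (\big[Num.max/p0 y]_(i <- r) p i y)).
  exact: gauge_max.
by apply/funext => y; rewrite big_cons.
Qed.

Lemma gauge_bigmin (I : Type) (r : seq I) p0 (p : I -> 'rV[R]_m.+1 -> R) : gauge p0 ->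
  (forall i, gauge (p i)) -> gauge (fun y => \big[Num.min/p0 y]_(i <- r) p i y).
Proof.
move=> h0 h; elim: r => [|i r IH].
  by rewrite (_ : (fun y => _) = p0)//; apply/funext => y; rewrite big_nil.
rewrite (_ : (fun y => _) =
    fun y => Num.min (p i y) (\big[Num.min/p0 y]_(i <- r) p i y)).
  exact: gauge_min.
by apply/funext => y; rewrite big_cons.
Qed.

Lemma gauge_gt1_nonempty p : gauge p -> [set y | 1 < p y] !=set0.
Proof.
move=> hp; have v0 : const_mx 1 != 0 :> 'rV[R]_m.+1.
  by apply/eqP => /rowP/(_ 0)/eqP; rewrite !mxE oner_eq0.
have pv := gauge_gt0 hp v0.
exists ((2 / p (const_mx 1)) *: const_mx 1) => /=.
rewrite (gaugeZ hp) ?divr_ge0 ?ltW// divfK ?lt0r_neq0//; lra.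
Qed.

End GaugeLattice.

(** * All regions of the diagram *)

Section Cells.
Variables (R : realType) (n d : nat).
Hypothesis n0 : (0 < n)%N.
Implicit Types (b : nat -> bool) (y : 'rV[R]_d.+2).
Local Notation cell := (@cell R n d).

(** The minimum starts from a gauge, as [gauge_bigmin] requires; [enorm] dominates every [vgauge]
    and leaves the minimum unchanged. *)
Lemma empty_cellE y :
  cell (fun k => (k < 0)%N) y <-> 1 < \big[Num.min/enorm y]_(i < n) vgauge n i y.
Proof.
split=> [h|/bigmin_gtP[_ h] k kn].
  have h' (i : 'I_n) : 1 < vgauge n i y by rewrite vgauge_gt1; exact: h.
  apply/bigmin_gtP; split=> // .
  apply: lt_le_trans (h' (Ordinal n0)) _.
  exact: cone_gauge_le (field_norm n 0) (amp_norm R n 0) y.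
by rewrite -vgauge_gt1; exact: (h (Ordinal kn)).
Qed.

(** Dually, a third of [enorm] lies below every [vgauge], the radii being at most 3. *)
Lemma full_cellE y :
  cell (fun k => (k < n)%N) y <-> \big[Num.max/3^-1 * enorm y]_(i < n) vgauge n i y < 1.
Proof.
split=> [h|/bigmax_ltP[_ h] k kn].
  have h' (i : 'I_n) : vgauge n i y < 1.
    by rewrite vgauge_lt1; have := h i (ltn_ord i); rewrite ltn_ord.
  apply/bigmax_ltP; split=> //.
  apply: le_lt_trans (h' (Ordinal n0)); rewrite mulrC.
  exact: cone_gauge_ge (field_norm n 0) (amp_norm R n 0) y.
by rewrite kn -vgauge_lt1; exact: (h (Ordinal kn)).
Qed.

Definition good_region (A : set 'rV[R]_d.+2) := [/\ A !=set0, connected A &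
  exists X, surface_in d.+2 [set: 'rV[R]_d.+2] X /\
   (homeomorphic A (surface_interior d.+2 [set: 'rV[R]_d.+2] X) \/
    homeomorphic A (surface_exterior d.+2 [set: 'rV[R]_d.+2] X))].

Lemma good_homeomorphic_setT (A : set 'rV[R]_d.+2) :
  homeomorphic A [set: 'rV[R]_d.+2] -> good_region A.
Proof.
move=> hA; have hA' := homeomorphic_sym hA; split.
- by apply: homeomorphic_nonempty hA' _; exists 0.
- by apply: homeomorphic_connected hA' _; exact: connected_setT.
- have [X [sX hX]] := homeomorphic_setT_interior hA.
  by exists X; split => //; left.
Qed.

(** A pattern without gap is an initial segment of some length [j]. For [j = 0] the cell is the
    exterior of a minimum of gauges, for [j = n] the interior of a maximum; only intermediate
    lengths need the view from the pole. *)
Lemma good_cell b : good_region (cell b).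
Proof.
have [gb|/no_gap[j jn hb]] := pselect (has_gap n b).
  exact: good_homeomorphic_setT (@gap_cell_homeomorphic R n d b n0 gb).
have -> : cell b = cell (fun k => (k < j)%N).
  by apply/seteqP; split => y h k kn; have := h k kn; rewrite hb.
have vg (i : 'I_n) : gauge (@vgauge R n d i) by exact: vgauge_gauge.
have [j0|j0] := posnP j.
  rewrite j0; pose p y := \big[Num.min/enorm y]_(i < n) vgauge n i y.
  have hp : gauge p by apply: gauge_bigmin => //; exact: enorm_gauge.
  have -> : cell (fun k => (k < 0)%N) = [set y | 1 < p y].
    by apply/seteqP; split => y /empty_cellE.
  split; [exact: gauge_gt1_nonempty|exact: gauge_gt1_connected|].
  exists [set y | p y = 1]; split; first exact: gauge_surface.
  by right; rewrite gauge_exterior//; exact: homeomorphic_refl.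
apply: good_homeomorphic_setT.
move: jn; rewrite leq_eqVlt => /predU1P[->|jn]; last exact: prefix_cell_homeomorphic.
pose p y := \big[Num.max/3^-1 * enorm y]_(i < n) vgauge n i y.
have hp : gauge p by apply: gauge_bigmax => //; apply: gaugeM; [|exact: enorm_gauge].
have -> : cell (fun k => (k < n)%N) = [set y | p y < 1].
  by apply/seteqP; split => y /full_cellE.
exact: gauge_lt1_homeomorphic.
Qed.

Lemma regionE (e : 'I_n -> bool) :
  region d.+2 [set: 'rV[R]_d.+2] (fun i : 'I_n => sphere n i) e =
  cell (fun k => if insub k is Some i then ~~ e i else false).
Proof.
have sideE (i : 'I_n) y : side d.+2 [set: 'rV[R]_d.+2] (sphere n i) (e i) y <->
    if ~~ e i then enorm y < vradius n i y else vradius n i y < enorm y.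
  have vg : gauge (@vgauge R n d i) by exact: vgauge_gauge.
  rewrite /side /sphere; case: (e i); rewrite ?(gauge_exterior vg) ?(gauge_interior vg) /=.
    by rewrite vgauge_gt1.
  by rewrite vgauge_lt1.
apply/seteqP; split => y hy.
  by move=> k kn; rewrite insubT; apply/sideE/hy.
move=> i _; apply/sideE; by have := hy i (ltn_ord i); rewrite valK.
Qed.

End Cells.

(** * Triple intersections as finite unions of spheres *)

Section Triples.
Variables (R : realType) (n d : nat).
Local Notation amp := (amp R n).
Local Notation sphere := (@sphere R n d).

Lemma norm_sphere_homeomorphic m (r : R) : 0 < r ->
  homeomorphic [set z : 'rV[R]_m.+1 | `|z| = r] (@unit_sphere R m.+1).
Proof.
move=> r0; have hp : gauge (fun z : 'rV[R]_m.+1 => r^-1 * `|z|).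
  apply: gaugeM; first by rewrite invr_gt0.
  split; [by move=> z; exact: norm_continuous|by move=> a z a0; rewrite normrZ ger0_norm|].
  by exists 1 => // z; rewrite mul1r.
have -> : [set z : 'rV[R]_m.+1 | `|z| = r] = [set z | r^-1 * `|z| = 1].
  apply/seteqP; split => z /= h; first by rewrite h mulVf// lt0r_neq0.
  by rewrite -[LHS](mulVKf (lt0r_neq0 r0)) h mulr1.
exact: gauge_sphere hp.
Qed.

(** By [field_triple] the abscissa is one of finitely many: [xs] lists the two points of each pit
    where its profile equals [amp k / amp i]. Each retained one contributes a sphere of radius [r]
    about the axis. *)
Lemma sphere_triple_surfaces i j k : (i < j)%N -> (j < k < n)%N ->
  finite_union_of_surfaces d (sphere i `&` (sphere j `&` sphere k)).
Proof.
move=> ij jkn; have [jk kn] := andP jkn.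
have ik := ltn_trans ij jk.
have k0 : 0 < amp k / amp i by rewrite divr_gt0// amp_gt0.
have k1 : amp k / amp i < 1 by rewrite ltr_pdivrMr ?amp_gt0// mul1r amp_lt.
set r := depth R n j + (amp k / amp j) / 4.
have r0 : 0 < r.
  by rewrite ltr_wpDl ?ler0n// !divr_gt0// amp_gt0.
pose f X z := @lift_graph R n d i (row_cons (X - 2 ^+ n) z).
pose xs := [seq pit_center R n i P + x | P <- iota 0 (2 ^ i.-1),
  x <- [:: width R n i + amp k / amp i / 4; - (width R n i + amp k / amp i / 4)]].
pose good := [seq X <- xs | (wave n i X == amp k / amp i) && (wave n j X == -1)].
rewrite (_ : _ `&` _ = \bigcup_(X in [set` good]) (f X @` [set z | `|z| = r])); last first.
  apply/seteqP; split => [y [hi [hj hk]]|y [X /= hX [z /= zr <-]]].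
    have [q e1 ey] := sphere_pair ij hi hj.
    have e2 : field n j q = field n k q.
      by rewrite -e1; apply/esym; move: hk; rewrite ey => /sphere_lift_graph.
    have [h1 h2 h3] := (field_triple q ij jkn).1 (conj e1 e2).
    exists (q 0 0 + 2 ^+ n); last first.
      by exists (row_tail q) => //; rewrite /f addrK row_eta.
    rewrite /= mem_filter h1 h2 !eqxx /=.
    have [|P Pi eP] := @wave_pit R n i (q 0 0 + 2 ^+ n); first by rewrite h1.
    have eX : `|q 0 0 + 2 ^+ n - pit_center R n i P| = width R n i + amp k / amp i / 4.
      move: h1; rewrite eP /pit; case: clampP; lra.
    apply/allpairsP; have [x0|x0] := leP 0 (q 0 0 + 2 ^+ n - pit_center R n i P).
      exists (P, width R n i + amp k / amp i / 4); split => /=; rewrite ?inE ?eqxx ?mem_iota//.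
      by rewrite -eX ger0_norm//; ring.
    exists (P, - (width R n i + amp k / amp i / 4)); split => /=;
      rewrite ?inE ?eqxx ?orbT ?mem_iota//.
    by rewrite -eX ltr0_norm//; ring.
  move: hX; rewrite mem_filter => /andP[/andP[/eqP h1 /eqP h2] _].
  have [e1 e2] : field n i (row_cons (X - 2 ^+ n) z) = field n j (row_cons (X - 2 ^+ n) z) /\
      field n j (row_cons (X - 2 ^+ n) z) = field n k (row_cons (X - 2 ^+ n) z).
    by apply/(field_triple _ ij jkn); rewrite row_cons0 subrK row_consK.
  split; first exact/sphere_lift_graph.
  by split; apply/sphere_lift_graph; rewrite e1.
apply: finite_union_seq => X _.
(* For [d = 0], the planar case, there is no transverse direction: the norm of [z] is 0 while [r] is
   positive, so three curves never meet. *)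
move: @f; case: d => [|d'] f.
  rewrite (_ : [set z | _] = set0) ?image_set0; first by exists set0.
  apply/seteqP; split => z //= zr; move: r0; rewrite -zr (_ : z = 0) ?normr0 ?ltxx//.
  by apply/rowP => -[].
apply: (@surface_embedding _ _ _ _ (fun y => row_tail (stereo y))).
- move=> z; apply: (@ct_comp _ _ _ (fun z : 'rV[R]_d'.+1 => row_cons (X - 2 ^+ n) z)
    (@lift_graph R n d'.+1 i)); last exact: lift_graph_continuous.
  by apply: ct_row_cons; [exact: ct_cst|exact: ct_id].
- by move=> z; rewrite stereo_lift_graph row_consK.
- apply: (within_comp (B := setT)) => //.
    by apply: (@stereo_graph_continuous _ _ _ _ i) => _ [z _ <-]; eexists.
  by apply: continuous_subspaceT => q; apply: ct_row_tail; exact: ct_id.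
- exact: norm_sphere_homeomorphic.
Qed.

End Triples.

(** * Assembling the diagram *)

Lemma setU1_min n k (A : {set 'I_n}) : #|A| = k.+1 -> exists i (B : {set 'I_n}),
  [/\ A = i |: B, #|B| = k & forall j, j \in B -> (i < j)%N].
Proof.
move=> cA; have /card_gt0P[x Ax] : (0 < #|A|)%N by rewrite cA.
case: (@arg_minnP _ x (mem A) val Ax) => i Ai hi.
exists i, (A :\ i); split; first by rewrite finset.setD1K.
  by have := cardsD1 i A; rewrite (Ai : i \in A) cA add1n => -[].
move=> j; rewrite !inE => /andP[ji Aj].
by rewrite ltn_neqAle eq_sym ji hi.
Qed.

Lemma bigcap_setU1 (T : Type) n (S : 'I_n -> set T) i (B : {set 'I_n}) :
  \bigcap_(j in [set` i |: B]) S j = S i `&` \bigcap_(j in [set` B]) S j.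
Proof.
apply/seteqP; split => [x h|x [hi h] j] /=.
  split; first by apply: h; rewrite /= !inE eqxx.
  by move=> j /= jB; apply: h; rewrite /= !inE jB orbT.
by rewrite !inE => /orP[/eqP ->//|]; exact: h.
Qed.

Theorem theorem1 (R : realType) (m n : nat) (hm : (2 <= m)%N) (hn : (1 <= n)%N) :
  exists (d : nat) (T : set 'rV[R]_d) (S : 'I_n -> set 'rV[R]_d),
    simple_venn_diagram m T S.
Proof.
case: m hm => [|[|d]]// _.
pose S (i : 'I_n) : set 'rV[R]_d.+2 := sphere n i.
have surf (i : 'I_n) : surface_in d.+2 [set: 'rV[R]_d.+2] (S i).
  exact/gauge_surface/vgauge_gauge.
have inter (k : nat) (A : {set 'I_n}) : (0 < k)%N -> #|A| = k ->
    finite_union_of_surfaces (d.+3 - k) (\bigcap_(i in [set` A]) S i).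
  (* Least indices are peeled off one at a time, since the intersection lemmas take increasing
     indices. *)
  case: k => // k _ /setU1_min[i [A1 [-> c1 h1]]]; rewrite bigcap_setU1.
  case: k c1 => [/eqP|k].
    rewrite cards_eq0 => /eqP ->; rewrite subn1 /=.
    rewrite (_ : \bigcap_(_ in _) _ = setT) ?setIT.
      exists 1%N, (fun=> S i); split; first by move=> _; exists setT; exact: surf.
      by apply/seteqP; split => [y hy|y [_ _]//]; exists ord0.
    by apply/seteqP; split => // y _ j /=; rewrite inE.
  move=> /setU1_min[j [A2 [A1E c2 h2]]].
  have ij : (i < j)%N by apply: h1; rewrite A1E !inE eqxx.
  rewrite A1E bigcap_setU1.
  case: k c2 => [/eqP|k].
    rewrite cards_eq0 => /eqP ->; rewrite (_ : d.+3 - 2 = d.+1)%N; last by lia.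
    rewrite (_ : \bigcap_(_ in _) _ = setT) ?setIT.
      by apply: sphere_pair_surfaces; rewrite ij ltn_ord.
    by apply/seteqP; split => // y _ l /=; rewrite inE.
  move=> /setU1_min[l [A3 [A2E c3 h3]]].
  have jl : (j < l)%N by apply: h2; rewrite A2E !inE eqxx.
  rewrite A2E bigcap_setU1.
  case: k c3 => [/eqP|k].
    rewrite cards_eq0 => /eqP ->; rewrite (_ : d.+3 - 3 = d)%N; last by lia.
    rewrite (_ : \bigcap_(_ in _) _ = setT) ?setIT.
      by apply: sphere_triple_surfaces => //; rewrite jl ltn_ord.
    by apply/seteqP; split => // y _ l' /=; rewrite inE.
  move=> /setU1_min[l' [A4 [A3E _ _]]].
  have ll' : (l < l')%N by apply: h3; rewrite A3E !inE eqxx.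
  (* Four surfaces have no common point, and the empty union is allowed in every dimension,
     including the truncated ones. *)
  rewrite A3E bigcap_setU1 (_ : _ `&` _ = set0); first exact: finite_union_set0.
  apply/seteqP; split => // y [hi [hj [hl [hl' _]]]].
  have ll'n : (l < l' < n)%N by rewrite ll' ltn_ord.
  exact: (sphere_quadruple ij jl ll'n hi hj hl hl').
exists d.+2, setT, S; split; last exact: inter.
split; [exact: mspace_setT|exact: surf| |].
  by move=> e; rewrite regionE; exact: good_cell.
move=> i j ij; have := inter 2%N (i |: [set j])%SET isT.
rewrite [#|_|]cards2 ij => /(_ erefl); rewrite (_ : d.+3 - 2 = d.+1)%N; last by lia.
rewrite (_ : \bigcap_(_ in _) _ = S i `&` S j)//.
rewrite bigcap_setU1; congr (_ `&` _).
apply/seteqP; split => [y h|y hj l /=]; first by apply: h; rewrite /= inE.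
by rewrite inE => /eqP ->.
Qed.
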